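(* Let $n\ge 0$ and $p\ge 1$ be integers. Let $\mathcal F_{n,p}^{\mathrm{cc}}$ be the set of forests with $p$ trees and $n$ edges carrying two distinguished corners, let $\mathcal F_{n+1,p}^{\mathrm{ev}}$ be the set of forests with $p$ trees and $n+1$ edges carrying a distinguished edge and a distinguished vertex, and let $\Psi_{n\uparrow,p}$ and $\Psi_{n+1\downarrow,p}$ be the explicit cut-and-glue mappings defined in the context. Then the mappings $$\Psi_{n\uparrow,p}:\mathcal F_{n,p}^{\mathrm{cc}}\to\mathcal F_{n+1,p}^{\mathrm{ev}}\qquad\text{and}\qquad \Psi_{n+1\downarrow,p}:\mathcal F_{n+1,p}^{\mathrm{ev}}\to\mathcal F_{n,p}^{\mathrm{cc}}$$ are one-to-one and reverse one from another (that is, they are bijections inverse to each other).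
   Context: **Maps.** A planar map is an embedding of a finite connected graph (loops and multiple edges allowed) in the oriented two-dimensional sphere, up to direct homeomorphisms. Faces are the connected components of the complement of the edges. A half-edge is an edge with one of its two orientations; for a half-edge $h$, $h^-$ is its origin, $h^+$ its end, $\mathrm{rev}(h)$ its reverse. A half-edge is incident to a face if it belongs to the boundary of the face and the face lies to its left. A corner of a face is an angular sector delimited by two consecutive half-edges $h,h'$ incident to the face (the map reduced to one vertex has one corner). A corner $c$ is also viewed as a half-edge with no origin, only an end $c^+:=h^+=h'^-$ (a dangling half-edge lying in the face and pointing at the vertex). Maps are rooted: one corner is distinguished. **Forests.** A tree is a rooted planar map with one face (the tree with one vertex and no edge is allowed). A forest with $p$ trees and $n$ edges is a $p$-tuple $\mathfrak f=(\mathfrak t_1,\dots,\mathfrak t_p)$ of trees with $n$ edges in total; $\mathcal F_{n,p}$ is the set of these. Let $\rho_i$ be the root vertex of $\mathfrak t_i$ and $\rho_{p+1}:=\rho_1$. For $1\le i\le p$ one adds an extra half-edge from $\rho_i$ to $\rho_{i+1}$, arriving and leaving in the root corners of the trees, so that the forest becomes a map with two faces: an inner face of degree $p$, bounded by the simple cycle formed by the extra half-edges and lying to their right, and an outer face containing the trees and lying to the left of the extra half-edges. Extra half-edges may be used by paths only in the direction $\rho_i\to\rho_{i+1}$; they do not count as edges of the forest. The corners of the forest are the corners of the outer face. An element of $\mathcal F_{n,p}$ has $n$ edges, $n+p$ vertices and $2n+p$ corners. The contour is the cyclic sequence of half-edges incident to the outer face (travelled with the outer face to the left), starting with tree $\mathfrak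 t_1$, then $\mathfrak t_2$, etc.; it orders the corners (cyclically). **Distinguishing twice.** Distinguishing a corner splits it into two new corners; so when the same corner is distinguished a second time, one specifies on which of its two sides (before or after the first one in the contour) it is distinguished. Thus a first corner has $2n+p$ possibilities and a second one has $2n+p+1$. **Paths.** A path from $v$ to $v'$ is a finite sequence $\mathbf p=(\mathbf p_1,\dots,\mathbf p_\ell)$ of half-edges with $\mathbf p_1^-=v$, $\mathbf p_k^+=\mathbf p_{k+1}^-$, $\mathbf p_\ell^+=v'$; its length is $[\mathbf p]=\ell$; the empty path has length $0$. It is self-avoiding if it visits no vertex twice. $\mathrm{rev}(\mathbf p)=(\mathrm{rev}(\mathbf p_\ell),\dots,\mathrm{rev}(\mathbf p_1))$ and $\bullet$ denotes concatenation. A half-edge is directed away from a vertex if its origin is strictly closer (for the graph distance) to this vertex than its end. **Cutting and gluing.** Given two distinguished corners $a,b$ of the outer face and a self-avoiding path $\mathbf q$ from $a^+$ to $b^+$, cutting along $\mathbf q$ between $a$ and $b$ produces two maps: the left part, made of all the elements encountered between $a$ and $b$ in the (cyclic) contour together with a copy of $\mathbf q$, and the right part, made of all the elements encountered between $b$ and $a$ in the (cyclic) contour together with a copy of $\mathbf q$. (Topologically, these are what lies to the left, resp. to the right, of the curve entering through $a$, following $\mathbf q$, and leaving through $b$; the inner face lies in exactly one part.) Matching a half-edge of the left part with a half-edge of the right part means identifying them, origin with origin and end with end, so that the left part lies to the left and the right part to the right of the resulting path. The inner face, with the mark indicating which tree is the first, is kept unchanged. **Definition of $\Psi_{n\uparrow,p}$.**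 Let $(\mathfrak f;c,c')\in\mathcal F_{n,p}^{\mathrm{cc}}$, where $c$ is the first and $c'$ the second distinguished corner. Let $\mathbf p$ be the only self-avoiding path from $c^+$ to $c'^+$. Cut along $\mathbf p$ between $c$ and $c'$. In the left part consider $c$ as an extra half-edge (with a new vertex as origin) and set $\mathbf l:=c\bullet\mathbf p$; in the right part consider $c'$ as an extra half-edge (with a new vertex as origin) and set $\mathbf r:=\mathbf p\bullet\mathrm{rev}(c')$. The forest $\mathfrak f'$ is obtained by gluing back both parts while matching $\mathbf l_k$ with $\mathbf r_k$ for $1\le k\le[\mathbf l]=[\mathbf r]$. In $\mathfrak f'$ let $e$ be the edge corresponding to $\mathbf l_{[\mathbf l]}$ and $v:=\mathbf l_1^-$. Set $\Psi_{n\uparrow,p}(\mathfrak f;c,c'):=(\mathfrak f';e,v)$. **Definition of $\Psi_{n+1\downarrow,p}$.** Let $(\mathfrak f';e,v)\in\mathcal F_{n+1,p}^{\mathrm{ev}}$. Let $\vec e$ be the half-edge corresponding to $e$ directed away from $v$ and $\mathbf p$ the only self-avoiding path from $v$ to $\vec e^{\,-}$. Cut along $\mathbf p\bullet\vec e$ between, on the one hand, the corner delimited by $(\mathbf p\bullet\vec e)_1$ and its predecessor in the contour and, on the other hand, the corner delimited by $\mathrm{rev}(\vec e)$ and its predecessor in the contour. Let $\mathbf l$ and $\mathbf r$ be the images of $\mathbf p\bullet\vec e$ in the left part and in the right part. The forest $\mathfrak f$ is obtained by gluing back the parts while matching $\mathbf l_{k+1}$ with $\mathbf r_k$ for $1\le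 k\le[\mathbf l]-1$ (if $[\mathbf l]=1$, one only identifies the vertices $\mathbf l_1^+$ and $\mathbf r_1^-$). In the left part nothing except $\mathbf l_1$ is attached to $\mathbf l_1^-$, and in the right part nothing except $\mathbf r_{[\mathbf r]}$ is attached to $\mathbf r_{[\mathbf r]}^+$; the dangling half-edges $\mathbf l_1$ and $\mathrm{rev}(\mathbf r_{[\mathbf r]})$, which are not glued with anything, are replaced by the corners, denoted respectively $c$ and $c'$, that they define in $\mathfrak f$. Set $\Psi_{n+1\downarrow,p}(\mathfrak f';e,v):=(\mathfrak f;c,c')$. *)

(* Defs.v *)
From HB Require Import structures.
From mathcomp Require Import all_boot.

Set Implicit Arguments.
Unset Strict Implicit.
Unset Printing Implicit Defensive.

(* A rooted planar map with one face, up to direct homeomorphism, is a finite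
   ordered tree; the subtrees of a vertex are listed in the order in which the
   contour (outer face on the left, starting from the root corner) meets
   them. *)
Inductive tree := Node of seq tree.

Definition leaf := Node [::].

Fixpoint tree_edges (t : tree) : nat :=
  let: Node ts := t in sumn [seq (tree_edges t').+1 | t' <- ts].

Definition forest_edges (f : seq tree) : nat := sumn [seq tree_edges t | t <- f].

Definition forest (n p : nat) := {f : p.-tuple tree | forest_edges f == n}.

(* [(i, s)] is a vertex of the i-th tree (counted from 0); [s] lists the child
   ranks on the path from the vertex up to the root, so [behead] leads to the
   parent and [[::]] is the root. *)
Definition vertex := (nat * seq nat)%type.
Definition root (i : nat) : vertex := (i, [::]).
Definition child (x : vertex) (k : nat) : vertex := (x.1, k :: x.2).
Definition parent (x : vertex) : vertex := (x.1, behead x.2).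

(* An edge of the forest is named after its end furthest from the root:
   [Down x] goes from [parent x] to [x] and [Up x] is its reverse.  [Ext i] is
   the extra half-edge from the i-th root to the next one (cyclically), and
   [Inn i] is its reverse, which is the side incident to the inner face. *)
Inductive half_edge :=
  Down of vertex | Up of vertex | Ext of nat | Inn of nat.

Definition half_edge_code (h : half_edge) : (bool * vertex) + (bool * nat) :=
  match h with
  | Down x => inl (true, x) | Up x => inl (false, x)
  | Ext i => inr (true, i) | Inn i => inr (false, i)
  end.

Definition half_edge_decode (c : (bool * vertex) + (bool * nat)) : half_edge :=
  match c with
  | inl (b, x) => if b then Down x else Up x
  | inr (b, i) => if b then Ext i else Inn i
  end.

Lemma half_edge_codeK : cancel half_edge_code half_edge_decode.
Proof. by case. Qed.

HB.instance Definition _ := Equality.copy half_edge (can_type half_edge_codeK).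

Definition hrev (h : half_edge) : half_edge :=
  match h with
  | Down x => Up x | Up x => Down x | Ext i => Inn i | Inn i => Ext i
  end.

Definition is_ext (h : half_edge) : bool := if h is Ext _ then true else false.

(* Origin and end of a half-edge, [p] being the number of trees. *)
Definition org (p : nat) (h : half_edge) : vertex :=
  match h with
  | Down x => parent x
  | Up x => x
  | Ext i => root i
  | Inn i => root (i.+1 %% p)
  end.

Definition fin (p : nat) (h : half_edge) : vertex := org p (hrev h).

Fixpoint tree_contour (x : vertex) (t : tree) : seq half_edge :=
  let: Node ts := t in
  (fix contour_from (k : nat) (ts : seq tree) : seq half_edge :=
     if ts is t' :: ts' then
       Down (child x k) :: tree_contour (child x k) t'
         ++ Up (child x k) :: contour_from k.+1 ts'
     else [::]) 0 ts.

(* The half-edges incident to the outer face.  These are also exactly the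
   half-edges that a path may use. *)
Definition contour (f : seq tree) : seq half_edge :=
  flatten [seq rcons (tree_contour (root i) (nth leaf f i)) (Ext i)
          | i <- iota 0 (size f)].

Definition vertices (f : seq tree) : seq vertex :=
  undup [seq org (size f) h | h <- contour f].

Definition edges (f : seq tree) : pred vertex := [pred x | Down x \in contour f].

Fixpoint is_path (f : seq tree) (x : vertex) (q : seq half_edge) (y : vertex) :
    bool :=
  if q is h :: q' then
    [&& h \in contour f, org (size f) h == x & is_path f (fin (size f) h) q' y]
  else x == y.

Definition self_avoiding (f : seq tree) (x : vertex) (q : seq half_edge)
    (y : vertex) : bool :=
  is_path f x q y && uniq (x :: [seq fin (size f) h | h <- q]).

Definition the_self_avoiding (f : seq tree) (x : vertex) (q : seq half_edge)
    (y : vertex) : Prop :=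
  unique (fun q' => self_avoiding f x q' y) q.

Definition path_rev (q : seq half_edge) : seq half_edge := rev (map hrev q).

Definition is_dist (f : seq tree) (x y : vertex) (d : nat) : Prop :=
  (exists2 q, is_path f x q y & size q = d) /\
  (forall q, is_path f x q y -> d <= size q).

Definition directed_away (f : seq tree) (v : vertex) (h : half_edge) : Prop :=
  exists d d', [/\ is_dist f v (org (size f) h) d,
                   is_dist f v (fin (size f) h) d' & d < d'].

(* The corners of the outer face are numbered from 0 along the contour: the
   corner [c] is the one that precedes the half-edge number [c], so its vertex
   is the origin of that half-edge. *)
Definition corner_vertex (f : seq tree) (c : nat) : vertex :=
  org (size f) (nth (Ext 0) (contour f) c).

(* Distinguishing [c] splits it into two corners, which get the numbers [c]
   (the side before) and [c.+1] (the side after); the corners that follow are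
   shifted by one.  Hence the second corner [c'] ranges over one more value,
   and it comes from the original corner number [unbump c c'].  The number of
   half-edges met from [c] to [c'], out of [N] on the contour, is: *)
Definition gap (N c c' : nat) : nat :=
  if c < c' then c'.-1 - c else N - (c - c').

(* Forests with two distinguished corners; the bounds are the numbers of
   corners available to the first one and to the second one. *)
Record forest_cc (n p : nat) := ForestCC {
  cc_forest : forest n p;
  cc_first : 'I_(2 * n + p);
  cc_second : 'I_(2 * n + p).+1
}.

Record forest_ev (n p : nat) := ForestEV {
  ev_forest : forest n p;
  ev_edge : vertex;
  ev_vertex : vertex;
  ev_edgeP : ev_edge \in edges (val ev_forest);
  ev_vertexP : ev_vertex \in vertices (val ev_forest)
}.

(* A combinatorial map with an outer face and at most one inner face.  [outer]
   and [inner] list the half-edges incident to each of them, travelled with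
   the face on the left; [outer] is to be read cyclically, while [inner]
   starts at the mark, and is empty if there is no inner face.  Vertices are
   implicit: the half-edges with the same origin are the orbits of "take the
   successor, in its face, of the reverse". *)
Record cmap (D : Type) := CMap {
  outer : seq D;
  inner : seq D;
  mrev : D -> D
}.

Definition darts (D : Type) (M : cmap D) : seq D := outer M ++ inner M.

(* The mark is at the root of the first tree. *)
Definition forest_map (f : seq tree) : cmap half_edge :=
  CMap (contour f) [seq Inn i | i <- rev (iota 0 (size f))] hrev.

(* [g] is an isomorphism of maps that preserves the marked inner face and
   sends the starting point of [outer M] to the corner number [k] of [M']. *)
Definition is_iso (D D' : eqType) (M : cmap D) (M' : cmap D') (k : nat)
    (g : D -> D') : Prop :=
  [/\ {in darts M &, injective g},
      map g (outer M) = rot k (outer M'),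
      map g (inner M) = inner M' &
      {in darts M, forall d, g (mrev M d) = mrev M' (g d)}].

(* Cutting along a path [q] from [a] to [b]: [A] lists the half-edges of the
   contour met from [a] to [b] and [B] those met from [b] to [a].  A half-edge
   of [q] or its reverse has the same name in both parts, which are only made
   disjoint when they are glued.  In each part, the side created by the cut
   closes the outer face; the outer face of the left part is listed from [a]
   and the outer face of the right part from [b].  As the inner face lies to
   the right of the extra half-edges, it belongs to the right part if and only
   if an extra half-edge is incident to the outer face of that part. *)
Definition inner_on_right (B q : seq half_edge) : bool := has is_ext (B ++ q).

Definition left_part (f : seq tree) (A B q : seq half_edge) : cmap half_edge :=
  CMap (A ++ path_rev q)
       (if inner_on_right B q then [::] else inner (forest_map f)) hrev.

Definition right_part (f : seq tree) (A B q : seq half_edge) : cmap half_edge :=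
  CMap (B ++ q)
       (if inner_on_right B q then inner (forest_map f) else [::]) hrev.

(* The corner at which [outer] starts becomes an edge to a new vertex:
   [inr true] is the half-edge whose origin is the new vertex. *)
Definition add_dangling (D : Type) (M : cmap D) : cmap (D + bool) :=
  CMap (inr true :: rcons (map inl (outer M)) (inr false))
       (map inl (inner M))
       (fun d => match d with
                 | inl h => inl (mrev M h)
                 | inr b => inr (~~ b)
                 end).

(* The dangling edge of [d] is replaced by a corner. *)
Definition remove_dangling (D : eqType) (M : cmap D) (d : D) : cmap D :=
  CMap [seq x <- outer M | (x != d) && (x != mrev M d)] (inner M) (mrev M).

Definition partner (S T : eqType) (m : seq (S * T)) (x : S) : option T :=
  ohead [seq z.2 | z <- m & z.1 == x].

(* [m] lists the matched pairs (half-edge of the left part, half-edge of the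
   right part).  For a matched pair (x, y), the left side of x (towards the
   left part) and the left side of the reverse of y (towards the right part)
   survive and become the two sides of a single edge; the reverse of x and y
   disappear.  The outer faces are merged at the corners where they start,
   which also identifies the vertices of these corners when [m] is empty. *)
Definition left_kept (D : eqType) (T : eqType) (L : cmap D) (m : seq (D * T)) :
    seq D :=
  [seq x <- outer L | mrev L x \notin unzip1 m].

Definition right_kept (D : eqType) (T : eqType) (R : cmap T) (m : seq (D * T)) :
    seq T :=
  [seq y <- outer R | y \notin unzip2 m].

Definition glue (DL DR : eqType) (L : cmap DL) (R : cmap DR)
    (m : seq (DL * DR)) : cmap (DL + DR) :=
  CMap (map inl (left_kept L m) ++ map inr (right_kept R m))
       (map inl (inner L) ++ map inr (inner R))
       (fun d => match d with
                 | inl x => if partner m x is Some y then inr (mrev R y)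
                            else inl (mrev L x)
                 | inr y => if partner [seq (z.2, z.1) | z <- m] (mrev R y)
                              is Some x then inl x
                            else inr (mrev R y)
                 end).

(* [Psi_up_rel (f; c, c') (f'; e, v)]: the cut-and-glue construction applied
   to (f; c, c') yields (f'; e, v). *)
Definition Psi_up_rel (n p : nat) (X : forest_cc n p) (Y : forest_ev n.+1 p) :
    Prop :=
  let f : seq tree := val (cc_forest X) in
  let f' : seq tree := val (ev_forest Y) in
  let c : nat := cc_first X in
  let c' : nat := cc_second X in
  let C := rot c (contour f) in
  let A := take (gap (size C) c c') C in
  let B := drop (gap (size C) c c') C in
  exists2 q : seq half_edge,
    the_self_avoiding f (corner_vertex f c) q (corner_vertex f (unbump c c')) &
    let L := add_dangling (left_part f A B q) in
    let R := add_dangling (right_part f A B q) in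
    let l : seq (half_edge + bool) := inr true :: map inl q in
    let r : seq (half_edge + bool) := rcons (map inl q) (inr false) in
    exists k g,
      [/\ is_iso (glue L R (zip l r)) (forest_map f') k g,
          g (inl (last (inr true) l)) \in [:: Down (ev_edge Y); Up (ev_edge Y)] &
          org (size f') (g (inl (inr true))) = ev_vertex Y].

(* [Psi_down_rel (f'; e, v) (f; c, c')]: the reverse cut-and-glue construction
   applied to (f'; e, v) yields (f; c, c').  Here [h] is the half-edge of [e]
   directed away from [v], and [zip (behead s) s] matches the (k+1)-st
   half-edge of the left copy of [s] with the k-th one of the right copy, the
   last half-edge of the latter being unmatched.  The dangling half-edges are
   turned into corners before gluing: they sit at the starting corners of the
   two outer faces, so that [c] ends up at the beginning of what remains of
   the left part and [c'] at its end. *)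
Definition Psi_down_rel (n p : nat) (Y : forest_ev n.+1 p) (X : forest_cc n p) :
    Prop :=
  let f' : seq tree := val (ev_forest Y) in
  let f : seq tree := val (cc_forest X) in
  let v := ev_vertex Y in
  exists h : half_edge, exists q : seq half_edge,
    [/\ h \in [:: Down (ev_edge Y); Up (ev_edge Y)],
        directed_away f' v h,
        the_self_avoiding f' v q (org (size f') h) &
        let s := rcons q h in
        let s1 := head h q in
        let C := rot (index s1 (contour f')) (contour f') in
        let A := take (index (hrev h) C) C in
        let B := drop (index (hrev h) C) C in
        let L := remove_dangling (left_part f' A B s) s1 in
        let R := remove_dangling (right_part f' A B s) h in
        let m := zip (behead s) s in
        exists2 g, is_iso (glue L R m) (forest_map f) (cc_first X) g &
          gap (size (contour f)) (cc_first X) (cc_second X)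
            = size (left_kept L m)].

(* Main.v *)
From mathcomp Require Import all_boot zify.
From Stdlib Require Import IndefiniteDescription.
Require Import Defs.

Set Implicit Arguments.
Unset Strict Implicit.
Unset Printing Implicit Defensive.

(** The contour of a forest is a cyclic word in which every half-edge is paired
    with its reverse, the reverses of the extra half-edges being read along the
    inner face. A pair of words, one for each face, is that of a forest exactly
    when some of their rotations, once joined, reduce to the empty word by
    deleting well parenthesized factors made of pairs [x ... r x] ([plane]):
    contours have this property ([plane_forest_map]), and every pair of words with
    this property comes from a forest ([realize_plane]), which is unique and has
    no symmetry because the inner word is marked ([forest_rigid]).

    Two distinguished corners split the contour as [A ++ B]. Insert the inner word
    in [B] if it contains an extra half-edge, and in [A] otherwise. As the whole
    word cancels, [A] reduces to some word q_1 ... q_m and [B] to the reverse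
    path ([cut], [plane_cut]). This word is a path that never uses both sides of
    an edge and misses some extra half-edge, so it is self-avoiding
    ([path_self_avoiding], [cut_self_avoiding]); and there is only one
    self-avoiding path between two vertices, since its first half-edge is
    determined by its endpoints ([self_avoiding_first], [self_avoiding_uniq]).

    Writing r for the reversal, one has, up to the insertion of the inner word,
    A = D_0 q_1 D_1 ... q_m D_m and B = E_m (r q_m) ... E_1 (r q_1) E_0, where the
    factors D_i and E_i cancel. The increasing construction yields the word
    t A u B, where t is paired with r q_1, each q_k with r q_(k+1), and q_m with u
    ([up_map], [glue_up]). Its separating path is t q_1 ... q_m ([cut_up]), so the
    word is planar and comes from a forest. The decreasing construction removes
    the first and last letters t and u and shifts the pairs backwards ([down_map],
    [glue_down], [cut_down]); the two are inverse to each other up to renaming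
    ([iso_down_up], [iso_up_down]). Finally, the self-avoiding path is the shortest
    one, so a half-edge is directed away from v exactly when it prolongs the
    self-avoiding path from v to its origin into a self-avoiding path
    ([directed_away_last], [directed_away_rcons]). Hence the decreasing
    construction cuts a forest along a self-avoiding path that ends with the given
    edge, and this path is again the separating path of the two parts
    ([down_word]). *)

(** * Words and their reductions *)

Lemma uniq_cat_cons_eq (D : eqType) (x : D) X Y X' Y' : uniq (X ++ x :: Y) ->
  X ++ x :: Y = X' ++ x :: Y' -> X = X' /\ Y = Y'.
Proof.
elim: X X' => [|a X IH] [|b X'] //=.
- by move=> _ [].
- by move=> /andP[xY _] [E1 E2]; case/negP: xY; rewrite E2 E1 mem_cat inE eqxx orbT.
- by move=> /andP[aX _] [E1 E2]; case/negP: aX; rewrite E1 mem_cat inE eqxx orbT.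
- by move=> /andP[_ U] [<- /IH[//|-> ->]].
Qed.

Section Reduction.

Variables (D : eqType) (r : D -> D).

(** [red w z]: the word [w] reduces to [z] by deleting disjoint factors that are
    cancelling, that is, well parenthesized by pairs [x ... r x]. Pairs are not
    oriented, as [r] is meant to be an involution; [red w [::]] says that [w] is
    cancelling. *)
Inductive red : seq D -> seq D -> Prop :=
| red_nil : red [::] [::]
| red_keep x w z : red w z -> red (x :: w) (x :: z)
| red_pair x w1 w2 z :
    red w1 [::] -> red w2 z -> red (x :: w1 ++ r x :: w2) z.

Lemma red_refl w : red w w.
Proof. by elim: w => [|x w IH]; constructor. Qed.

Lemma red_cat w1 z1 w2 z2 :
  red w1 z1 -> red w2 z2 -> red (w1 ++ w2) (z1 ++ z2).
Proof.
move=> H1 H2; elim: H1 => //= [x w z _ IH|x u1 u2 z Hu1 _ _ IH].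
- exact: red_keep.
- by rewrite -catA /=; apply: red_pair.
Qed.

Lemma red_sub w z : red w z -> {subset z <= w}.
Proof.
elim=> // [x w' z' _ IH|x w1 w2 z' _ _ _ IH] y.
- by rewrite !inE => /orP[->//|/IH ->]; rewrite orbT.
- by move=> /IH H; rewrite !(inE, mem_cat) H !orbT.
Qed.

Lemma red_uniq w z : red w z -> uniq w -> uniq z.
Proof.
elim=> //= [x w' z' H IH|x w1 w2 z' _ _ H IH].
- by case/andP=> xw /IH ->; rewrite andbT; apply: contra xw; apply: red_sub H _.
- by rewrite cat_uniq /= => /and5P[_ _ _ _ /IH].
Qed.

(** A letter that is cancelled has its partner in the same word. *)
Lemma red_closed w z : red w z -> {in w, forall x, r (r x) = x} ->
  {in w, forall x, x \in z \/ r x \in w}.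
Proof.
elim=> // [x w' z' _ IH|x w1 w2 z' _ IH1 _ IH2] inv y.
- rewrite !inE; case: eqP => [->|_] /= Hy; first by left.
  case: (IH _ y Hy) => [u Hu|->|->]; [|by left|by right; rewrite orbT].
  by apply: inv; rewrite inE Hu orbT.
- rewrite !(inE, mem_cat); case/or4P => [/eqP ->|Hy|/eqP ->|Hy].
  + by right; rewrite eqxx !orbT.
  + case: (IH1 _ y Hy) => // [u Hu|->]; last by right; rewrite orbT.
    by apply: inv; rewrite !(inE, mem_cat) Hu !orbT.
  + by right; rewrite inv ?eqxx // !(inE, mem_cat) eqxx.
  + case: (IH2 _ y Hy) => [u Hu|->|->]; [|by left|by right; rewrite !orbT].
    by apply: inv; rewrite !(inE, mem_cat) Hu !orbT.
Qed.

(** When a reduced word is split in two, the pairs that straddle the splitting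
    point, listed by [s], are opened. *)
Lemma red_split w z : red w z -> forall X Y, w = X ++ Y ->
  exists z1 z2 s, [/\ z = z1 ++ z2, red X (z1 ++ s) &
                      red Y (rev (map r s) ++ z2)].
Proof.
elim=> [|x w' z' H IH|x w1 w2 z' H1 IH1 H2 IH2] X Y.
- case: X => //= <-; exists [::], [::], [::]; split=> //; exact: red_nil.
- case: X => [|x' X] /=.
    move=> <-; exists [::], (x :: z'), [::]; split=> //; first exact: red_nil.
    exact: red_keep.
  case=> <- /IH[z1 [z2 [s [-> HX HY]]]].
  by exists (x :: z1), z2, s; split=> //; apply: red_keep.
- case: X => [|x' X] /=.
    move=> <-; exists [::], z', [::]; split=> //; first exact: red_nil.
    exact: red_pair.
  case=> <- {x'} E.
  (* either the pair [x ... r x] straddles the splitting point or it precedes it *)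
  have [ltX|leX] := ltnP (size X) (size w1).+1.
    have EX : X = take (size X) w1.
      have := congr1 (take (size X)) E.
      rewrite [RHS]take_size_cat // => EX; rewrite -[LHS]EX take_cat.
      case: ltnP => // leX; have -> : size X = size w1 by lia.
      by rewrite subnn take0 cats0 take_size.
    have EY : Y = drop (size X) w1 ++ r x :: w2.
      have := congr1 (drop (size X)) E.
      rewrite [RHS]drop_size_cat // => EY; rewrite -[LHS]EY drop_cat.
      case: ltnP => // leX; have -> : size X = size w1 by lia.
      by rewrite subnn drop0 drop_size.
    have [|z1 [z2 [s [Ez HX HY]]]] := IH1 X (drop (size X) w1).
      by rewrite {1}EX cat_take_drop.
    case: z1 z2 Ez HX HY => // -[|//] _ /= HX; rewrite cats0 => HY.
    exists [::], z', (x :: s); split=> //=; first exact: red_keep.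
    rewrite EY rev_cons cat_rcons; apply: red_cat => //; exact: red_keep.
  have [X' EX] : exists X', X = w1 ++ r x :: X'.
    exists (drop (size w1).+1 X).
    have := congr1 (take (size w1).+1) E.
    rewrite take_cat ltnNge leqnSn subSnn /= take0 takel_cat // => E'.
    by rewrite -{1}(cat_take_drop (size w1).+1 X) -E' -catA.
  move: E; rewrite EX -catA => /eqP; rewrite eqseq_cat // eqxx /= eqseq_cons eqxx /=.
  move=> /eqP /IH2 [z1 [z2 [s [Ez HX HY]]]].
  by exists z1, z2, s; split=> //; apply: red_pair.
Qed.

Lemma red_cat_nil X Y : red (X ++ Y) [::] ->
  exists2 s, red X s & red Y (rev (map r s)).
Proof.
move=> /red_split /(_ X Y erefl) [z1 [z2 [s []]]].
by case: z1 => //; case: z2 => // _ HX; rewrite cats0; exists s.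
Qed.

Lemma red_at w z : red w z -> forall z1 x z2, z = z1 ++ x :: z2 ->
  exists w1 w2, [/\ w = w1 ++ x :: w2, red w1 z1 & red w2 z2].
Proof.
elim=> [|x w' z' H IH|x w1 w2 z' H1 IH1 H2 IH2] z1 y z2.
- by case: z1.
- case: z1 => [|a z1] /= [<-].
    by move=> <-; exists [::], w'; split=> //; exact: red_nil.
  by move=> /IH[u1 [u2 [-> ? ?]]]; exists (x :: u1), u2; split=> //; apply: red_keep.
- move=> /IH2[u1 [u2 [-> ? ?]]]; exists (x :: w1 ++ r x :: u1), u2.
  by split=> //; rewrite /= -?catA //; apply: red_pair.
Qed.

Lemma red_cancel X z Y w : red X z -> red Y (rev (map r z) ++ w) -> red (X ++ Y) w.
Proof.
move=> HX; elim: HX Y w => //= [x X' z' _ IH|x w1 w2 z' H1 _ _ IH] Y w.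
- rewrite rev_cons cat_rcons => HY.
  have [Y1 [Y2 [-> H1 H2]]] := red_at HY erefl.
  rewrite catA; apply: red_pair => //; apply: IH; by rewrite cats0.
- by move=> /IH H; rewrite -catA /=; apply: red_pair.
Qed.

Lemma red_cat0 X z Y : red X z -> red Y (rev (map r z)) -> red (X ++ Y) [::].
Proof. by move=> HX HY; apply: red_cancel HX _; rewrite cats0. Qed.

Lemma red_rotate X Y : {in X, forall x, r (r x) = x} ->
  red (X ++ Y) [::] -> red (Y ++ X) [::].
Proof.
move=> inv /red_cat_nil[s HX HY]; apply: red_cat0 HY _.
rewrite map_rev revK -map_comp (eq_in_map _ id _).1 ?map_id // => x xs /=.
exact/inv/(red_sub HX).
Qed.

(** A cancelling word may be inserted anywhere in a cancelling word. *)
Lemma red_insert X W Y : red (X ++ Y) [::] -> red W [::] -> red (X ++ W ++ Y) [::].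
Proof. by move=> /red_cat_nil[s HX HY] HW; apply: red_cat0 HX (red_cat HW HY). Qed.

Lemma red_consE x w z : red (x :: w) z ->
  (exists2 z', z = x :: z' & red w z') \/
  (exists w1 w2, [/\ w = w1 ++ r x :: w2, red w1 [::] & red w2 z]).
Proof.
move=> H; inversion H; subst; [by left; exists z0|right].
by exists w1, w2.
Qed.

(** As the letters differ, the first letter of the reduced word is the one that
    is kept, and not a letter that survives further on. *)
Lemma red_cons_keep x w z : uniq (x :: w) -> red (x :: w) (x :: z) -> red w z.
Proof.
move=> /=/andP[xw _] /red_consE[[z' [->]]//|[w1 [w2 [E _ H2]]]].
by case/negP: xw; rewrite E mem_cat inE (red_sub H2) ?inE ?eqxx ?orbT.
Qed.

(** A word without internal pairs is irreducible. *)
Lemma red_irr w z : {in w, forall x, r x \notin w} -> red w z -> z = w.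
Proof.
move=> H Hr; elim: Hr H => // [x w' z' _ IH H|x w1 w2 z' _ _ _ _ H].
- rewrite IH // => y yw; have := H y; rewrite !inE yw orbT negb_or.
  by move=> /(_ isT)/andP[].
- by have := H x; rewrite !(inE, mem_cat) !eqxx !orbT => /(_ isT).
Qed.

Lemma red_cons_pair x X Y :
  uniq (x :: X ++ r x :: Y) -> red (x :: X ++ r x :: Y) [::] ->
  red X [::] /\ red Y [::].
Proof.
move=> /=/andP[_ U] /red_consE[[]//|[w1 [w2 [E]]]].
by have [<- <-] := uniq_cat_cons_eq U E.
Qed.

End Reduction.

Lemma red_map (D T : eqType) (r : D -> D) (r' : T -> T) (g : D -> T) w z :
  red r w z -> {in w, forall x, x \notin z -> g (r x) = r' (g x)} ->
  uniq w -> red r' (map g w) (map g z).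
Proof.
elim=> [|x w' z' _ IH|x w1 w2 z' _ IH1 H2 IH2] H /=.
- by move=> _; exact: red_nil.
- case/andP=> xw U; apply: red_keep; apply: IH => // y yw yz.
  apply: H; rewrite inE ?yw ?orbT // negb_or yz andbT.
  by apply: contra xw => /eqP <-.
- rewrite map_cat /= mem_cat inE cat_uniq /=.
  case/and4P=> /norP[xw1 /norP[_ xw2]] U1 /norP[rx1 h] /andP[rx2 U2].
  rewrite (H x) ?inE ?eqxx //; last by apply: contra xw2; apply: red_sub H2 _.
  apply: red_pair.
  + apply: IH1 => // y yw _; apply: H; first by rewrite !(inE, mem_cat) yw !orbT.
    apply: contra h => yz; apply/hasP; exists y => //; exact: red_sub H2 _ yz.
  + apply: IH2 => // y yw yz; apply: H => //.
    by rewrite !(inE, mem_cat) yw !orbT.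
Qed.

(** * Rotations of a word *)

(** Two rotations of a word without repetition that begin with the same letter
    are equal. *)
Lemma rot_head_eq (D : eqType) (s : seq D) a b x s1 s2 : uniq s ->
  rot a s = x :: s1 -> rot b s = x :: s2 -> s1 = s2.
Proof.
move=> U Ea Eb.
suff H c t : rot c s = x :: t -> x :: t = rot (index x s) s.
  by have := H _ _ Ea; rewrite -(H _ _ Eb) => -[].
move=> E; have [le|lt] := leqP (size s) c.
  by move: E; rewrite rot_oversize // => ->; rewrite /= eqxx rot0.
rewrite -E; congr (rot _ s).
have -> : x = nth x s c.
  have := congr1 (head x) E; rewrite /rot -nth0 nth_cat size_drop subn_gt0 lt.
  by rewrite nth_drop addn0 /= => ->.
by rewrite index_uniq.
Qed.

Lemma rot_split (D : Type) k (s : seq D) : exists X Y, s = X ++ Y /\ rot k s = Y ++ X.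
Proof. by exists (take k s), (drop k s); rewrite cat_take_drop. Qed.

Lemma rot_of_cat (D : Type) (X Y : seq D) : exists k, rot k (X ++ Y) = Y ++ X.
Proof. by exists (size X); rewrite rot_size_cat. Qed.

Lemma rot_rot_exists (D : Type) a b (s : seq D) : exists c, rot a (rot b s) = rot c s.
Proof.
have [le|/ltnW lt] := leqP (size s) b; first by rewrite (rot_oversize le); exists a.
have [le'|/ltnW lt'] := leqP (size s) a.
  by exists b; rewrite rot_oversize ?size_rot.
by rewrite rot_add_mod //; eexists.
Qed.

Lemma rot_sym (D : Type) a (s t : seq D) : rot a s = t -> exists b, rot b t = s.
Proof. by case: (rot_split a s) => X [Y [-> ->]] <-; exact: rot_of_cat. Qed.

Lemma rot_rcons_eq (D : eqType) (s : seq D) a b x s1 s2 : uniq s ->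
  rot a s = rcons s1 x -> rot b s = rcons s2 x -> s1 = s2.
Proof.
have F c t : rot c s = rcons t x -> exists c', rot c' s = x :: t.
  move=> E; have : rotr 1 (rot c s) = x :: t by rewrite E rotr1_rcons.
  by rewrite /rotr; have [c' ->] := rot_rot_exists (size (rot c s) - 1) c s; eauto.
move=> U /F[a' Ea] /F[b' Eb]; exact: rot_head_eq Ea Eb.
Qed.

(** * Planar words *)

(** [plane r O I]: the words [O] and [I] are those of the outer and inner faces of
    a map of genus 0 with these two faces, in which [r] is the reversal and every
    half-edge of the inner face has its reverse on the outer face. Planarity says
    that some rotations of the two words, once joined, cancel, which means that
    the pairing of their letters is noncrossing. *)
Record plane (D : eqType) (r : D -> D) (O I : seq D) : Prop := Plane {
  plane_uniq : uniq (O ++ I);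
  plane_closed : {in O ++ I, forall x, r x \in O ++ I};
  plane_inv : {in O ++ I, forall x, r (r x) = x};
  plane_inner : {in I, forall x, r x \in O};
  plane_neq0 : I != [::];
  plane_red : exists i j, red r (rot i O ++ rot j I) [::]
}.

(** The outer word is cut as [A ++ B]. Some rotation of the inner word is inserted
    in [B] if [b], and in [A] otherwise; after that, [A] reduces to [l] and [B]
    to [rr] read backwards. *)
Definition planar_cut (D : eqType) (r : D -> D) (b : bool) (A B I l rr : seq D) :=
  exists j,
    if b then exists B1 B2,
      [/\ B = B1 ++ B2, red r A l & red r (B1 ++ rot j I ++ B2) (rev rr)]
    else exists A1 A2,
      [/\ A = A1 ++ A2, red r (A1 ++ rot j I ++ A2) l & red r B (rev rr)].

(** Some half-edge of the word [B] is the reverse of one of the inner face. *)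
Definition has_ext (D : eqType) (r : D -> D) (B I : seq D) :=
  has (fun x => r x \in I) B.

(** [cut r A B I q]: [q] is the path that separates the two parts of the map when
    its outer face is cut as [A ++ B]. With the inner word inserted in the other
    part, the path would go around the inner face on its other side. *)
Definition cut (D : eqType) (r : D -> D) (A B I q : seq D) : Prop :=
  plane r (A ++ B) I /\ planar_cut r (has_ext r B I) A B I q (map r q).

Lemma disjoint_parts (D : eqType) (A B I : seq D) : uniq ((A ++ B) ++ I) ->
  [/\ forall x, x \in A -> x \notin B, forall x, x \in A -> x \notin I &
      forall x, x \in B -> x \notin I].
Proof.
rewrite !cat_uniq => /and3P[/and3P[_ /hasPn H1 _] /hasPn H2 _].
split=> x Hx; apply/negP => Hx'.
- by have := H1 _ Hx'; rewrite /= Hx.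
- by have := H2 _ Hx'; rewrite /= mem_cat Hx.
- by have := H2 _ Hx'; rewrite /= mem_cat Hx orbT.
Qed.

Lemma perm_cons_cons (D : eqType) (t u : D) (A B I : seq D) :
  perm_eq ((t :: A ++ u :: B) ++ I) (t :: u :: (A ++ B) ++ I).
Proof. by rewrite /= perm_cons -catA perm_catC /= perm_cons perm_catC catA. Qed.

Lemma perm_insert_rot (D : eqType) (B1 B2 J : seq D) j :
  perm_eq (B1 ++ rot j J ++ B2) ((B1 ++ B2) ++ J).
Proof. by rewrite -catA perm_cat2l perm_catC perm_cat2l perm_rot. Qed.

Lemma uniq_parts (D : eqType) (A B I : seq D) : uniq ((A ++ B) ++ I) ->
  [/\ uniq A, uniq B, uniq (A ++ I) & uniq (B ++ I)].
Proof.
move=> U; have UBI : uniq (B ++ I) by move: U; rewrite -catA cat_uniq => /and3P[].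
have UAI : uniq (A ++ I).
  move: U; rewrite -[uniq _](rot_uniq (size (A ++ B))) rot_size_cat catA cat_uniq.
  by case/and3P; rewrite uniq_catC.
by split=> //; [move: UAI | move: UBI]; rewrite cat_uniq => /and3P[].
Qed.

Section Plane.

Variables (D : eqType) (r : D -> D).
Implicit Types (A B I O U V q : seq D).

Lemma plane_rot k O I : plane r O I -> plane r (rot k O) I.
Proof.
have M x : (x \in rot k O ++ I) = (x \in O ++ I) by rewrite !(mem_rot, mem_cat).
case=> U C V N N0 [i [j R]]; split=> //.
- by rewrite (@perm_uniq _ _ (O ++ I)) // perm_cat2r perm_rot.
- by move=> x; rewrite !M => /C.
- by move=> x; rewrite M => /V.
- by move=> x /N; rewrite mem_rot.
- have [k' E] := rot_sym (erefl (rot k O)); have [i' E'] := rot_rot_exists i k' (rot k O).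
  by exists i', j; rewrite -E' E.
Qed.

(** The inner word may be inserted right after any half-edge [e] of the outer word
    that is adjacent to the inner face, provided that it is rotated so as to
    begin with [r e]. *)
Lemma plane_insert k O I U e V : plane r O I -> rot k O = U ++ e :: V ->
  r e \in I ->
  exists j, red r (U ++ e :: rot j I ++ V) [::] /\ head e (rot j I) = r e.
Proof.
case=> Un C Inv N N0 [i [j0 R]] EO reI.
have eO : e \in rot i O by rewrite mem_rot -(mem_rot k) EO mem_cat inE eqxx orbT.
have : r e \in rot j0 I by rewrite mem_rot.
have : uniq (rot i O ++ rot j0 I).
  by rewrite (@perm_uniq _ _ (O ++ I)) // perm_cat ?perm_rot.
have Inv' : {in rot i O ++ rot j0 I, forall x, r (r x) = x}.
  by move=> x; rewrite mem_cat !mem_rot -mem_cat => H; apply: Inv.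
move EZ: (rot i O) eO R Inv' => Z eO; move EJ: (rot j0 I) => J R Inv' UZJ dJ.
case/splitPr: eO EZ R Inv' UZJ => X Y EZ.
case/splitPr: dJ EJ => J1 J2 EJ; rewrite -catA => R Inv' UZJ.
have UO : uniq O by move: Un; rewrite cat_uniq => /and3P[].
have EVU : V ++ U = Y ++ X.
  have [a Ea] := rot_rot_exists (size U) k O; have [b Eb] := rot_rot_exists (size X) i O.
  by apply: (rot_head_eq UO (a:=a) (b:=b) (x:=e)); rewrite -?Ea -?Eb ?EO ?EZ rot_size_cat.
have R1 : red r ((e :: Y) ++ (J1 ++ r e :: J2) ++ X) [::].
  rewrite catA; apply: red_rotate => //.
  by move=> x Hx; apply: Inv'; rewrite !mem_cat Hx.
have [R2 R3] : red r (Y ++ J1) [::] /\ red r (J2 ++ X) [::].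
  apply: (@red_cons_pair _ r e); last by move: R1; rewrite /= -!catA.
  by move: UZJ; rewrite -catA -(rot_uniq (size X)) rot_size_cat /= -!catA.
have [j Ej] : exists j, rot j I = r e :: J2 ++ J1.
  have [j Ej] := rot_rot_exists (size J1) j0 I; exists j.
  by rewrite -Ej EJ rot_size_cat.
(* the words [Y ++ J1] and [J2 ++ X] are now nested instead of being separated by
   the pair [e], [r e] *)
exists j; rewrite Ej; split=> //.
have sub x : x \in (e :: rot j I ++ V) ++ U -> r (r x) = x.
  move=> Hx; apply: Inv; move: Hx; rewrite !(mem_rot, inE, mem_cat) -(mem_rot k O) EO.
  by rewrite mem_cat inE; do !case: (_ \in _) => //; rewrite ?orbT.
rewrite -Ej; apply: red_rotate; first by move=> x Hx; apply: sub; rewrite mem_cat Hx.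
rewrite Ej /= -!catA EVU [J1 ++ _]catA.
apply: (@red_pair _ r e [::]); first exact: red_nil.
apply: red_insert => //.
apply: red_rotate => // x Hx; apply: Inv'.
by rewrite !(inE, mem_cat) Hx !orbT.
Qed.



(** The inner word is inserted in [B] next to an extra half-edge if there is one,
    and otherwise in [A], where there must be one; then the reduction of the
    joined word is split at the cut. *)
Lemma plane_cut k O I A B : plane r O I -> rot k O = A ++ B ->
  exists q, cut r A B I q.
Proof.
move=> P EO; have P' : plane r (A ++ B) I by rewrite -EO; exact: plane_rot.
case: (boolP (has_ext r B I)) => [H|H].
  case/hasP: (H) => e eB /(@plane_insert k O I) HI.
  case/splitPr: eB HI EO H P' => B1 B2 HI EO H P'.
  have [|j [R _]] := HI (A ++ B1) B2 P; first by rewrite EO -catA.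
  move: R; rewrite -catA => /red_cat_nil[q R1 R2].
  exists q; split=> //; exists j; rewrite H.
  exists (rcons B1 e), B2; split=> //; rewrite ?cat_rcons //.
have [x xI] : exists x, x \in I.
  by case: (I) (plane_neq0 P) => // x I' _; exists x; rewrite inE eqxx.
have : r x \in A.
  have := plane_inner P' xI; rewrite mem_cat => /orP[//|rB].
  case/hasP: H; exists (r x) => //.
  by rewrite (plane_inv P') // mem_cat xI orbT.
have : r (r x) \in I by rewrite (plane_inv P') // mem_cat xI orbT.
move: {x xI} (r x) => e reI eA.
have HI := @plane_insert k O I _ e _ P _ reI.
case/splitPr: eA HI EO P' => A1 A2 HI EO P'.
have [|j [R _]] := HI A1 (A2 ++ B); first by rewrite EO -catA.
have [q R1 R2] : exists2 q, red r (rcons A1 e ++ rot j I ++ A2) q &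
                            red r B (rev (map r q)).
  by move: (rot j I) R => J; rewrite -cat_rcons !catA => /red_cat_nil.
exists q; split=> //; exists j; rewrite (negbTE H).
by exists (rcons A1 e), A2; rewrite cat_rcons; split.
Qed.

Lemma cut_plane_red b A B I l : {in (A ++ B) ++ I, forall x, r (r x) = x} ->
  planar_cut r b A B I l (map r l) ->
  exists i j, red r (rot i (A ++ B) ++ rot j I) [::].
Proof.
move=> inv [j].
have invO x : x \in A ++ B -> r (r x) = x by move=> Hx; apply: inv; rewrite mem_cat Hx.
have invJ x : x \in rot j I -> r (r x) = x.
  by rewrite mem_rot => Hx; apply: inv; rewrite mem_cat Hx orbT.
case: b => [[B1 [B2 [EB RA RB]]]|[A1 [A2 [EA RA RB]]]].
- have [i Ei] := rot_of_cat (A ++ B1) B2.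
  exists i, j; rewrite EB catA Ei; move: (rot j I) invJ RB => J invJ RB.
  rewrite -!catA; apply: red_rotate.
    move=> x Hx; have := @invO x; have := @invJ x; move: Hx.
    by rewrite EB !mem_cat; do !case: (_ \in _) => //=; auto.
  by rewrite -!catA; apply: red_cat0 RA _.
- have [i Ei] := rot_of_cat A1 (A2 ++ B).
  exists i, j; rewrite EA -catA Ei; move: (rot j I) invJ RA => J invJ RA.
  rewrite -!catA catA; apply: red_rotate.
    move=> x Hx; have := @invO x; have := @invJ x; move: Hx.
    by rewrite EA !mem_cat; do !case: (_ \in _) => //=; auto.
  have -> : (A1 ++ J) ++ A2 ++ B = (A1 ++ J ++ A2) ++ B by rewrite -!catA.
  exact: red_cat0 RA RB.
Qed.

End Plane.

(** * Changing partners *)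

Section Rematch.

Variable D : eqType.
Implicit Types (r : D -> D) (l rr : seq D).

(** The reversal obtained from [r] by pairing the k-th element of [l] with the
    k-th element of [rr], other elements keeping their partners. *)
Definition rematch r l rr (x : D) : D :=
  if x \in l then nth x rr (index x l)
  else if x \in rr then nth x l (index x rr) else r x.

Lemma rematch_out r l rr x : x \notin l -> x \notin rr -> rematch r l rr x = r x.
Proof. by rewrite /rematch => /negbTE -> /negbTE ->. Qed.

Lemma rematch_mem_l r l rr x : size l = size rr -> x \in l ->
  rematch r l rr x \in rr.
Proof. by rewrite /rematch => E xl; rewrite xl mem_nth // -E index_mem. Qed.

Lemma rematch_mem_r r l rr x : size l = size rr -> x \notin l -> x \in rr ->
  rematch r l rr x \in l.
Proof.
by rewrite /rematch => E /negbTE -> xl; rewrite xl mem_nth // E index_mem.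
Qed.

Lemma map_rematch_l r l rr : size l = size rr -> uniq l ->
  map (rematch r l rr) l = rr.
Proof.
move=> E U; case: l E U => [|x0 l]; first by case: rr.
move=> E U; apply: (@eq_from_nth _ x0); rewrite size_map // => i Hi.
rewrite (nth_map x0) // /rematch mem_nth // index_uniq //.
by apply: set_nth_default; rewrite -E.
Qed.

Lemma rematch_inv r l rr x : size l = size rr -> uniq l -> uniq rr ->
  {in rr, forall x, x \notin l} -> (x \in l) || (x \in rr) ->
  rematch r l rr (rematch r l rr x) = x.
Proof.
move=> E Ul Ur N /orP[xl|xr].
- have Hk : index x l < size rr by rewrite -E index_mem.
  rewrite {2}/rematch xl /rematch (negbTE (N _ _)) mem_nth // index_uniq //.
  by rewrite (set_nth_default x) ?nth_index // E.
- have Hk : index x rr < size l by rewrite E index_mem.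
  rewrite {2}/rematch (negbTE (N _ xr)) xr /rematch mem_nth // index_uniq //.
  by rewrite (set_nth_default x) ?nth_index // -E.
Qed.

(** Pairing the elements of [l] with their partners changes nothing. *)
Lemma rematch_id r l x : {in l, forall y, r (r y) = y} ->
  rematch r l (map r l) x = r x.
Proof.
rewrite /rematch => inv; case: ifP => [xl|_].
  by rewrite (nth_map x) ?index_mem // nth_index.
case: ifP => // xr.
have Hk : index x (map r l) < size l by rewrite -(size_map r) index_mem.
have := nth_index x xr; rewrite (nth_map x) // => E.
by rewrite -[in RHS]E inv // mem_nth.
Qed.

End Rematch.

Lemma mem_map_in (D T : eqType) (g : D -> T) (S : {pred D}) l x :
  {in S &, injective g} -> {subset l <= S} -> x \in S ->
  (g x \in map g l) = (x \in l).
Proof.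
move=> inj sub xS; apply/mapP/idP => [[y yl E]|xl]; last by exists x.
by rewrite (inj _ _ xS (sub _ yl) E).
Qed.

Lemma index_map_in (D T : eqType) (g : D -> T) (S : {pred D}) l x :
  {in S &, injective g} -> {subset l <= S} -> x \in S ->
  index (g x) (map g l) = index x l.
Proof.
move=> inj sub xS; elim: l sub => //= y l IH sub.
have yS : y \in S by apply: sub; rewrite inE eqxx.
rewrite IH; last by move=> z zl; apply: sub; rewrite inE zl orbT.
by rewrite (inj_in_eq inj).
Qed.

Lemma rematch_morph (D T : eqType) (r1 : D -> D) (r2 : T -> T) (g : D -> T)
    (S : {pred D}) l rr x :
  {in S &, injective g} -> {subset l <= S} -> {subset rr <= S} -> x \in S ->
  size l = size rr ->
  (x \notin l -> x \notin rr -> g (r1 x) = r2 (g x)) ->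
  g (rematch r1 l rr x) = rematch r2 (map g l) (map g rr) (g x).
Proof.
move=> inj sl sr xS E H; rewrite /rematch !(mem_map_in inj) // !(index_map_in inj) //.
case: ifP => [xl|/negbT xl].
  by rewrite (nth_map x) // -E index_mem.
case: ifP => [xr|/negbT xr]; last exact: H.
by rewrite (nth_map x) // E index_mem.
Qed.

Section Cut.

Variables (D : eqType) (r : D -> D).
Implicit Types (A B I l q rr : seq D).

(** The path [q] lies in [A], its reverse in the right part, and each part is
    closed under reversal apart from the path. The inner face belongs to the part
    in which its word is inserted. *)
Lemma cut_facts A B I q : cut r A B I q ->
  let b := has_ext r B I in
  let IL := if b then [::] else I in
  let IR := if b then I else [::] in
  [/\ uniq q,
      {subset q <= A},
      {in q, forall x, r x \in B ++ IR},
      {in A ++ IL, forall x, x \notin q -> r x \in A ++ IL} &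
      {in B ++ IR, forall x, x \notin map r q -> r x \in B ++ IR}].
Proof.
move=> [P [j]]; have [UA UB UI] := disjoint_parts (plane_uniq P).
have inv : forall x, x \in (A ++ B) ++ I -> r (r x) = x by exact: plane_inv P.
have U := plane_uniq P; case: ifP => Hb.
- move=> [B1 [B2 [EB RA RB]]] b IL IR.
  have EA x : (x \in A ++ IL) = (x \in A) by rewrite cats0.
  have EBI x : (x \in B1 ++ rot j I ++ B2) = (x \in B ++ IR).
    by rewrite /IR /b EB !(mem_rot, mem_cat); do !case: (_ \in _).
  split.
  + by have [UA' _ _ _] := uniq_parts U; apply: red_uniq RA _.
  + exact: red_sub RA.
  + move=> x xq; rewrite -EBI; apply: (red_sub RB).
    by rewrite mem_rev map_f.
  + move=> x; rewrite !EA => xA xq.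
    case: (red_closed RA _ xA) => // [y yA|xq']; last by rewrite xq' in xq.
    by apply: inv; rewrite !mem_cat yA.
  + move=> x; rewrite -!EBI => xB xq.
    case: (red_closed RB _ xB) => // [y|]; last by rewrite mem_rev (negbTE xq).
    rewrite EBI => Hy; apply: inv; move: Hy; rewrite /IR /b !mem_cat.
    by case/orP => ->; rewrite ?orbT.
- move=> [A1 [A2 [EA RA RB]]] b IL IR.
  have EB x : (x \in B ++ IR) = (x \in B) by rewrite /IR /b cats0.
  have EAI x : (x \in A1 ++ rot j I ++ A2) = (x \in A ++ IL).
    by rewrite /IL /b EA !(mem_rot, mem_cat); do !case: (_ \in _).
  have rqB x : x \in q -> r x \in B.
    by move=> xq; apply: (red_sub RB); rewrite mem_rev map_f.
  have qAI x : x \in q -> x \in A ++ I.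
    by move=> /(red_sub RA); rewrite EAI /IL /b.
  have UAI : uniq (A1 ++ rot j I ++ A2).
    have [_ _ UAI _] := uniq_parts U.
    by rewrite (@perm_uniq _ _ (A ++ I)) // EA perm_insert_rot.
  split.
  + exact: red_uniq RA UAI.
  + move=> x xq; have := qAI _ xq; rewrite mem_cat => /orP[//|xI].
    move/negP: Hb; case; apply/hasP; exists (r x); first exact: rqB.
    by rewrite inv // mem_cat xI orbT.
  + by move=> x /rqB; rewrite EB.
  + move=> x; rewrite -!EAI => xA xq.
    case: (red_closed RA _ xA) => // [y|xq']; last by rewrite xq' in xq.
    rewrite EAI => Hy; apply: inv; move: Hy; rewrite /IL /b !mem_cat.
    by case/orP => ->; rewrite ?orbT.
  + move=> x; rewrite !EB => xB xq.
    case: (red_closed RB _ xB) => // [y yB|]; last by rewrite mem_rev (negbTE xq).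
    by apply: inv; rewrite !mem_cat yB orbT.
Qed.

End Cut.

Lemma red_ext (D : eqType) (r r' : D -> D) w z : uniq w ->
  {in w, forall x, x \notin z -> r x = r' x} -> red r w z -> red r' w z.
Proof. by move=> U H R; rewrite -[w]map_id -[z]map_id; apply: red_map R H U. Qed.

(** Changing the partners along the path keeps the shape of the reduction, as the
    deleted factors are left untouched. *)
Lemma cut_rematch (D : eqType) (r : D -> D) (A B I l rr : seq D) :
  uniq ((A ++ B) ++ I) -> I != [::] -> size l = size rr ->
  {subset l <= A} -> {subset rr <= B ++ I} -> uniq l -> uniq rr ->
  (forall x, x \in (A ++ B) ++ I -> x \notin l -> x \notin rr ->
     [/\ r x \in (A ++ B) ++ I, r x \notin l, r x \notin rr & r (r x) = x]) ->
  (forall x, x \in I -> x \notin rr -> r x \in A ++ B) ->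
  planar_cut r (has (fun x => (x \notin rr) && (r x \in I)) B) A B I l rr ->
  cut (rematch r l rr) A B I l.
Proof.
move=> U I0 E lA rB Ul Ur Hr HI Hred; have [UA UB UI] := disjoint_parts U.
have [uA uB uAI uBI] := uniq_parts U; set r' := rematch r l rr.
have lr x : x \in rr -> x \notin l.
  move=> /rB; rewrite mem_cat => H; apply/negP => /lA xA; case/orP: H => Hx.
  - by have := UA _ xA; rewrite Hx.
  - by have := UB _ xA; rewrite Hx.
have Elr : map r' l = rr by exact: map_rematch_l.
have lS x : x \in l -> x \in (A ++ B) ++ I by move=> /lA xA; rewrite !mem_cat xA.
have rS x : x \in rr -> x \in (A ++ B) ++ I.
  by move=> /rB; rewrite -catA !mem_cat => ->; rewrite orbT.
have inv' : {in (A ++ B) ++ I, forall x, r' (r' x) = x}.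
  move=> x xS; have [xl|xl] := boolP (x \in l).
    by apply: rematch_inv => //; rewrite xl.
  have [xr|xr] := boolP (x \in rr).
    by apply: rematch_inv => //; rewrite xr orbT.
  have [_ H1 H2 H3] := Hr x xS xl xr.
  by rewrite {2}/r' rematch_out // /r' rematch_out.
have Hext : has (fun x => (x \notin rr) && (r x \in I)) B = has_ext r' B I.
  apply: eq_in_has => x xB.
  have xl : x \notin l by apply/negP => /lA /UA; rewrite xB.
  have [xr|xr] /= := boolP (x \in rr); last by rewrite /r' rematch_out.
  by symmetry; apply: negbTE; apply/UB/lA; exact: rematch_mem_r.
have Hred' : planar_cut r' (has_ext r' B I) A B I l (map r' l).
  rewrite -Hext Elr; case: Hred => j H; exists j; move: H; case: ifP => Hb.
  - case=> B1 [B2 [EB RA RB]]; exists B1, B2; split=> //.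
      apply: red_ext RA => // x xA xl.
      rewrite /r' rematch_out //; apply/negP => /rB; rewrite mem_cat.
      by rewrite (negbTE (UA _ xA)) (negbTE (UB _ xA)).
    apply: red_ext RB; first by rewrite (@perm_uniq _ _ (B ++ I)) // EB perm_insert_rot.
    move=> x xB xr; rewrite mem_rev in xr; rewrite /r' rematch_out //.
    apply/negP => /lA xA; move: xB; rewrite !(mem_rot, mem_cat).
    move: (UA _ xA) (UB _ xA); rewrite EB !mem_cat.
    by do !case: (_ \in _).
  - case=> A1 [A2 [EA RA RB]]; exists A1, A2; split=> //.
      apply: red_ext RA => [|x xA xl].
        by rewrite (@perm_uniq _ _ (A ++ I)) // EA perm_insert_rot.
      rewrite /r' rematch_out //; apply/negP => xr.
      have xB : x \in B by apply: (red_sub RB); rewrite mem_rev.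
      move: xA (UI _ xB); rewrite !(mem_rot, mem_cat) => xA.
      have : x \notin A by apply/negP => /UA; rewrite xB.
      by move: xA; rewrite EA !mem_cat; do !case: (_ \in _).
    apply: red_ext RB => // x xB; rewrite mem_rev => xr; rewrite /r' rematch_out //.
    by apply/negP => /lA /UA; rewrite xB.
split=> //; split=> //.
- move=> x xS; have [xl|xl] := boolP (x \in l).
    by apply: rS; exact: rematch_mem_l.
  have [xr|xr] := boolP (x \in rr); first by apply: lS; exact: rematch_mem_r.
  by rewrite /r' rematch_out //; case: (Hr x xS xl xr).
- move=> x xI; have xl : x \notin l by apply/negP => /lA /UB; rewrite xI.
  have [xr|xr] := boolP (x \in rr).
    by rewrite mem_cat lA //; exact: rematch_mem_r.
  by rewrite /r' rematch_out //; exact: HI.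
- exact: cut_plane_red Hred'.
Qed.


(** The cut is preserved by isomorphisms. *)
Lemma cut_map (D T : eqType) (r : D -> D) (r' : T -> T) (g : D -> T) A B I q :
  {in (A ++ B) ++ I &, injective g} ->
  {in (A ++ B) ++ I, forall x, g (r x) = r' (g x)} ->
  cut r A B I q -> cut r' (map g A) (map g B) (map g I) (map g q).
Proof.
move=> inj com C; have [P [j Hred]] := C.
have [_ qA _ _ _] := cut_facts C.
have U := plane_uniq P; have [UA UB UI] := disjoint_parts U.
have U' : uniq ((map g A ++ map g B) ++ map g I) by rewrite -!map_cat map_inj_in_uniq.
have Eq : map r' (map g q) = map g (map r q).
  by rewrite -!map_comp; apply/eq_in_map => x /qA xA /=; rewrite com // !mem_cat xA.
have Hext : has_ext r' (map g B) (map g I) = has_ext r B I.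
  rewrite /has_ext has_map; apply: eq_in_has => x xB /=.
  rewrite -com ?mem_cat ?xB ?orbT // (mem_map_in inj) //.
  - by move=> y yI; rewrite mem_cat yI orbT.
  - by apply: (plane_closed P); rewrite !mem_cat xB orbT.
have Rg w z : {subset w <= (A ++ B) ++ I} -> red r w z -> uniq w ->
    red r' (map g w) (map g z).
  by move=> sub R Uw; apply: red_map R _ Uw => x xw _; rewrite com // sub.
have [UA' UB' UAI UBI] := uniq_parts U.
have Hred' : planar_cut r' (has_ext r' (map g B) (map g I)) (map g A) (map g B) (map g I)
               (map g q) (map r' (map g q)).
  rewrite Hext Eq; exists j; move: Hred; case: ifP => Hb.
  - case=> B1 [B2 [EB RA RB]]; exists (map g B1), (map g B2).
    have PB : perm_eq (B1 ++ rot j I ++ B2) (B ++ I) by rewrite EB perm_insert_rot.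
    rewrite -map_cat -EB -map_rev -map_rot -!map_cat; split=> //; apply: Rg => //.
    + by move=> x xA; rewrite !mem_cat xA.
    + by move=> x; rewrite (perm_mem PB) -catA !mem_cat => ->; rewrite orbT.
    + by rewrite (perm_uniq PB).
  - case=> A1 [A2 [EA RA RB]]; exists (map g A1), (map g A2).
    have PA : perm_eq (A1 ++ rot j I ++ A2) (A ++ I) by rewrite EA perm_insert_rot.
    rewrite -map_cat -EA -map_rev -map_rot -!map_cat; split=> //; apply: Rg => //.
    + move=> x; rewrite (perm_mem PA) !mem_cat; by case/orP => ->; rewrite ?orbT.
    + by rewrite (perm_uniq PA).
    + by move=> x xB; rewrite !mem_cat xB orbT.
have inv' : {in (map g A ++ map g B) ++ map g I, forall x, r' (r' x) = x}.
  rewrite -!map_cat => _ /mapP[x xS ->].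
  by rewrite -!com ?(plane_inv P) //; exact: (plane_closed P).
split=> //; split=> //.
- rewrite -!map_cat => _ /mapP[x xS ->].
  by rewrite -com // map_f //; exact: (plane_closed P).
- rewrite -!map_cat => _ /mapP[x xI ->].
  by rewrite -com ?mem_cat ?xI ?orbT // map_f //; exact: (plane_inner P).
- by rewrite -size_eq0 size_map size_eq0; exact: plane_neq0 P.
- exact: cut_plane_red Hred'.
Qed.

(** * The two constructions on words *)

Section UpDown.

Variables (D : eqType) (r : D -> D).
Implicit Types (A B I q : seq D).

(** The reversal on the half-edges and the two half-edges [inr true], [inr false]
    of a new edge. *)
Definition lift_rev (x : D + bool) : D + bool :=
  match x with inl d => inl (r d) | inr b => inr (~~ b) end.

(** The left sides of the edges that form the path in the word [up_map], in their
    order along the path; [up_right] lists the right sides, that is, their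
    reverses. *)
Definition up_left q : seq (D + bool) := inr true :: map inl q.
Definition up_right q : seq (D + bool) := rcons (map inl (map r q)) (inr false).

(** The words of the map produced by the increasing construction: the new
    half-edge [inr true] comes before [A] and [inr false] before [B], and the left
    side of each edge of the path is paired with the right side of the next one.
    The left side of the first edge is [inr true] and the right side of the last
    one is [inr false]. *)
Definition up_map A B I q : cmap (D + bool) :=
  CMap ((inr true :: map inl A) ++ inr false :: map inl B) (map inl I)
       (rematch lift_rev (up_left q) (up_right q)).

(** The words of the map produced by the decreasing construction along the path
    [t :: q]: the first left side [t] and the last right side are removed, and
    each other left side is paired with the right side of the previous edge. *)
Definition down_map A B I t q : cmap D :=
  CMap (A ++ B) I (rematch r q (map r (belast t q))).

Lemma mem_inl (s : seq D) d : ((inl d : D + bool) \in map inl s) = (d \in s).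
Proof. by rewrite mem_map // => ? ? []. Qed.

Lemma mem_inr (s : seq D) b : ((inr b : D + bool) \in map inl s) = false.
Proof. by apply/negP => /mapP[]. Qed.

Lemma last_inl A q : {subset q <= A} ->
  last (inr true) (map inl q) \in (inr true : D + bool) :: map inl A.
Proof.
move=> qA; have := mem_last (inr true : D + bool) (map inl q).
by rewrite !inE => /predU1P[->|/mapP[x /qA xA ->]]; rewrite ?eqxx // map_f.
Qed.

(** The increasing construction turns the separating path [q] into the separating
    path made of the new half-edge and [q]; in particular its result is planar. *)
Lemma cut_up A B I q : cut r A B I q ->
  cut (mrev (up_map A B I q)) (inr true :: map inl A) (inr false :: map inl B)
    (map inl I) (up_left q).
Proof.
move=> C; have [P [j Hred]] := C; have [Uq qA qB _ _] := cut_facts C.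
have U := plane_uniq P; have [UA UB UI] := disjoint_parts U.
have inv := plane_inv P; have Cl := plane_closed P.
have qS x : x \in q -> x \in (A ++ B) ++ I by move=> /qA H; rewrite !mem_cat H.
have rinj : {in q &, injective r}.
  by move=> x y xq yq E; rewrite -(inv x) ?E ?inv //; exact: qS.
have inlinj : injective (@inl D bool) by move=> ? ? [].
have qBI x : x \in map r q -> x \in B ++ I.
  case/mapP => y /qB; case: ifP => _ H ->; move: H; rewrite ?cats0 // !mem_cat.
  by move=> ->.
have memr d : (inl d \in up_right q) = (d \in map r q).
  by rewrite mem_rcons inE mem_inl.
have meml d : (inl d \in up_left q) = (d \in q) by rewrite inE mem_inl.
have Ur : uniq (map r q) by rewrite map_inj_in_uniq.
apply: cut_rematch.
- rewrite (@perm_uniq _ _ (inr true :: inr false :: map inl ((A ++ B) ++ I))).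
    by rewrite /= inE !mem_inr /= map_inj_uniq.
  rewrite /= perm_cons -catA perm_catC /= perm_cons perm_catC catA.
  by rewrite -!map_cat.
- by rewrite -size_eq0 size_map size_eq0; exact: plane_neq0 P.
- by rewrite size_rcons /= !size_map.
- by move=> [d|b]; rewrite !inE ?mem_inl ?mem_inr ?orbF //=; apply: qA.
- move=> [d|[]]; rewrite ?memr ?mem_rcons !(inE, mem_cat) ?mem_inl ?mem_inr //.
  by move=> /qBI; rewrite mem_cat.
- by rewrite /= mem_inr map_inj_uniq.
- by rewrite rcons_uniq mem_inr map_inj_uniq.
- move=> [d|[]] xS xl xr; last first.
  + by move: xr; rewrite mem_rcons inE eqxx.
  + by move: xl; rewrite inE eqxx.
  have dS : d \in (A ++ B) ++ I.
    by move: xS; rewrite !(inE, mem_cat) !mem_inl /=.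
  rewrite meml in xl; rewrite memr in xr.
  rewrite /= meml memr; split.
  + by have := Cl d dS; rewrite !(inE, mem_cat) !mem_inl.
  + by apply: contra xr => H; rewrite -(inv d dS) map_f.
  + by apply: contra xl => /mapP[y yq E]; rewrite -(inv d dS) E inv // qS.
  + by rewrite inv.
- move=> _ /mapP[d dI ->] _; rewrite /= !(inE, mem_cat) !mem_inl /=.
  by have := plane_inner P dI; rewrite mem_cat.
have -> : has (fun x => (x \notin up_right q) && (lift_rev x \in map inl I))
              (inr false :: map inl B) = has_ext r B I.
  rewrite /= mem_rcons inE eqxx /= has_map; apply: eq_in_has => d dB /=.
  rewrite memr mem_inl; apply: andb_idl => rI; apply/negP => /mapP[y yq E].
  have := UB _ (qA _ yq); rewrite -[y]inv ?qS // -E.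
  by rewrite rI.
have Rg w z : red r w z -> uniq w -> red lift_rev (map inl w) (map inl z).
  by move=> R; apply: red_map R _.
have [UA' UB' UAI UBI] := uniq_parts U.
exists j; move: Hred; case: ifP => Hb.
- case=> B1 [B2 [EB RA RB]]; exists (inr false :: map inl B1), (map inl B2).
  have PB : perm_eq (B1 ++ rot j I ++ B2) (B ++ I) by rewrite EB perm_insert_rot.
  split; first by rewrite EB map_cat.
    by apply: red_keep; exact: Rg.
  rewrite rev_rcons -map_rev /= -map_rot -!map_cat; apply: red_keep.
  by apply: Rg => //; rewrite (perm_uniq PB).
- case=> A1 [A2 [EA RA RB]]; exists (inr true :: map inl A1), (map inl A2).
  have PA : perm_eq (A1 ++ rot j I ++ A2) (A ++ I) by rewrite EA perm_insert_rot.
  split; first by rewrite EA map_cat.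
    rewrite /= -map_rot -!map_cat; apply: red_keep.
    by apply: Rg => //; rewrite (perm_uniq PA).
  by rewrite rev_rcons -map_rev; apply: red_keep; exact: Rg.
Qed.

(** The decreasing construction turns the separating path [t :: q] into [q]; in
    particular its result is planar. *)
Lemma cut_down A B I t u q : cut r (t :: A) (u :: B) I (t :: q) ->
  u = r (last t q) ->
  cut (mrev (down_map A B I t q)) A B I q.
Proof.
move=> C Eu; have [P [j Hred]] := C; have [Uq qA qB _ _] := cut_facts C.
have U := plane_uniq P; have [UA UB UI] := disjoint_parts U.
have inv := plane_inv P; have Cl := plane_closed P.
have qS x : x \in t :: q -> x \in (t :: A ++ u :: B) ++ I.
  by move=> /qA; rewrite !(inE, mem_cat); case/orP => ->; rewrite ?orbT.
have rinj : {in t :: q &, injective r}.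
  by move=> x y xq yq E; rewrite -(inv x) ?E ?inv //; exact: qS.
have Er : map r (t :: q) = rcons (map r (belast t q)) u.
  by rewrite lastI map_rcons Eu.
have perm := perm_cons_cons t u A B I.
have := U; rewrite (perm_uniq perm) /= inE negb_or => /and3P[/andP[tu tS] uS U'].
have Sx x : (x \in (t :: A ++ u :: B) ++ I) = [|| x == t, x == u | x \in (A ++ B) ++ I].
  by rewrite (perm_mem perm) !inE.
have uq : uniq (map r (t :: q)) by rewrite map_inj_in_uniq.
have qA' x : x \in q -> x \in A.
  move=> xq; have := qA x; rewrite !inE xq orbT => /(_ isT).
  by case: eqP xq => // ->; case/andP: Uq => /negbTE ->.
have bq x : x \in belast t q -> x \in t :: q by rewrite lastI mem_rcons inE orbC => ->.
have ub x : x \in map r (belast t q) -> x != u.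
  move=> H; move: uq; rewrite Er rcons_uniq => /andP[H' _].
  by apply: contra H' => /eqP <-.
have rB x : x \in map r (belast t q) -> x \in B ++ I.
  move=> H; have /negbTE xu := ub x H; case/mapP: H xu => y /bq /qB H -> yu.
  move: H; rewrite mem_cat inE yu mem_cat /=; case: (_ \in B) => //=.
  by case: ifP.
apply: cut_rematch => //.
- exact: plane_neq0 P.
- by rewrite size_map size_belast.
- by case/andP: Uq.
- by move: uq; rewrite Er rcons_uniq => /andP[].
- move=> x xS xq xr.
  have xS' : x \in (t :: A ++ u :: B) ++ I by rewrite Sx xS !orbT.
  have xt : x != t by apply: contraNneq tS => <-.
  have xu : x != u by apply: contraNneq uS => <-.
  have xtq : x \notin t :: q by rewrite inE negb_or xt.
  have xrtq : x \notin map r (t :: q) by rewrite Er mem_rcons inE negb_or xu.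
  have rtq : r x \notin t :: q.
    by apply: contra xrtq => H; rewrite -(inv x xS') map_f.
  have rrtq : r x \notin map r (t :: q).
    by apply: contra xtq => /mapP[y yq E]; rewrite -(inv x xS') E inv // qS.
  split; last exact: inv.
  + have := Cl x xS'; rewrite Sx => /or3P[/eqP E|/eqP E|//].
    * by move: rtq; rewrite E inE eqxx.
    * by move: rrtq; rewrite E Er mem_rcons inE eqxx.
  + by apply: contra rtq => H; rewrite inE H orbT.
  + by apply: contra rrtq => H; rewrite Er mem_rcons inE H orbT.
- move=> x xI xr.
  have xS' : x \in (t :: A ++ u :: B) ++ I by rewrite Sx !mem_cat xI !orbT.
  have := plane_inner P xI; rewrite /= !(inE, mem_cat).
  case/or4P => [/eqP E|->//|/eqP E|->]; last by rewrite orbT.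
  + have : x \in map r (t :: q) by rewrite -(inv x xS') map_f // E inE eqxx.
    rewrite Er mem_rcons inE (negbTE xr) orbF => /eqP xu.
    by move: uS; rewrite -xu mem_cat xI orbT.
  + have : x = last t q by apply: (can_in_inj inv); rewrite ?inv ?E // qS // mem_last.
    move=> Ex; have /qA : last t q \in t :: q by exact: mem_last.
    by rewrite -Ex => /UB; rewrite xI.
have -> : has (fun x => (x \notin map r (belast t q)) && (r x \in I)) B =
          has_ext r (u :: B) I.
  rewrite /has_ext /= Eu inv ?qS ?mem_last //.
  have /qA /UB /negbTE -> : last t q \in t :: q by exact: mem_last.
  apply: eq_in_has => d dB /=.
  apply: andb_idl => rI; apply/negP => /mapP[y /bq yq E].
  by have := UB _ (qA _ yq); rewrite -[y]inv ?qS // -E rI.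
(* the inner word is irreducible, hence not inserted before the first letter of
   its part, which is the one to remove *)
have Jirr w x z : uniq (rot j I ++ x :: w) -> ~ red r (rot j I ++ x :: w) (x :: z).
  move=> Uw /(@red_at _ _ _ _)/(_ [::] x z erefl) [w1 [w2 [E R1 _]]].
  have [EJ _] := uniq_cat_cons_eq Uw E.
  have : [::] = w1.
    apply: red_irr R1; rewrite -EJ => y; rewrite !mem_rot => yI.
    by move: U; rewrite cat_uniq => /and3P[_ /hasPn H _]; apply/negP => /H;
      rewrite /= (plane_inner P yI).
  rewrite -EJ => /esym/eqP; rewrite -size_eq0 size_rot size_eq0.
  by rewrite (negbTE (plane_neq0 P)).
have [UA' UB' UAI UBI] := @uniq_parts _ (t :: A) (u :: B) I U.
exists j; move: Hred; rewrite Er rev_rcons; case: ifP => Hb.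
- case=> B1 [B2 [EB RA RB]].
  have PB : perm_eq (B1 ++ rot j I ++ B2) ((u :: B) ++ I) by rewrite EB perm_insert_rot.
  have Uw : uniq (B1 ++ rot j I ++ B2) by rewrite (perm_uniq PB).
  case: B1 EB RB Uw {PB} => [|b B1] /= EB RB Uw.
    by rewrite -EB in RB Uw; case: (Jirr _ _ _ Uw RB).
  case: EB RB Uw => <- -> RB Uw; exists B1, B2; split=> //.
    exact: red_cons_keep RA.
  exact: red_cons_keep RB.
- case=> A1 [A2 [EA RA RB]].
  have PA : perm_eq (A1 ++ rot j I ++ A2) ((t :: A) ++ I) by rewrite EA perm_insert_rot.
  have Uw : uniq (A1 ++ rot j I ++ A2) by rewrite (perm_uniq PA).
  case: A1 EA RA Uw {PA} => [|a A1] /= EA RA Uw.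
    by rewrite -EA in RA Uw; case: (Jirr _ _ _ Uw RA).
  case: EA RA Uw => <- -> RA Uw; exists A1, A2; split=> //.
    exact: red_cons_keep RA.
  exact: red_cons_keep RB.
Qed.

End UpDown.

(** * Isomorphisms of maps *)

(** The map [M] whose outer face is read from its corner number [k]. *)
Definition rot_cmap (D : Type) k (M : cmap D) : cmap D :=
  CMap (rot k (outer M)) (inner M) (mrev M).

(** [is_iso] for maps whose outer faces are read from corresponding corners. *)
Definition iso (D D' : eqType) (M : cmap D) (M' : cmap D') (g : D -> D') : Prop :=
  [/\ {in darts M &, injective g}, map g (outer M) = outer M',
      map g (inner M) = inner M' &
      {in darts M, forall d, g (mrev M d) = mrev M' (g d)}].

Definition mrev_closed (D : eqType) (M : cmap D) :=
  {in darts M, forall d, mrev M d \in darts M}.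

Lemma is_isoE (D D' : eqType) (M : cmap D) (M' : cmap D') k g :
  is_iso M M' k g <-> iso M (rot_cmap k M') g.
Proof. by []. Qed.

Lemma iso_darts (D D' : eqType) (M : cmap D) (M' : cmap D') g :
  iso M M' g -> map g (darts M) = darts M'.
Proof. by case=> _ E1 E2 _; rewrite /darts map_cat E1 E2. Qed.

Lemma iso_comp (D1 D2 D3 : eqType) (M1 : cmap D1) (M2 : cmap D2) (M3 : cmap D3) g h :
  iso M1 M2 g -> iso M2 M3 h -> iso M1 M3 (h \o g).
Proof.
move=> H1 H2; have E := iso_darts H1; case: H1 H2 => I1 O1 N1 C1 [I2 O2 N2 C2].
have S x : x \in darts M1 -> g x \in darts M2 by rewrite -E => /(map_f g).
split.
- move=> x y xM yM /= /I2 Exy; apply: I1 => //; apply: Exy; exact: S.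
- by rewrite map_comp O1.
- by rewrite map_comp N1.
- by move=> x xM /=; rewrite C1 // C2 // S.
Qed.

(** The default value [d0] only serves to make the inverse a total function. *)
Lemma iso_inv (D D' : eqType) (M : cmap D) (M' : cmap D') g (d0 : D) :
  mrev_closed M -> iso M M' g ->
  exists g', [/\ iso M' M g', {in darts M, cancel g g'} & {in darts M', cancel g' g}].
Proof.
move=> C H; have E := iso_darts H; case: H => I1 O1 N1 C1.
pose g' y := nth d0 (darts M) (index y (map g (darts M))).
have K : {in darts M, cancel g g'}.
  move=> x xM; have Hi : index (g x) (map g (darts M)) < size (darts M).
    by rewrite -(size_map g) index_mem map_f.
  by apply: I1 => //; rewrite ?mem_nth // -(nth_map _ (g x)) // nth_index // map_f.
have Kd s : {subset s <= darts M} -> map g' (map g s) = s.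
  move=> sub; rewrite -map_comp -[RHS]map_id; apply/eq_in_map => x /sub xM /=.
  exact: K.
have K' : {in darts M', cancel g' g}.
  by rewrite -E => _ /mapP[x xM ->]; rewrite K.
exists g'; split=> //; split=> //.
- exact: can_in_inj K'.
- by rewrite -O1 Kd // => x xO; rewrite mem_cat xO.
- by rewrite -N1 Kd // => x xO; rewrite mem_cat xO orbT.
- rewrite -E => _ /mapP[x xM ->]; rewrite -C1 // !K //; exact: C.
Qed.

Lemma uniq_map_inj (D T : eqType) (g : D -> T) s : uniq (map g s) ->
  {in s &, injective g}.
Proof.
elim: s => //= z s IH /andP[zs U] x y; rewrite !inE.
move=> /predU1P[->|xs] /predU1P[->|ys] //; last exact: IH.
- by move=> E; case/negP: zs; rewrite E map_f.
- by move=> E; case/negP: zs; rewrite -E map_f.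
Qed.

(** * Gluing *)

Lemma partnerE (S T : eqType) (l : seq S) (r : seq T) x y0 : size l = size r ->
  partner (zip l r) x = if x \in l then Some (nth y0 r (index x l)) else None.
Proof.
elim: l r => [|a l IH] [|b r] //= [E]; rewrite /partner /= inE eq_sym.
by case: eqP => //= _; rewrite -IH.
Qed.

Lemma partner_swap (S T : eqType) (l : seq S) (r : seq T) :
  [seq (z.2, z.1) | z <- zip l r] = zip r l.
Proof. by elim: l r => [|a l IH] [|b r] //=; rewrite IH. Qed.

Section Glue.

Variables (DL DR T : eqType) (L : cmap DL) (R : cmap DR).
Variables (l : seq DL) (r : seq DR) (gL : DL -> T) (gR : DR -> T).
Variables (rho : T -> T) (O I : seq T).

Let OL := left_kept L (zip l r).
Let OR := right_kept R (zip l r).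
Let SL := OL ++ inner L.
Let SR := OR ++ inner R.

(** The function on a gluing given by functions on its two parts. *)
Definition glue_fun (d : DL + DR) : T :=
  match d with inl x => gL x | inr y => gR y end.

Let l' := map gL l.
Let r' := map (gR \o mrev R) r.

(** A gluing is the union of what is kept from its two parts, with partners
    changed along the matched half-edges. The hypotheses say that each part is
    closed under reversal up to the matched half-edges and that [gL] and [gR]
    respect this. *)
Lemma glue_iso :
  size l = size r -> injective gL -> injective gR -> involutive (mrev R) ->
  map gL OL ++ map gR OR = O -> map gL (inner L) ++ map gR (inner R) = I ->
  uniq (O ++ I) ->
  {subset l <= SL} -> {in r, forall y, mrev R y \in SR} ->
  {in SL, forall x, x \notin l ->
     [/\ mrev L x \in SL, gL x \notin r' & gL (mrev L x) = rho (gL x)]} ->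
  {in SR, forall y, gR y \notin l' /\
     (mrev R y \notin r -> mrev R y \in SR /\ gR (mrev R y) = rho (gR y))} ->
  iso (glue L R (zip l r)) (CMap O I (rematch rho l' r')) glue_fun
  /\ mrev_closed (glue L R (zip l r)).
Proof.
move=> Elr injL injR invR EO EI U lS rS HL HR.
have dE d : d \in darts (glue L R (zip l r)) =
    match d with inl x => x \in SL | inr y => y \in SR end.
  have fi x s : ((inl x : DL + DR) \in map inl s) = (x \in s).
    by rewrite mem_map // => ? ? [].
  have fr x s : ((inr x : DL + DR) \in map inr s) = (x \in s).
    by rewrite mem_map // => ? ? [].
  have ni x s : ((inl x : DL + DR) \in map inr s) = false by apply/negP => /mapP[].
  have nr x s : ((inr x : DL + DR) \in map inl s) = false by apply/negP => /mapP[].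
  rewrite /darts /= /SL /SR; case: d => x; rewrite !mem_cat ?fi ?fr ?ni ?nr ?orbF //.
have PL x (y0 : DR) : partner (zip l r) x =
    if x \in l then Some (nth y0 r (index x l)) else None.
  exact: partnerE.
have PR y (x0 : DL) : partner [seq (z.2, z.1) | z <- zip l r] y =
    if y \in r then Some (nth x0 l (index y r)) else None.
  by rewrite partner_swap; apply: partnerE.
have injRr : injective (gR \o mrev R) by apply: inj_comp => //; exact: inv_inj.
have memr y : (gR y \in r') = (mrev R y \in r).
  by rewrite -(mem_map injRr) /= invR.
have idxr y : index (gR y) r' = index (mrev R y) r.
  by rewrite -(index_map injRr) /= invR.
have meml x : (gL x \in l') = (x \in l) by rewrite mem_map.
have idxl x : index (gL x) l' = index x l by rewrite index_map.
split; last first.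
  move=> [x|y]; rewrite !dE => Hd /=.
  - have [xl|xl] := boolP (x \in l); last first.
      have -> : partner (zip l r) x = None.
        by case: (r) PL => [|y0 r0] PL; [case: (l)|rewrite (PL x y0) (negbTE xl)].
      by case: (HL x Hd xl).
    have Hk : index x l < size r by rewrite -Elr index_mem.
    case: (r) PL Hk rS => // y0 r0 PL Hk rS.
    by rewrite (PL x y0) xl; apply: rS; rewrite mem_nth.
  - have [_ H2] := HR y Hd; have [yr|yr] := boolP (mrev R y \in r); last first.
      have -> : partner [seq (z.2, z.1) | z <- zip l r] (mrev R y) = None.
        case: (l) PR => [|x0 l0] PR; last by rewrite (PR _ x0) (negbTE yr).
        by case: (r).
      by case: (H2 yr).
    have Hk : index (mrev R y) r < size l by rewrite Elr index_mem.
    case: (l) PR Hk lS => // x0 l0 PR Hk lS.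
    by rewrite (PR _ x0) yr; apply: lS; rewrite mem_nth.
have Em s t : map glue_fun (map inl s ++ map inr t) = map gL s ++ map gR t.
  by rewrite map_cat -!map_comp.
split.
- have : uniq (map glue_fun (darts (glue L R (zip l r)))).
    by rewrite /darts map_cat !Em EO EI.
  by move=> /uniq_map_inj.
- by rewrite /= Em.
- by rewrite /= Em.
- move=> [x|y]; rewrite dE => Hd /=.
  + have [xl|xl] := boolP (x \in l); last first.
      have -> : partner (zip l r) x = None.
        by case: (r) PL => [|y0 r0] PL; [case: (l)|rewrite (PL x y0) (negbTE xl)].
      by have [_ H2 H3] := HL x Hd xl; rewrite /= H3 rematch_out ?meml.
    have Hk : index x l < size r by rewrite -Elr index_mem.
    have [y0 Hy0] : exists y0 : DR, true by case: (r) Hk => // y0; exists y0.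
    rewrite (PL x y0) xl /= /rematch meml xl idxl.
    by rewrite (nth_map y0).
  + have [H1 H2] := HR y Hd; have [yr|yr] := boolP (mrev R y \in r); last first.
      have -> : partner [seq (z.2, z.1) | z <- zip l r] (mrev R y) = None.
        case: (l) PR => [|x0 l0] PR; last by rewrite (PR _ x0) (negbTE yr).
        by case: (r).
      by have [_ H3] := H2 yr; rewrite /= H3 rematch_out ?memr.
    have Hk : index (mrev R y) r < size l by rewrite Elr index_mem.
    have [x0 Hx0] : exists x0 : DL, true by case: (l) Hk => // x0; exists x0.
    rewrite (PR _ x0) yr /= /rematch (negbTE H1) memr yr idxr.
    by rewrite (nth_map x0).
Qed.

End Glue.

(** * The two cut-and-glue constructions *)

Lemma filter_all_in (D : eqType) (p : pred D) s : {in s, forall x, p x} ->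
  filter p s = s.
Proof. by move=> H; apply/all_filterP/allP. Qed.

Lemma filter_none_in (D : eqType) (p : pred D) s : {in s, forall x, ~~ p x} ->
  filter p s = [::].
Proof.
by move=> H; rewrite (eq_in_filter (a2 := pred0)) ?filter_pred0 // => x /H /negbTE.
Qed.

Lemma hrevK : involutive hrev.
Proof. by case. Qed.

Lemma map_hrev_path_rev q : map hrev (path_rev q) = rev q.
Proof. by rewrite /path_rev map_rev -map_comp (eq_map hrevK) map_id. Qed.

(** The path contributes no extra half-edge unless [B] contains one. *)
Lemma inner_on_rightE A B I q : cut hrev A B I q ->
  {in A ++ B, forall h, is_ext h = (hrev h \in I)} ->
  inner_on_right B q = has_ext hrev B I.
Proof.
move=> C H; have [_ qA qB _ _] := cut_facts C.
have [UA UB UI] := disjoint_parts (plane_uniq C.1).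
have E : has is_ext B = has_ext hrev B I.
  by apply: eq_in_has => x xB; rewrite H // mem_cat xB orbT.
rewrite /inner_on_right has_cat E; case: has_ext qB => //= qB.
apply/negbTE/hasPn => x xq; rewrite H ?mem_cat ?qA //.
by apply: UI; rewrite -[B]cats0; exact: qB.
Qed.

Lemma mem_cat_unless (D : eqType) (A I : seq D) (b : bool) x :
  (x \in A ++ (if b then [::] else I)) = (x \in A) || ~~ b && (x \in I).
Proof. by rewrite mem_cat; case: b. Qed.

Lemma mem_cat_if (D : eqType) (B I : seq D) (b : bool) x :
  (x \in B ++ (if b then I else [::])) = (x \in B) || b && (x \in I).
Proof. by rewrite mem_cat; case: b. Qed.

(** In the right part, [inr true] is the half-edge that comes before [B], which
    [up_map] calls [inr false]. *)
Definition flip_new (x : half_edge + bool) : half_edge + bool :=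
  match x with inl d => inl d | inr b => inr (~~ b) end.

Section GlueUp.

Variables (f : seq tree) (A B q : seq half_edge).
Let I := inner (forest_map f).
Hypothesis C : cut hrev A B I q.
Hypothesis Hext : {in A ++ B, forall h, is_ext h = (hrev h \in I)}.

Let L := add_dangling (left_part f A B q).
Let R := add_dangling (right_part f A B q).
Let l : seq (half_edge + bool) := inr true :: map inl q.
Let r : seq (half_edge + bool) := rcons (map inl q) (inr false).

Lemma size_up_lr : size l = size r.
Proof. by rewrite size_rcons. Qed.

(** [A] contains no reverse of a half-edge of the path, and [B] no half-edge of
    the path. *)
Lemma cut_disjoint :
  [/\ {in A, forall x, hrev x \notin q},
      {in B, forall x, x \notin q} &
      {in A, forall x, x \notin map hrev q}].
Proof.
have [_ qA qB _ _] := cut_facts C; have [UA UB UI] := disjoint_parts (plane_uniq C.1).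
have H1 : {in A, forall x, hrev x \notin q}.
  move=> x xA; apply/negP => /qB; rewrite hrevK mem_cat_if.
  by rewrite (negbTE (UA _ xA)) (negbTE (UB _ xA)) andbF.
split=> // x xB; first by apply/negP => /qA /UA; rewrite xB.
by apply/negP => /mapP[y yq E]; have := H1 x xB; rewrite E hrevK yq.
Qed.

Lemma up_left_kept : left_kept L (zip l r) = inr true :: map inl A.
Proof.
have [H1 H2 H3] := cut_disjoint.
rewrite /left_kept unzip1_zip ?size_up_lr // /= filter_rcons /=.
have -> : (inr false \in l) = false by rewrite inE mem_inr.
rewrite /= map_cat filter_cat.
rewrite filter_all_in ?filter_none_in ?cats0 //.
- move=> _ /mapP[x xq ->]; rewrite negbK inE mem_inl /=.
  by have := map_f hrev xq; rewrite map_hrev_path_rev mem_rev.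
- by move=> _ /mapP[x xA ->]; rewrite inE mem_inl /= H1.
Qed.

Lemma up_right_kept : right_kept R (zip l r) = inr true :: map inl B.
Proof.
have [H1 H2 H3] := cut_disjoint.
rewrite /right_kept unzip2_zip ?size_up_lr // /= filter_rcons /=.
have -> : (inr false \in r) = true by rewrite mem_rcons inE eqxx.
have -> : (inr true \in r) = false by rewrite mem_rcons inE mem_inr.
rewrite /= map_cat filter_cat.
rewrite filter_all_in ?filter_none_in ?cats0 //.
- by move=> _ /mapP[x xq ->]; rewrite negbK mem_rcons inE mem_inl xq orbT.
- by move=> _ /mapP[x xA ->]; rewrite mem_rcons inE mem_inl /= H2.
Qed.

(** The cut-and-glue construction that adds an edge is [up_map]. *)
Lemma glue_up :
  iso (glue L R (zip l r)) (up_map hrev A B I q) (glue_fun id flip_new)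
  /\ mrev_closed (glue L R (zip l r)).
Proof.
have [H1 H2 H3] := cut_disjoint; have [_ qA qB cA cB] := cut_facts C.
have [UA UB UI] := disjoint_parts (plane_uniq C.1).
have Eright : up_right hrev q = map (flip_new \o mrev R) r.
  by rewrite /up_right map_rcons -!map_comp.
have Eleft : up_left q = map id l by rewrite map_id.
rewrite /up_map Eright Eleft.
have EI := inner_on_rightE C Hext.
set b := has_ext hrev B I in EI qB cA cB.
have innL : inner L = map inl (if b then [::] else I) by rewrite /= EI.
have innR : inner R = map inl (if b then I else [::]) by rewrite /= EI.
apply: glue_iso.
- exact: size_up_lr.
- by [].
- move=> [x|x] [y|y] //= [E].
  by rewrite (negb_inj E).
- by move=> [x|x] /=; rewrite ?hrevK ?negbK.
- by rewrite up_left_kept up_right_kept map_id /= -map_comp.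
- by rewrite innL innR map_id -map_comp; case: (b); rewrite ?cats0.
- have [P _] := cut_up C; exact: plane_uniq P.
- rewrite up_left_kept => -[x|[]];
    rewrite ?inE ?mem_inl ?mem_inr //= !(mem_cat, inE) mem_inl.
  by move=> /qA ->.
- rewrite up_right_kept innR => y; rewrite mem_rcons inE => /orP[/eqP ->|].
    by rewrite inE eqxx.
  case/mapP => x xq ->; have := qB _ xq.
  by rewrite /= inE /= -map_cat mem_inl.
- rewrite up_left_kept innL => -[x|[]];
    rewrite /= !inE ?mem_inl ?mem_inr /= -?map_cat ?mem_inl.
  + move=> xS xq; split; first exact: cA.
      rewrite -Eright mem_rcons inE mem_inl /=.
      move: xS; rewrite mem_cat_unless => /orP[/H3//|/andP[nb xI]].
      apply/negP => /mapP[y /qB Hy E]; move: Hy; rewrite -E mem_cat_if (negbTE nb) orbF.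
      by move=> /UI; rewrite xI.
    by [].
  + by [].
  + by rewrite mem_inr.
- rewrite up_right_kept innR map_id => -[x|[]];
    rewrite /= mem_rcons !inE ?mem_inl ?mem_inr /= -?map_cat ?mem_inl ?mem_inr //.
  move=> xS; split.
    move: xS; rewrite mem_cat_if => /orP[/H2//|/andP[_ xI]].
    by apply/negP => /qA /UB; rewrite xI.
  move=> xq; split=> //; apply: cB => //.
  by apply: contra xq => /mapP[y yq ->]; rewrite hrevK.
Qed.

End GlueUp.

Section GlueDown.

Variables (f : seq tree) (A B q : seq half_edge) (t : half_edge).
Let I := inner (forest_map f).
Let h := last t q.
Let u := hrev h.
Hypothesis C : cut hrev (t :: A) (u :: B) I (t :: q).
Hypothesis Hext : {in (t :: A) ++ u :: B, forall h, is_ext h = (hrev h \in I)}.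

Let L := remove_dangling (left_part f (t :: A) (u :: B) (t :: q)) t.
Let R := remove_dangling (right_part f (t :: A) (u :: B) (t :: q)) h.
Let r := belast t q.

(** The path is longer by one than its tail, so that its last half-edge is not
    matched. *)
Lemma zip_down : zip (behead (t :: q)) (t :: q) = zip q r.
Proof.
rewrite /r /=; by elim: (q) (t) => //= x q0 IH t0; rewrite IH.
Qed.

Lemma size_down_lr : size q = size r.
Proof. by rewrite size_belast. Qed.

Lemma down_facts :
  [/\ {in A, forall x, [&& x != t, x != hrev t, hrev x \notin q & x \notin map hrev r]},
      {in B, forall x, [&& x != h, x != hrev h & x \notin r]},
      t \notin q & h \notin r].
Proof.
have [Uq qA qB _ _] := cut_facts C; have U := plane_uniq C.1.
have [UA UB UI] := disjoint_parts U.
have [D1 D2 D3] := cut_disjoint C.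
have hq : h \in t :: q by exact: mem_last.
have bq x : x \in r -> x \in t :: q by rewrite lastI mem_rcons inE orbC => ->.
split.
- move=> x xA; have xA' : x \in t :: A by rewrite inE xA orbT.
  have := D1 _ xA'; rewrite inE negb_or => /andP[H1 H2].
  apply/and4P; split=> //.
  + by apply/eqP => E; move: U => /=/andP[]; rewrite -E !mem_cat xA.
  + by apply: contra H1 => /eqP ->; rewrite hrevK.
  + by apply: contra (D3 _ xA') => /mapP[y /bq yq ->]; rewrite map_f.
- move=> x xB; have xB' : x \in u :: B by rewrite inE xB orbT.
  have Hx := D2 _ xB'.
  apply/and3P; split=> //.
  + by apply: contra Hx => /eqP ->.
  + apply/eqP => E; move: U; rewrite !cat_uniq => /and3P[/and3P[_ _ /=/andP[]]].
    by rewrite -/u -/h /u -E xB.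
  + by apply: contra Hx => /bq.
- by case/andP: Uq.
- by move: Uq; rewrite lastI rcons_uniq => /andP[].
Qed.

Lemma down_left_kept : left_kept L (zip q r) = A.
Proof.
have [H1 H2 H3 H4] := down_facts.
rewrite /left_kept unzip1_zip ?size_down_lr // /= eqxx /=.
rewrite -filter_predI filter_cat filter_all_in ?filter_none_in ?cats0 //.
- move=> x; rewrite /path_rev mem_rev => /mapP[y]; rewrite inE => yq -> /=.
  rewrite hrevK; case/orP: yq => [/eqP ->|->//].
  by rewrite eqxx /= !andbF.
- by move=> x xA /=; have /and4P[-> -> -> _] := H1 x xA.
Qed.

Lemma down_right_kept : right_kept R (zip q r) = B.
Proof.
have [H1 H2 H3 H4] := down_facts.
rewrite /right_kept unzip2_zip ?size_down_lr //.
rewrite /R /remove_dangling /= -/h /u eqxx andbF.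
rewrite -filter_predI filter_cat filter_all_in ?filter_none_in ?cats0 //.
- move=> x; rewrite lastI mem_rcons inE -/h -/r => /predU1P[->|xr] /=.
    by rewrite eqxx andbF.
  by rewrite xr.
- by move=> x xB /=; have /and3P[-> -> ->] := H2 x xB.
Qed.

(** The cut-and-glue construction that removes an edge is [down_map]. *)
Lemma glue_down :
  iso (glue L R (zip q r)) (down_map hrev A B I t q) (glue_fun id id)
  /\ mrev_closed (glue L R (zip q r)).
Proof.
have [H1 H2 H3 H4] := down_facts; have [Uq qA qB cA cB] := cut_facts C.
have [UA UB UI] := disjoint_parts (plane_uniq C.1).
have Cd := cut_down C erefl.
have [_ qA' qB' cA' cB'] := cut_facts Cd.
have Ud := plane_uniq Cd.1; have [UA' UB' UI'] := disjoint_parts Ud.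
have ER : map hrev (belast t q) = map (id \o mrev R) r by [].
have EL : rematch hrev q = rematch hrev (map id q) by rewrite map_id.
rewrite /down_map ER EL.
have EI := inner_on_rightE C Hext.
have bq x : x \in r -> x \in t :: q by rewrite lastI mem_rcons inE orbC => ->.
have inv := plane_inv Cd.1.
set b := has_ext hrev (u :: B) I in EI qB cA cB.
have innL : inner L = if b then [::] else I by rewrite /= EI.
have innR : inner R = if b then I else [::] by rewrite /= EI.
have EAI x : x \in A ++ (if b then [::] else I) ->
    [/\ x != t, x != hrev t, x \notin map hrev r &
        x \in (t :: A) ++ (if b then [::] else I)].
  rewrite !mem_cat_unless inE => /orP[xA|/andP[nb xI]].
    by have /and4P[-> -> _ ->] := H1 x xA; rewrite xA !orbT.
  split.
  - by apply: contraTneq xI => ->; apply: UB; rewrite inE eqxx.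
  - apply: contraTneq xI => E; have := qB t; rewrite inE eqxx mem_cat_if => /(_ isT).
    by rewrite (negbTE nb) orbF -E => /UI.
  - apply/negP => /mapP[y /bq /qB + E]; rewrite -E mem_cat_if (negbTE nb) orbF => /UI.
    by rewrite xI.
  - by rewrite nb xI orbT.
have EBI x : x \in B ++ (if b then I else [::]) ->
    [/\ x != h, x != hrev h, x \notin q & x \in (u :: B) ++ (if b then I else [::])].
  rewrite !mem_cat_if inE => /orP[xB|/andP[nb xI]].
    have /and3P[-> -> _] := H2 x xB; rewrite xB !orbT; split=> //.
    by apply/negP => /qA' /UA'; rewrite xB.
  split.
  - by apply: contraTneq xI => ->; apply/UB/qA/mem_last.
  - by apply: contraTneq xI => ->; apply: UI; rewrite inE eqxx.
  - by apply/negP => /qA' /UB'; rewrite xI.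
  - by rewrite nb xI !orbT.
apply: glue_iso.
- exact: size_down_lr.
- by [].
- by [].
- exact: hrevK.
- by rewrite down_left_kept down_right_kept !map_id.
- by rewrite innL innR !map_id; case: (b); rewrite ?cats0.
- exact: Ud.
- by rewrite down_left_kept => x /qA' xA; rewrite mem_cat xA.
- rewrite down_right_kept innR => y yr /=.
  have := qB _ (bq _ yr); rewrite !mem_cat_if inE /u (inv_eq hrevK) hrevK.
  case: eqP => // E; by move: H4; rewrite -E yr.
- rewrite down_left_kept innL => x xA xq; have [X1 X2 X3 X4] := EAI x xA.
  split=> //.
  have := cA x X4; rewrite inE negb_or X1 xq => /(_ isT).
  rewrite !mem_cat_unless inE (inv_eq hrevK).
  by rewrite (negbTE X2).
- rewrite down_right_kept innR map_id => y yB; have [X1 X2 X3 X4] := EBI y yB.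
  split=> // yr; split=> //.
  have : y \notin map hrev (t :: q).
    apply/negP => /mapP[z]; rewrite lastI mem_rcons inE -/h -/r => zq E.
    case/predU1P: zq => [Ez|zr]; first by rewrite E Ez eqxx in X2.
    by move: yr; rewrite /= E hrevK zr.
  move=> /(cB y X4); rewrite !mem_cat_if inE /u (inv_eq hrevK) hrevK.
  by rewrite (negbTE X1).
Qed.

End GlueDown.

(** * Contours of forests *)

(** Induction on a list of trees, with the subtrees of the first tree as another
    list of trees. *)
Lemma trees_ind (P : seq tree -> Prop) : P [::] ->
  (forall us ts, P us -> P ts -> P (Node us :: ts)) -> forall ts, P ts.
Proof.
move=> P0 P1.
pose Q t := let: Node us := t in P us.
have P1' t us : Q t -> P us -> P (t :: us) by case: t => vs; exact: P1.
have HQ : forall t, Q t.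
  fix IH 1 => t; case: t => us /=.
  by induction us as [|t us IHus]; [exact: P0 | exact (P1' t us (IH t) IHus)].
by elim=> // t ts IH; apply: P1'.
Qed.

(** The contour of the edges from [x] to its children of ranks [k], [k.+1], ...
    and of their subtrees [ts]. *)
Fixpoint subtrees_contour (x : vertex) (k : nat) (ts : seq tree) : seq half_edge :=
  if ts is t :: ts' then
    Down (child x k) :: tree_contour (child x k) t
      ++ Up (child x k) :: subtrees_contour x k.+1 ts'
  else [::].

Lemma tree_contourE x ts : tree_contour x (Node ts) = subtrees_contour x 0 ts.
Proof. by rewrite /=; elim: ts 0 => //= t ts IH k; rewrite IH. Qed.

Lemma subtrees_cons x k us ts : subtrees_contour x k (Node us :: ts) =
  Down (child x k) :: subtrees_contour (child x k) 0 us
    ++ Up (child x k) :: subtrees_contour x k.+1 ts.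
Proof. by rewrite [LHS]/= -/tree_contour -tree_contourE. Qed.

Lemma subtrees_mem x k ts h : h \in subtrees_contour x k ts -> exists u j,
  k <= j /\ (h = Down (x.1, u ++ j :: x.2) \/ h = Up (x.1, u ++ j :: x.2)).
Proof.
elim/trees_ind: ts x k => // us ts IHu IHt x k.
rewrite subtrees_cons inE mem_cat inE.
case/or4P => [/eqP ->|/IHu[u [j [kj H]]]|/eqP ->|/IHt[u [j [kj H]]]].
- by exists [::], k; split=> //; left.
- by exists (rcons u j), k; split=> //; rewrite cat_rcons.
- by exists [::], k; split=> //; right.
- by exists u, j; split=> //; exact: ltnW.
Qed.

(** Vertices below distinct children of a vertex are distinct. *)
Lemma suffix_inj (T : Type) (u u' s : seq T) j j' : u ++ j :: s = u' ++ j' :: s -> j = j'.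
Proof.
elim: u u' => [|a u IH] [|b u'] //=.
- by case.
- by move=> /(congr1 size) /=; rewrite size_cat /=; lia.
- by move=> /(congr1 size) /=; rewrite size_cat /=; lia.
- by case=> _; apply: IH.
Qed.

Lemma subtrees_uniq x k ts : uniq (subtrees_contour x k ts).
Proof.
elim/trees_ind: ts x k => // us ts IHu IHt x k.
have Hu h : h \in subtrees_contour (child x k) 0 us ->
    h \in [:: Down (child x k); Up (child x k)] -> False.
  move=> /subtrees_mem[u [j [_ H]]].
  have N : (child x k).2 <> u ++ j :: (child x k).2.
    by move=> /(congr1 size); rewrite size_cat /=; lia.
  case: H => ->; rewrite !inE => /orP[] /eqP //;
    by move: (child x k) N => [a b] /= N [] *; exact: N.
have Ht h : h \in subtrees_contour x k.+1 ts ->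
    h \in [:: Down (child x k); Up (child x k)] -> False.
  move=> /subtrees_mem[u [j [kj H]]].
  have N : (child x k).2 <> u ++ j :: x.2.
    by move=> E; have := @suffix_inj _ [::] u x.2 k j E; lia.
  case: H => ->; rewrite !inE => /orP[] /eqP //; rewrite /child /= => -[] /esym; exact: N.
rewrite subtrees_cons /= mem_cat inE cat_uniq /= IHu IHt /= !andbT; apply/and3P; split.
- apply/norP; split; first by apply/negP => /Hu; apply; rewrite inE eqxx.
  by apply/negP => /Ht; apply; rewrite inE eqxx.
- apply/norP; split; first by apply/negP => /Hu; apply; rewrite !inE eqxx orbT.
  apply/hasPn => h /subtrees_mem[u [j [kj H]]]; apply/negP => /subtrees_mem[u' [j' [_ H']]].
  have E : u ++ j :: x.2 = rcons u' j' ++ k :: x.2.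
    by rewrite cat_rcons; case: H H' => -> [] [].
  by have := suffix_inj E; lia.
- by apply/negP => /Ht; apply; rewrite !inE eqxx orbT.
Qed.

Lemma subtrees_red x k ts : red hrev (subtrees_contour x k ts) [::].
Proof.
elim/trees_ind: ts x k => [|us ts IHu IHt] x k; first exact: red_nil.
by rewrite subtrees_cons; apply: red_pair.
Qed.

Lemma subtrees_size x k ts : size (subtrees_contour x k ts) = (tree_edges (Node ts)).*2.
Proof.
elim/trees_ind: ts x k => // us ts IHu IHt x k.
rewrite subtrees_cons /= size_cat /= IHu IHt /= -/tree_edges.
by rewrite -!addnn /=; lia.
Qed.

(** A walk from [x] to [y]; contrary to [is_path], it may follow the reverses
    of the extra half-edges. *)
Fixpoint walk (p : nat) (x : vertex) (w : seq half_edge) (y : vertex) : bool :=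
  if w is h :: w' then (org p h == x) && walk p (fin p h) w' y else x == y.

Lemma walk_cat p x w1 w2 y : walk p x (w1 ++ w2) y ->
  exists2 z, walk p x w1 z & walk p z w2 y.
Proof.
elim: w1 x => [|h w1 IH] x /=; first by exists x.
by case/andP => /eqP <- /IH[z H1 H2]; exists z => //; rewrite eqxx.
Qed.

Lemma cat_walk p x w1 w2 y z : walk p x w1 z -> walk p z w2 y -> walk p x (w1 ++ w2) y.
Proof. by elim: w1 x => [|h w1 IH] x /= => [/eqP ->|/andP[-> /IH]]. Qed.

Lemma walk_rev p x w y : walk p x w y -> walk p y (rev (map hrev w)) x.
Proof.
elim: w x => [|h w IH] x /=; first by move/eqP ->.
case/andP => /eqP <- /IH H; rewrite rev_cons -cats1; apply: cat_walk H _.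
by rewrite /= /fin hrevK !eqxx.
Qed.

(** A cancelling word is a closed walk, so that deleting it from a walk leaves a
    walk. *)
Lemma walk_red p w z x y : red hrev w z -> walk p x w y -> walk p x z y.
Proof.
move=> R; elim: R x y => // [h w' z' _ IH|h w1 w2 z' _ IH1 _ IH2] x y /=.
- by case/andP=> -> /IH.
- case/andP=> /eqP <- /walk_cat[v /IH1 /= /eqP <-] /andP[_].
  by rewrite {1}/fin hrevK => /IH2.
Qed.

Lemma subtrees_walk p x k ts : walk p x (subtrees_contour x k ts) x.
Proof.
elim/trees_ind: ts x k => [|us ts IHu IHt] x k; first exact: eqxx.
have Ep : parent (child x k) = x by case: x.
rewrite subtrees_cons /= Ep eqxx /=; apply: cat_walk (IHu _ _) _.
by rewrite /= eqxx /= /fin /= Ep.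
Qed.

(** The contour of trees numbered from [i], each followed by its extra half-edge. *)
Fixpoint trees_contour (i : nat) (f : seq tree) : seq half_edge :=
  if f is t :: f' then rcons (tree_contour (root i) t) (Ext i) ++ trees_contour i.+1 f'
  else [::].

Lemma contourE f : contour f = trees_contour 0 f.
Proof.
rewrite /contour.
suff H i : flatten [seq rcons (tree_contour (root j) (nth leaf f (j - i))) (Ext j)
          | j <- iota i (size f)] = trees_contour i f.
  rewrite -(H 0); congr flatten; apply/eq_in_map => j _; by rewrite subn0.
elim: f i => //= t f IH i; rewrite subnn -IH; congr (_ ++ flatten _).
apply/eq_in_map => j; rewrite mem_iota => /andP[H _].
by rewrite -[j - i]prednK ?subn_gt0 //= -subnS.
Qed.

Lemma trees_cons i us f : trees_contour i (Node us :: f) =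
  subtrees_contour (root i) 0 us ++ Ext i :: trees_contour i.+1 f.
Proof. by rewrite /trees_contour -/trees_contour tree_contourE cat_rcons. Qed.

Lemma trees_mem i f h : h \in trees_contour i f ->
  (exists x, [/\ x.2 <> [::], i <= x.1 < i + size f & h = Down x \/ h = Up x]) \/
  (exists2 j, i <= j < i + size f & h = Ext j).
Proof.
elim: f i => [|[us] f IH] i //; rewrite trees_cons mem_cat inE => /or3P[|/eqP ->|/IH H].
- move=> /subtrees_mem[u [j [_ H]]]; left; exists (i, u ++ [:: j]); split=> //=.
  + by case: u {H}.
  + by lia.
- by right; exists i => //=; lia.
- case: H => [[x [? ? ?]]|[j ? ?]]; [left; exists x|right; exists j] => //=; last by lia.
  by split=> //; lia.
Qed.

Lemma trees_mem_ext i f j : i <= j < i + size f -> Ext j \in trees_contour i f.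
Proof.
elim: f i => [|[us] f IH] i /=; first by lia.
move=> H; rewrite -/(trees_contour i (Node us :: f)) trees_cons mem_cat inE.
have [->|ne] := eqVneq j i; first by rewrite eqxx orbT.
by rewrite IH ?orbT //; lia.
Qed.

Lemma trees_uniq i f : uniq (trees_contour i f).
Proof.
elim: f i => [|[us] f IH] i //; rewrite trees_cons cat_uniq subtrees_uniq /= IH andbT.
apply/andP; split.
- apply/norP; split; first by apply/negP => /subtrees_mem[u [j [_ []]]].
  apply/hasPn => h /trees_mem H; apply/negP => /subtrees_mem[u [j [_ H']]].
  case: H H' => [[[a b] [_ /= Ha]]|[k _ ->]]; last by case.
  by case=> -> [] // [E _]; move: Ha; rewrite E; lia.
- apply/negP => /trees_mem [[x [_ _ []]]|[j Hj [E]]] //; by move: Hj; lia.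
Qed.

Lemma trees_red i f : red hrev (trees_contour i f) (map Ext (iota i (size f))).
Proof.
elim: f i => [|[us] f IH] i; first exact: red_nil.
rewrite trees_cons; apply: (@red_cat _ _ _ [::]); first exact: subtrees_red.
exact: red_keep.
Qed.

Lemma trees_walk p i f : i + size f <= p ->
  walk p (root (i %% p)) (trees_contour i f) (root ((i + size f) %% p)).
Proof.
elim: f i => [|[us] f IH] i; first by rewrite addn0 /= eqxx.
rewrite /= -/(trees_contour i (Node us :: f)) => H; rewrite trees_cons.
rewrite modn_small; last by lia.
apply: cat_walk (subtrees_walk _ _ _ _) _; rewrite /= eqxx /=.
by rewrite -addSnnS; apply: IH; lia.
Qed.

Lemma trees_size i f : size (trees_contour i f) = (forest_edges f).*2 + size f.
Proof.
elim: f i => [|[us] f IH] i //; rewrite trees_cons size_cat subtrees_size /= IH.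
by rewrite /forest_edges /= -/(tree_edges (Node us)); lia.
Qed.

Section ForestMap.

Variable f : seq tree.
Hypothesis f0 : 0 < size f.
Let p := size f.
Let I := inner (forest_map f).

Lemma innerE : I = rev (map hrev (map Ext (iota 0 p))).
Proof. by rewrite /I /= map_rev -map_comp. Qed.

Lemma mem_inner h : (h \in I) = if h is Inn i then i < p else false.
Proof.
rewrite /I /=; case: h => [x|x|i|i]; try by apply/negP => /mapP[].
by rewrite mem_map ?mem_rev ?mem_iota ?add0n // => ? ? [].
Qed.

Lemma contour_uniq : uniq (contour f).
Proof. by rewrite contourE trees_uniq. Qed.

Lemma contour_mem h : h \in contour f ->
  (exists x, [/\ x.2 <> [::], x.1 < p & h = Down x \/ h = Up x]) \/
  (exists2 j, j < p & h = Ext j).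
Proof.
rewrite contourE => /trees_mem[[x [? ? ?]]|[j ? ?]]; [left; exists x|right; exists j] => //.
Qed.

Lemma contour_ext j : (Ext j \in contour f) = (j < p).
Proof.
apply/idP/idP => [/contour_mem[[x [_ _ []]]|[k kp [->]]] //|jp].
by rewrite contourE trees_mem_ext.
Qed.

Lemma is_ext_inner h : h \in contour f -> is_ext h = (hrev h \in I).
Proof.
by rewrite mem_inner => /contour_mem[[x [_ _ [->|->]]]|[j jp ->]].
Qed.

Lemma size_contour : size (contour f) = (forest_edges f).*2 + p.
Proof. by rewrite contourE trees_size. Qed.

Lemma contour_walk : walk p (root 0) (contour f) (root 0).
Proof.
have := @trees_walk p 0 f (leqnn _); rewrite add0n modnn mod0n.
by rewrite contourE.
Qed.

(** The contour reduces to the word of the extra half-edges, which is the reverse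
    of the inner word. *)
Lemma plane_forest_map : plane hrev (contour f) I.
Proof.
have M := mem_inner; have U := contour_uniq.
have R := trees_red 0 f; rewrite -contourE -/p in R.
split.
- rewrite cat_uniq U /=; apply/andP; split.
    by apply/hasPn => h hI; apply/negP => /contour_mem[[x [_ _ []]]|[j _]] E;
      move: hI; rewrite E M.
  by rewrite innerE rev_uniq -map_comp map_inj_uniq ?iota_uniq // => ? ? [].
- move=> h; rewrite !mem_cat M => /orP[hc|].
    have := red_closed R (fun x _ => hrevK x) hc.
    case=> [/mapP[j]|->//]; rewrite mem_iota => /andP[_ jp] ->.
    by rewrite M /= jp orbT.
  by case: h => // i ip; rewrite contour_ext ip.
- by move=> h _; rewrite hrevK.
- by move=> h; rewrite M; case: h => // i ip; rewrite /= contour_ext.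
- by rewrite innerE -size_eq0 size_rev !size_map size_iota -lt0n.
- exists 0, 0; rewrite !rot0 innerE; apply: red_cat0 R _; exact: red_refl.
Qed.

End ForestMap.

(** * Paths and distances in a forest *)

Lemma fin_hrev p h : fin p (hrev h) = org p h.
Proof. by rewrite /fin hrevK. Qed.

Lemma is_pathE f x q y :
  is_path f x q y = all (mem (contour f)) q && walk (size f) x q y.
Proof. by elim: q x => //= h q IH x; rewrite IH andbA andbACA -andbA. Qed.

Lemma walk_last p x w y : walk p x w y -> y = last x (map (fin p) w).
Proof. by elim: w x => [|h w IH] x /= => [/eqP ->|/andP[_ /IH]]. Qed.

Lemma walk_prefix p z q y v : walk p z q y -> v \in z :: map (fin p) q ->
  exists q1 q2, [/\ q = q1 ++ q2, walk p z q1 v & walk p v q2 y].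
Proof.
elim: q z => [|h q IH] z.
  by rewrite inE => W /eqP ->; exists [::], [::]; rewrite /= eqxx.
have [-> W _|vz] := eqVneq v z; first by exists [::], (h :: q); rewrite /= eqxx.
rewrite [walk _ _ _ _]/= inE (negbTE vz) => /andP[E W] /(IH _ W) [q1 [q2 [-> H1 H2]]].
by exists (h :: q1), q2; split; rewrite //= E.
Qed.

Lemma walk_rot p x w k A B : walk p x w x -> rot k w = A ++ B ->
  exists z y, walk p z A y /\ walk p y B z.
Proof.
case: (rot_split k w) => X [Y [-> ->]] /walk_cat[z HX HY] E.
have := cat_walk HY HX; rewrite E => /walk_cat[y HA HB].
by exists z, y.
Qed.

(** A walk that leaves a set of vertices crosses its boundary. *)
Lemma walk_cross p (S : pred vertex) x w y : walk p x w y -> x \in S -> y \notin S ->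
  exists h, [/\ h \in w, org p h \in S & fin p h \notin S].
Proof.
elim: w x => [|h w IH] x /=; first by move=> /eqP -> ->.
case/andP => /eqP <- W xS yS; have [S'|S'] := boolP (fin p h \in S).
  by have [h' [hw ? ?]] := IH _ W S' yS; exists h'; rewrite inE hw orbT.
by exists h; rewrite inE eqxx.
Qed.

(** The vertices of the subtree rooted at [u]. *)
Definition below (u : vertex) : pred vertex :=
  [pred v | (v.1 == u.1) && suffix u.2 v.2].

Lemma below_refl u : u \in below u.
Proof. by rewrite inE eqxx suffix_refl. Qed.

Lemma parent_notin_below u : u.2 <> [::] -> parent u \notin below u.
Proof.
case: u => i [//|a s] _; rewrite inE /= eqxx /=; apply/negP => /size_suffix /=.
by rewrite ltnn.
Qed.

Lemma below_parent u x : x.2 <> [::] -> parent x \in below u -> x \in below u.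
Proof.
case: x => i [//|a s] _; rewrite !inE /= => /andP[-> /suffixP[t ->]].
by rewrite -cat_cons suffix_suffix.
Qed.

Lemma below_parentW u x : x != u -> x \in below u -> parent x \in below u.
Proof.
case: x u => i s [j s'] ne; rewrite !inE /= => /andP[/eqP E /suffixP[t Et]].
rewrite E eqxx /=; move: ne; rewrite E Et; case: t {Et} => [|a t]; first by rewrite eqxx.
by rewrite /= suffix_suffix.
Qed.

Section Paths.

Variable f : seq tree.
Hypothesis f0 : 0 < size f.
Let p := size f.

(** The only half-edge of the contour that leaves a subtree goes up from its
    root. *)
Lemma leave_below u h : h \in contour f -> u.2 <> [::] ->
  org p h \in below u -> fin p h \notin below u -> h = Up u.
Proof.
move=> /contour_mem[[x [x0 _ [->|->]]]|[j _ ->]] u0; rewrite /fin /=.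
- by move=> /(below_parent x0) ->.
- by have [-> //|ne /(below_parentW ne) ->] := eqVneq x u.
- by rewrite inE /= => /andP[_ /size_suffix] /=; case: (u.2) u0.
Qed.

Lemma enter_below u h : h \in contour f -> u.2 <> [::] ->
  org p h \notin below u -> fin p h \in below u -> h = Down u.
Proof.
move=> /contour_mem[[x [x0 _ [->|->]]]|[j _ ->]] u0; rewrite /fin /=.
- by have [-> //|ne + /(below_parentW ne)] := eqVneq x u; move=> /negbTE ->.
- by move=> /negP + /(below_parent x0).
- by move=> _; rewrite inE /= => /andP[_ /size_suffix] /=; case: (u.2) u0.
Qed.

Lemma self_avoidingP x q y : reflect
  [/\ {subset q <= contour f}, walk p x q y & uniq (x :: map (fin p) q)]
  (self_avoiding f x q y).
Proof.
rewrite /self_avoiding is_pathE -andbA.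
by apply: (iffP and3P) => -[/allP H1 H2 H3]; split=> //; exact/allP.
Qed.

(** The first half-edge of the self-avoiding path from [x] to [y], when [x] and
    [y] differ. *)
Definition next_step (x y : vertex) : half_edge :=
  if y \in below x then Down (x.1, drop (size y.2 - (size x.2).+1) y.2)
  else if x.2 == [::] then Ext x.1 else Up x.

(** A walk that starts in [S] and avoids [x] stays in [S], if leaving [S] is only
    possible by arriving at [x]. *)
Lemma walk_stay (S : pred vertex) x z q y : {subset q <= contour f} ->
  walk p z q y -> z \in S -> x \notin map (fin p) q ->
  (forall h, h \in contour f -> org p h \in S -> fin p h \notin S -> fin p h = x) ->
  y \in S.
Proof.
move=> sub W zS xq H; apply/negPn/negP => yS.
have [h [hq hS hS']] := walk_cross W zS yS.
by case/negP: xq; rewrite -(H h) ?map_f // sub.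
Qed.

(** A self-avoiding path does not come back to its origin [x], so that the first
    half-edge determines on which side of [x] it stays, and conversely. *)
Lemma self_avoiding_first x h q y : self_avoiding f x (h :: q) y -> h = next_step x y.
Proof.
case/self_avoidingP => sub /= /andP[/eqP Ex W] /and3P[xN _ _].
move: xN; rewrite inE negb_or => /andP[xh xq].
have hc : h \in contour f by apply: sub; rewrite inE eqxx.
have subq : {subset q <= contour f} by move=> h' h'q; apply: sub; rewrite inE h'q orbT.
have stay S := @walk_stay S x _ q y subq W.
rewrite /next_step.
case: (contour_mem hc) Ex xh W stay => [[u [u0 _ [->|->]]]|[j jp ->]] /=
  <- {x} xh W stay in xq *.
- have yu : y \in below u.
    apply: (stay (below u)) => //; first exact: below_refl.
    by move=> h' h'c o o'; rewrite (leave_below h'c u0 o o').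
  case: u u0 yu {xh W stay xq} => i [//|a s] _.
  rewrite /parent !inE /= => /andP[/eqP -> /suffixP[t ->]].
  rewrite eqxx /= -cat_rcons suffix_suffix.
  have -> : size (rcons t a ++ s) - (size s).+1 = size t.
    by rewrite size_cat size_rcons addSn subSS addnK.
  by rewrite cat_rcons drop_size_cat.
- have yu : y \notin below u.
    apply: (stay [pred v | v \notin below u]) => //.
    + exact: parent_notin_below.
    + move=> h' h'c o o'; rewrite negbK in o'.
      by rewrite (enter_below h'c u0 o o').
  by rewrite (negbTE yu); case: eqP.
- have yu : y.1 != j.
    apply: (stay [pred v | v.1 != j]) => //.
    + rewrite inE; apply: contra xh => /eqP E; rewrite /fin /= /root.
      by move: E; rewrite /fin /= => ->.
    + move=> h' h'c; rewrite !inE negbK.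
      case: (contour_mem h'c) => [[u [_ _ [->|->]]]|[k kp ->]] /=.
      * by move=> /negbTE ->.
      * by move=> /negbTE ->.
      * by move=> _; rewrite /fin /= => /eqP ->.
  by rewrite inE /= (negbTE yu).
Qed.

Lemma self_avoiding_tail x h q y : self_avoiding f x (h :: q) y ->
  self_avoiding f (fin p h) q y.
Proof.
case/self_avoidingP => sub /= /andP[_ W] /andP[_ U]; apply/self_avoidingP; split=> //.
by move=> h' h'q; apply: sub; rewrite inE h'q orbT.
Qed.

Lemma self_avoiding_uniq x q q' y :
  self_avoiding f x q y -> self_avoiding f x q' y -> q = q'.
Proof.
have N z h r : ~ self_avoiding f z (h :: r) z.
  move=> /self_avoidingP[_ /walk_last E /andP[/negP zN _]]; apply: zN.
  by rewrite {1}E /= mem_last.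
elim: q q' x => [|h q IH] [|h' q'] x //.
- by move=> /self_avoidingP[_ /= /eqP -> _] /N.
- by move=> H /self_avoidingP[_ /= /eqP E _]; move: H; rewrite E => /N.
- move=> H H'; have E : h = h' by rewrite (self_avoiding_first H) (self_avoiding_first H').
  by rewrite -E in H' *; rewrite (IH _ _ (self_avoiding_tail H) (self_avoiding_tail H')).
Qed.

Lemma self_avoiding_cat x a b y v : self_avoiding f x (a ++ b) y -> walk p x a v ->
  self_avoiding f x a v /\ self_avoiding f v b y.
Proof.
case/self_avoidingP => sub W U Wa; have Ev := walk_last Wa.
move: U; rewrite map_cat -cat_cons lastI -Ev => U.
split; apply/self_avoidingP; split=> //.
- by move=> h ha; apply: sub; rewrite mem_cat ha.
- by move: U; rewrite Ev -lastI cat_uniq => /and3P[].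
- by move=> h hb; apply: sub; rewrite mem_cat hb orbT.
- case/walk_cat: W => z W1 W2.
  by rewrite Ev -(walk_last W1).
- by move: U; rewrite cat_rcons cat_uniq => /and3P[].
Qed.

(** Deleting the loops of a path makes it self-avoiding. *)
Lemma path_shorten x q y : is_path f x q y ->
  exists2 q', self_avoiding f x q' y & size q' <= size q.
Proof.
elim: q x => [|h q IH] x.
  by move=> /eqP ->; exists [::] => //; rewrite /self_avoiding /= eqxx.
move=> /= /and3P[hc /eqP Ex /IH[q' H le]].
have [/self_avoidingP [sub W U]] := H.
have [xq|xq] := boolP (x \in fin p h :: map (fin p) q').
  have [a [b [E Wa Wb]]] := walk_prefix W xq; rewrite E in H.
  have [_ Hb] := self_avoiding_cat H Wa; exists b => //.
  by apply: leq_trans (leqW le); rewrite E size_cat leq_addl.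
exists (h :: q') => //; apply/self_avoidingP; split.
- by move=> h'; rewrite inE => /predU1P[->|/sub].
- by rewrite /= Ex eqxx.
- by rewrite /= xq.
Qed.

(** The self-avoiding path is a shortest path. *)
Lemma self_avoiding_dist x q y : self_avoiding f x q y -> is_dist f x y (size q).
Proof.
move=> H; split; first by exists q => //; case/andP: H.
by move=> r /path_shorten[r' H' le]; rewrite (self_avoiding_uniq H H').
Qed.

Lemma is_dist_fun x y d d' : is_dist f x y d -> is_dist f x y d' -> d = d'.
Proof.
move=> [[q H <-] M] [[q' H' <-] M'].
by apply/eqP; rewrite eqn_leq M // M'.
Qed.

Lemma directed_away_last v q h :
  self_avoiding f v (rcons q h) (fin p h) -> directed_away f v h.
Proof.
move=> H; exists (size q), (size q).+1; split=> //.
- apply: self_avoiding_dist; rewrite -cats1 in H.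
  apply: (proj1 (self_avoiding_cat H _)).
  case/self_avoidingP: H => _ /walk_cat[z W1 /= /andP[/eqP E _]] _.
  by rewrite E.
- by rewrite -(size_rcons q h); exact: self_avoiding_dist.
Qed.

Lemma directed_away_rcons v q h : h \in contour f -> directed_away f v h ->
  self_avoiding f v q (org p h) -> self_avoiding f v (rcons q h) (fin p h).
Proof.
move=> hc [d [d' [D D' lt]]] H; have [/self_avoidingP[sub W U]] := H.
have E := is_dist_fun D (self_avoiding_dist H).
apply/self_avoidingP; split.
- by move=> h'; rewrite mem_rcons inE => /predU1P[->|/sub].
- by rewrite -cats1; apply: cat_walk W _; rewrite /= !eqxx.
- rewrite map_rcons -rcons_cons rcons_uniq U andbT; apply/negP => hq.
  have [a [b [Eq Wa Wb]]] := walk_prefix W hq; rewrite Eq in H.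
  have [/self_avoiding_dist /(is_dist_fun D') E' _] := self_avoiding_cat H Wa.
  by move: lt; rewrite E E' Eq size_cat; lia.
Qed.

Lemma directed_away_anti v h : directed_away f v h -> ~ directed_away f v (hrev h).
Proof.
move=> [d [d' [D D' lt]]] [e [e' [E E' lt']]].
rewrite fin_hrev in E'; have := is_dist_fun D E'; have := is_dist_fun D' E; lia.
Qed.

(** The contour is a closed walk. *)
Lemma path_exists h1 h2 : h1 \in contour f -> h2 \in contour f ->
  exists q, self_avoiding f (org p h1) q (org p h2).
Proof.
move=> H1 H2.
have [k [B EB]] : exists k B, rot k (contour f) = h1 :: B.
  by case: (rot_to H1) => k B EB; exists k, B.
have [z [y [WA WB]]] := walk_rot (contour_walk f) (etrans EB (esym (cats0 _))).
have : h2 \in h1 :: B by rewrite -EB mem_rot.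
have sub : {subset h1 :: B <= contour f} by move=> h; rewrite -EB mem_rot.
have Ez : z = org p h1 by move: WA => /= /andP[/eqP ->].
rewrite Ez in WA; move: WA sub; case: (h1 :: B) => // h3 B3 W sub.
move=> h2B; case/splitPr: h2B W sub => X Y W sub.
case/walk_cat: W => v WX /= /andP[/eqP E _]; rewrite -E in WX.
have [|q Hq _] := @path_shorten (org p h1) X (org p h2); last by exists q.
by rewrite is_pathE WX andbT; apply/allP => h hX; apply: sub; rewrite mem_cat hX.
Qed.

(** One of the two half-edges of an edge prolongs the self-avoiding path from a
    given vertex. *)
Lemma away_exists u h1 : Down u \in contour f -> h1 \in contour f ->
  exists h q, [/\ h \in [:: Down u; Up u], self_avoiding f (org p h1) q (org p h) &
                  self_avoiding f (org p h1) (rcons q h) (fin p h)].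
Proof.
move=> Dc H1; set v := org p h1.
have u0 : u.2 <> [::] by case: (contour_mem Dc) => [[x [x0 _ [[->]|]]]|[]].
have Uc : Up u \in contour f.
  have := plane_closed (plane_forest_map f0) (x := Down u).
  by rewrite mem_cat Dc => /(_ isT); rewrite mem_cat mem_inner orbF.
have [q1 S1] : exists q, self_avoiding f v q u := path_exists H1 Uc.
have [/self_avoidingP[sub W U]] := S1.
have Eu : u = last v (map (fin p) q1) := walk_last W.
(* if the path to [u] visits the parent of [u], it is cut there and [u] is
   reached downwards; otherwise it is prolonged upwards *)
have [pq|pq] := boolP (parent u \in v :: map (fin p) q1).
- have [a [b [E Wa Wb]]] := walk_prefix W pq; rewrite E in S1 sub U.
  have [Sa Sb] := self_avoiding_cat S1 Wa.
  exists (Down u), a; split=> //; first by rewrite inE eqxx.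
  apply/self_avoidingP; split.
  + move=> h; rewrite mem_rcons inE => /predU1P[->//|ha].
    by apply: sub; rewrite mem_cat ha.
  + by rewrite -cats1; apply: cat_walk Wa _; rewrite /= !eqxx.
  + have /self_avoidingP[_ _ Ua] := Sa.
    rewrite map_rcons -rcons_cons rcons_uniq Ua andbT.
    rewrite /fin /=; apply/negP => ua.
    have ub : u \in map (fin p) b.
      have := walk_last Wb; case: (b) => [|h b0] /= Eb; last first.
        by rewrite {1}Eb mem_last.
      by have := parent_notin_below u0; rewrite -Eb below_refl.
    move: U; rewrite map_cat -cat_cons cat_uniq => /and3P[_ /hasPn /(_ _ ub)].
    by rewrite /= ua.
- exists (Up u), q1; split=> //; first by rewrite !inE eqxx orbT.
  apply/self_avoidingP; split.
  + by move=> h; rewrite mem_rcons inE => /predU1P[->//|/sub].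
  + by rewrite -cats1; apply: cat_walk W _; rewrite /= !eqxx.
  + by rewrite map_rcons -rcons_cons rcons_uniq pq U.
Qed.

(** A path that never uses both sides of an edge and misses some extra
    half-edge visits no vertex twice: to come back to a vertex it would have to
    cross a tree edge backwards or to go all the way around the inner face. *)
Lemma path_self_avoiding x q y k : is_path f x q y ->
  (forall h, h \in q -> hrev h \notin q) -> k < p -> Ext k \notin q ->
  self_avoiding f x q y.
Proof.
move=> P H kp kq; rewrite /self_avoiding P /=.
elim: q x P H kq => [|h q IH] x //= /and3P[hc /eqP Ex P] H.
rewrite inE negb_or => /andP[kh kq].
have Hq h' : h' \in q -> hrev h' \notin q.
  by move=> h'q; have := H h'; rewrite !inE h'q orbT negb_or => /(_ isT)/andP[].
have hrq : hrev h \notin q.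
  by have := H h; rewrite inE eqxx inE negb_or => /(_ isT)/andP[].
rewrite IH // andbT; apply/negP => xq.
have := P; rewrite is_pathE => /andP[/allP sub W].
have [a [b [E Wa Wb]]] := walk_prefix W xq.
have suba h' : h' \in a -> (h' \in contour f) /\ (h' \in q).
  move=> ha; have hq : h' \in q by rewrite E mem_cat ha.
  by split=> //; exact: sub.
case: (contour_mem hc) => [[u [u0 _ [Eh|Eh]]]|[j jp Eh]].
- have := walk_cross (S := below u) Wa; rewrite -Ex Eh below_refl /=.
  case=> // [|h' [ha o o']]; first exact: parent_notin_below.
  have [hc' hq'] := suba _ ha; move: hrq.
  by rewrite Eh /= -(leave_below hc' u0 o o') hq'.
- have := walk_cross (S := [pred v | v \notin below u]) Wa; rewrite -Ex Eh.
  case=> // [||h' [ha o o']].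
  + exact: parent_notin_below.
  + by rewrite inE negbK below_refl.
  have [hc' hq'] := suba _ ha; move: hrq; rewrite inE negbK in o'.
  by rewrite Eh /= -(enter_below hc' u0 o o') hq'.
- (* the number of the tree, counted cyclically from the missing extra
     half-edge *)
  pose phi (v : vertex) := if v.1 <= k then v.1 + p else v.1.
  have phiE i : i < p -> i != k -> phi (fin p (Ext i)) = (phi (root i)).+1.
    move=> ip ik; rewrite /phi /fin /=.
    have [Ei|ne] := eqVneq i.+1 p.
      by rewrite Ei modnn leq0n add0n; case: leqP => //; lia.
    rewrite modn_small; last by lia.
    move/eqP in ik; rewrite /=; case: leqP => H1; case: leqP => H2 //; lia.
  have mono z w t : walk p z w t -> {subset w <= q} -> phi z <= phi t.
    elim: w z => [|h' w IHw] z /=; first by move/eqP ->.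
    case/andP=> /eqP <- W' sw; apply: leq_trans (IHw _ W' _); last first.
      by move=> h'' hw; apply: sw; rewrite inE hw orbT.
    have hq' : h' \in q by apply: sw; rewrite inE eqxx.
    case: (contour_mem (sub _ hq')) => [[u [u0 _ [->|->]]]|[i ip Eh']] //.
    rewrite Eh' phiE // ; apply: contra kq => /eqP <-; by rewrite -Eh'.
  have := mono _ _ _ Wa (fun h' ha => (suba h' ha).2).
  rewrite -Ex Eh phiE ?ltnn //; apply: contra kh => /eqP <-; by rewrite Eh.
Qed.

End Paths.

(** * The separating path of a forest *)

(** The separating path is self-avoiding. When the inner word is inserted in [B],
    the path is obtained from the walk [A] and misses the extra half-edge of [B].
    Otherwise, the reverse path is obtained from the walk [B], which has no extra
    half-edge. *)
Lemma cut_self_avoiding f A B q k z y : 0 < size f ->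
  rot k (contour f) = A ++ B -> cut hrev A B (inner (forest_map f)) q ->
  walk (size f) z A y -> walk (size f) y B z -> self_avoiding f z q y.
Proof.
move=> f0 EAB C WA WB; set I := inner (forest_map f) in C.
have [_ qA qB _ _] := cut_facts C; have [D1 _ _] := cut_disjoint C.
have subA x : x \in A -> x \in contour f.
  by rewrite -(mem_rot k (contour f)) EAB mem_cat => ->.
have subB x : x \in B -> x \in contour f.
  by rewrite -(mem_rot k (contour f)) EAB mem_cat => ->; rewrite orbT.
have nodup h : h \in q -> hrev h \notin q by move=> /qA /D1.
have [UA _ _] := disjoint_parts (plane_uniq C.1).
suff [W [j jp jq]] : walk (size f) z q y /\ exists2 j, j < size f & Ext j \notin q.
  apply: (path_self_avoiding f0 _ nodup jp jq); rewrite is_pathE W andbT.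
  by apply/allP => x /qA /subA.
case: C.2 => j; case: ifP => Hb [X [Y [_ RA RB]]]; split.
- exact: walk_red RA WA.
- case/hasP: Hb => x xB xI; move: xB xI (subB x xB); rewrite /I mem_inner.
  case: x => // i iB ip _; exists i => //.
  by apply/negP => /qA /UA; rewrite iB.
- have := walk_rev (walk_red RB WB).
  by rewrite map_rev revK -map_comp (eq_map hrevK) map_id.
- exists 0 => //; apply/negP => /qB; rewrite Hb cats0 => /subB /contour_mem.
  by case=> [[x [_ _ []]]|[]].
Qed.

(** * Planar words are contours of forests *)

(** A cancelling word is, up to renaming, the contour of a list of subtrees. *)
Lemma realize_subtrees (D : eqType) (r : D -> D) w : red r w [::] ->
  {in w, forall d, r (r d) = d} -> forall x k, exists ts,
  size w = size (subtrees_contour x k ts) /\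
  forall d h, (d, h) \in zip w (subtrees_contour x k ts) ->
    (r d, hrev h) \in zip w (subtrees_contour x k ts).
Proof.
move=> R; move: {-2}[::] R (erefl ([::] : seq D)) => z R.
elim: R => // [_ _ x k|d w1 w2 z' _ IH1 _ IH2 Ez inv x k]; first by exists [::].
have [|us [Es1 H1]] := IH1 erefl _ (child x k) 0.
  by move=> d' Hd; apply: inv; rewrite !(inE, mem_cat) Hd !orbT.
have [|ts [Es2 H2]] := IH2 Ez _ x k.+1.
  by move=> d' Hd; apply: inv; rewrite !(inE, mem_cat) Hd !orbT.
exists (Node us :: ts); rewrite subtrees_cons; split.
  by rewrite /= !size_cat /= Es1 Es2.
rewrite /= zip_cat //= => d' h.
rewrite !(inE, mem_cat) => /or4P[/eqP[-> ->]|/H1->|/eqP[-> ->]|/H2->]; rewrite ?orbT //=.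
  by rewrite eqxx !orbT.
by rewrite inv ?eqxx // !(inE, mem_cat) eqxx.
Qed.

(** A word that reduces to [es] is, up to renaming and up to a last cancelling
    factor [w2], the contour of trees whose extra half-edges correspond to
    [es]. *)
Lemma realize_trees (D : eqType) (r : D -> D) es : forall w i, red r w es ->
  {in w, forall d, r (r d) = d} -> exists w1 w2 f,
  [/\ w = w1 ++ w2, size f = size es, size w1 = size (trees_contour i f),
      forall x, last x w1 = last x es &
      (forall d h, (d, h) \in zip w1 (trees_contour i f) ->
        (r d, hrev h) \in zip w1 (trees_contour i f) \/
        (d, h) \in zip es (map Ext (iota i (size es)))) /\
      {subset zip es (map Ext (iota i (size es))) <= zip w1 (trees_contour i f)}].
Proof.
elim: es => [|e es IH] w i R inv; first by exists [::], w, [::]; split.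
have [w0 [w1 [Ew R0 R1]]] := @red_at _ _ _ _ R [::] e es erefl.
have inv0 : {in w0, forall d, r (r d) = d}.
  by move=> d Hd; apply: inv; rewrite Ew mem_cat Hd.
have inv1 : {in w1, forall d, r (r d) = d}.
  by move=> d Hd; apply: inv; rewrite Ew mem_cat inE Hd !orbT.
have [us [Eus Hus]] := realize_subtrees R0 inv0 (root i) 0.
have [w1' [w2 [f [Ew1 Ef Es El [Hf Hs]]]]] := IH w1 i.+1 R1 inv1.
exists (w0 ++ e :: w1'), w2, (Node us :: f); rewrite trees_cons; split.
- by rewrite Ew Ew1 -catA.
- by rewrite /= Ef.
- by rewrite !size_cat /= Eus Es.
- by move=> x; rewrite last_cat /= El.
- rewrite zip_cat //=; split=> [d h|x].
  + rewrite !(inE, mem_cat) => /or3P[/Hus ->|->|/Hf[->|->]];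
      rewrite ?orbT; by [left | right].
  + by rewrite !(inE, mem_cat) => /predU1P[->|/Hs ->]; rewrite ?eqxx ?orbT.
Qed.

(** The renaming given by the positions in two words sends a letter to the letter
    with which it is zipped. *)
Lemma nth_zip_in (D T : eqType) (w : seq D) (H : seq T) h0 d h : uniq w ->
  size w = size H -> (d, h) \in zip w H -> nth h0 H (index d w) = h.
Proof.
elim: w H => [|a w IH] [|b H] //= /andP[aw U] [E]; rewrite inE.
case/predU1P=> [[-> ->]|dh]; first by rewrite eqxx.
have dw : d \in w.
  by have := map_f fst dh; rewrite -/unzip1 unzip1_zip // E.
by case: eqP => [Ea|_]; [rewrite Ea dw in aw|exact: IH].
Qed.

Lemma map_nth_index_eq (D T : eqType) (w : seq D) (H : seq T) h0 : uniq w ->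
  size w = size H -> map (fun d => nth h0 H (index d w)) w = H.
Proof.
move=> U E; case: w U E => [|d0 w] U E; first by case: H E.
apply: (@eq_from_nth _ h0); rewrite size_map // => i Hi.
by rewrite (nth_map d0) // index_uniq.
Qed.

Lemma zip_map_map (D D' T T' : Type) (a : D -> D') (b : T -> T') s t :
  zip (map a s) (map b t) = [seq (a z.1, b z.2) | z <- zip s t].
Proof. by elim: s t => [|x s IH] [|y t] //=; rewrite IH. Qed.

(** Every planar pair of words is that of a forest. The outer word is read from
    the position of the mark, after the reverse of the first letter of the inner
    word, so that it reduces to the reverse of the inner word. *)
Lemma realize_plane (D : eqType) (r : D -> D) (O I : seq D) : plane r O I ->
  exists f k g, [/\ iso (CMap O I r) (rot_cmap k (forest_map f)) g,
    size f = size I & size (contour f) = size O].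
Proof.
move=> P; have [U Cl inv inn I0 _] := P.
have [d0 [I' EI]] : exists d0 I', I = d0 :: I' by case: (I) I0 => // d0 I'; exists d0, I'.
have d0I : d0 \in I by rewrite EI inE eqxx.
have e0O := inn _ d0I.
have rr x : x \in O ++ I -> r (r x) = x by exact: inv.
have Ir x : x \in I -> r (r x) = x by move=> xI; apply: rr; rewrite mem_cat xI orbT.
have [k0 [O' EO]] : exists k0 O', rot k0 O = rcons O' (r d0).
  have [i O' E] := rot_to e0O; have [k0 Ek] := rot_rot_exists 1 i O.
  by exists k0, O'; rewrite -Ek E rot1_cons.
have UI : uniq I by move: U; rewrite cat_uniq => /and3P[].
have UO : uniq O by move: U; rewrite cat_uniq => /and3P[].
have [||j [R Hj]] := @plane_insert _ r k0 O I O' (r d0) [::] P.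
- by rewrite cats1.
- by rewrite Ir.
(* this rotation begins with the same letter as the inner word itself *)
have Ej : rot j I = I.
  case EJ: (rot j I) Hj => [|a J] /= Hj.
    by move/(congr1 size): EJ; rewrite size_rot EI.
  rewrite Ir // in Hj; rewrite Hj in EJ *; rewrite EI; congr cons.
  by apply: (@rot_head_eq _ I j 0 d0) => //; rewrite rot0 EI.
rewrite Ej cats0 -cat_rcons in R; case/red_cat_nil: R => es RW RI.
have Ees : I = rev (map r es).
  apply/esym; apply: red_irr RI => x /inn xO; apply/negP => xI.
  by move: U; rewrite cat_uniq => /and3P[_ /hasPn /(_ _ xI)]; rewrite /= xO.
set W := rcons O' (r d0) in EO RW.
have subW x : (x \in W) = (x \in O) by rewrite -EO mem_rot.
have UW : uniq W by rewrite -EO rot_uniq.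
have invW : {in W, forall d, r (r d) = d}.
  by move=> d; rewrite subW => dO; apply: rr; rewrite mem_cat dO.
have [w1 [w2 [f [EW Ef Es El [Hf Hs]]]]] := realize_trees 0 RW invW.
(* nothing follows the last extra half-edge *)
have Ew1 : W = w1.
  case: w2 EW => [|x w2] EW; first by rewrite EW cats0.
  have les y0 : last y0 es = r d0.
    have := congr1 (fun s => last y0 (map r (rev s))) Ees.
    rewrite EI revK -map_comp rev_cons map_rcons last_rcons => ->.
    rewrite (_ : map _ es = es) // -[RHS]map_id; apply/eq_in_map => y ye /=.
    by apply: invW; exact: red_sub RW _ ye.
  have w1e : r d0 \in w1.
    case: (w1) El Hs => [|a w1'] El' Hs'; last by rewrite -(les a) -El' /= mem_last.
    have : size es = size I by rewrite Ees size_rev size_map.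
    rewrite EI; case: (es) Hs' => // e es' Hs' _.
    by have := Hs' (e, Ext 0); rewrite /= inE eqxx => /(_ isT); case: (trees_contour 0 f).
  have w2e : r d0 \in x :: w2.
    have := congr1 (last x) EW; rewrite /W last_rcons last_cat /= => ->.
    by rewrite mem_last.
  move: UW; rewrite EW cat_uniq => /and3P[_ /hasPn /(_ _ w2e)].
  by rewrite /= w1e.
rewrite -Ew1 in Es El Hf Hs; rewrite -contourE in Es Hf Hs.
have szI : size f = size I by rewrite Ef Ees size_rev size_map.
have f0 : 0 < size f by rewrite szI EI.
have EIf := innerE f; rewrite Ef in EIf.
set If := inner (forest_map f) in EIf.
have szIf : size I = size If.
  by rewrite EIf size_rev !size_map size_iota Ees size_rev size_map.
have UWI : uniq (W ++ I) by rewrite (@perm_uniq _ _ (O ++ I)) // perm_cat2r -EO perm_rot.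
have szWI : size (W ++ I) = size (contour f ++ If) by rewrite !size_cat Es szIf.
have zI d h : (d, h) \in zip I If -> exists e x,
    [/\ (e, x) \in zip es (map Ext (iota 0 (size es))), d = r e & h = hrev x].
  rewrite Ees EIf -rev_zip ?size_map ?size_iota // mem_rev zip_map_map.
  by case/mapP => -[e x] ex [-> ->]; exists e, x.
have Iz e x : (e, x) \in zip es (map Ext (iota 0 (size es))) ->
    (r e, hrev x) \in zip I If.
  rewrite Ees EIf -rev_zip ?size_map ?size_iota // mem_rev zip_map_map => ex.
  by apply/mapP; exists (e, x).
pose g d := nth (Ext 0) (contour f ++ If) (index d (W ++ I)).
have gz d h : (d, h) \in zip (W ++ I) (contour f ++ If) -> g d = h.
  exact: nth_zip_in.
have corr d h : (d, h) \in zip (W ++ I) (contour f ++ If) ->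
    (r d, hrev h) \in zip (W ++ I) (contour f ++ If).
  rewrite zip_cat // !mem_cat => /orP[/Hf[->//|/Iz ->]|/zI]; rewrite ?orbT //.
  case=> e [x [ex -> ->]]; rewrite hrevK invW; first by rewrite Hs.
  apply: (red_sub RW); have := map_f fst ex.
  by rewrite -/unzip1 unzip1_zip // size_map size_iota.
have gWI : map g (W ++ I) = contour f ++ If by exact: map_nth_index_eq.
have [gW gI] : map g W = contour f /\ map g I = If.
  move/eqP: gWI; rewrite map_cat eqseq_cat ?size_map //.
  by case/andP => /eqP -> /eqP ->.
have [k1 Ek1] := rot_sym EO.
have perm x : (x \in darts (CMap O I r)) = (x \in W ++ I).
  by rewrite /darts /= !mem_cat subW.
exists f, k1, g; split=> //; last by rewrite -Es -EO size_rot.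
split.
- have inj : {in W ++ I &, injective g}.
    apply: uniq_map_inj; rewrite gWI; exact: plane_uniq (plane_forest_map f0).
  by move=> x y; rewrite !perm; apply: inj.
- by rewrite /= -gW -map_rot Ek1.
- by [].
- move=> d; rewrite perm => dWI; apply: gz; apply: corr.
  have Hi : index d (W ++ I) < size (W ++ I) by rewrite index_mem.
  rewrite -{1}(nth_index d dWI) /g -nth_zip // mem_nth //.
  by rewrite size_zip -szWI minnn.
Qed.

(** * Rigidity of forests *)

(** If a renaming that respects reversal sends a contour to a contour, both
    followed by the same fixed letter [b], then the trees are equal: the first
    half-edge [Down _] is fixed, hence its reverse, which closes the contour of
    the first subtree. *)
Lemma subtrees_rigid (h : half_edge -> half_edge) (S : {pred half_edge}) :
  {in S &, injective h} -> {in S, forall d, h (hrev d) = hrev (h d)} ->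
  forall ts ts2 x k b R R2, {subset subtrees_contour x k ts ++ b :: R <= S} -> h b = b ->
  (if b is Down _ then false else true) ->
  map h (subtrees_contour x k ts ++ b :: R) = subtrees_contour x k ts2 ++ b :: R2 ->
  ts = ts2 /\ map h R = R2.
Proof.
move=> inj com; elim/trees_ind => [|us ts IHu IHt] [|[us2] ts2] x k b R R2 sub hb bD.
- by case.
- by rewrite subtrees_cons /= => -[E]; rewrite -hb E in bD.
- rewrite subtrees_cons /= => -[E _]; exfalso.
  have E' : Down (child x k) = b.
    apply: inj; rewrite ?hb //; apply: sub;
      by rewrite subtrees_cons !(inE, mem_cat) eqxx ?orbT.
  by rewrite -E' in bD.
- rewrite !subtrees_cons /= => -[E1]; rewrite -!catA => E2.
  have sub' d : d \in subtrees_contour (child x k) 0 us ++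
      Up (child x k) :: subtrees_contour x k.+1 ts ++ b :: R -> d \in S.
    by move=> Hd; apply: sub; rewrite subtrees_cons /= inE -catA Hd orbT.
  have E3 : h (Up (child x k)) = Up (child x k).
    rewrite -[Up _]/(hrev (Down (child x k))) com ?E1 //.
    by apply: sub; rewrite subtrees_cons inE eqxx.
  have [-> E4] := IHu _ _ _ _ _ _ sub' E3 isT E2.
  have [|-> ->] := IHt _ _ _ _ _ _ _ hb bD E4 => //.
  by move=> d Hd; apply: sub'; rewrite mem_cat inE Hd !orbT.
Qed.

Lemma trees_rigid (h : half_edge -> half_edge) (S : {pred half_edge}) :
  {in S &, injective h} -> {in S, forall d, h (hrev d) = hrev (h d)} ->
  forall f f2 i, {subset trees_contour i f <= S} ->
  (forall j, i <= j < i + size f -> h (Ext j) = Ext j) -> size f = size f2 ->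
  map h (trees_contour i f) = trees_contour i f2 -> f = f2.
Proof.
move=> inj com; elim=> [|[us] f IH] [|[us2] f2] i sub hE //= [Es].
rewrite -/(trees_contour i (Node us :: f)) -/(trees_contour i (Node us2 :: f2)).
rewrite !trees_cons => E.
have sub' : {subset subtrees_contour (root i) 0 us ++ Ext i :: trees_contour i.+1 f <= S}.
  by move=> d Hd; apply: sub; rewrite trees_cons.
have [||-> E'] := subtrees_rigid inj com sub' _ _ E => //.
  by apply: hE; rewrite /=; lia.
rewrite (IH _ i.+1 _ _ Es E') //.
- by move=> d Hd; apply: sub'; rewrite mem_cat inE Hd !orbT.
- by move=> j Hj; apply: hE; rewrite /=; lia.
Qed.

Lemma contour_last f : 0 < size f -> exists Z, contour f = rcons Z (Ext (size f).-1).
Proof.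
rewrite contourE.
suff H i : 0 < size f ->
    exists Z, trees_contour i f = rcons Z (Ext (i + (size f).-1)) by exact: H 0.
elim: f i => [|[us] f IH] i // _; rewrite trees_cons.
case: f IH => [|t f] IH.
  by exists (subtrees_contour (root i) 0 us); rewrite /= addn0 cats1.
have [Z ->] := IH i.+1 isT; exists (subtrees_contour (root i) 0 us ++ Ext i :: Z).
by rewrite rcons_cat /= addSnnS.
Qed.

(** A forest is determined by its map, and a map isomorphism that preserves the
    mark is the identity: the inner word, hence the extra half-edges, are fixed,
    and so is the position of the last extra half-edge in the contour. *)
Lemma forest_rigid f1 f2 k1 k2 h : 0 < size f1 ->
  iso (rot_cmap k1 (forest_map f1)) (rot_cmap k2 (forest_map f2)) h ->
  [/\ f1 = f2, rot k1 (contour f1) = rot k2 (contour f2) &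
      {in contour f1 ++ inner (forest_map f1), forall d, h d = d}].
Proof.
move=> f0 [inj EO EI com].
have memd d : (d \in darts (rot_cmap k1 (forest_map f1))) =
              (d \in contour f1 ++ inner (forest_map f1)).
  by rewrite /darts /= !(mem_rot, mem_cat).
have P1 := plane_forest_map f0.
have szf : size f1 = size f2.
  by have := congr1 size EI; rewrite /= !size_map !size_rev !size_iota.
have com' d : d \in contour f1 ++ inner (forest_map f1) -> h (hrev d) = hrev (h d).
  by rewrite -memd => /com.
have hI i : i < size f1 -> h (Inn i) = Inn i.
  move: EI; rewrite /= -szf -map_comp => /eq_in_map E ip.
  by apply: (E i); rewrite mem_rev mem_iota.
have hE i : i < size f1 -> h (Ext i) = Ext i.
  move=> ip; rewrite -[Ext i]/(hrev (Inn i)) com' ?hI //.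
  by rewrite mem_cat mem_inner ip orbT.
have E0 : map h (contour f1) = contour f2.
  have [Z1 EZ1] := contour_last f0.
  have [|Z2 EZ2] := @contour_last f2; first by rewrite -szf.
  have [k Ek] : exists k, rot k (contour f2) = map h (contour f1).
    have [a Ea] := rot_sym (erefl (rot k1 (contour f1))).
    have [b Eb] := rot_rot_exists a k2 (contour f2); exists b.
    by rewrite -Eb -[rot k2 _]EO -map_rot Ea.
  rewrite EZ1 map_rcons hE in Ek *; last by lia.
  rewrite EZ2 szf; congr rcons.
  apply: (@rot_rcons_eq _ (contour f2) k 0 _ _ _ (contour_uniq f2) Ek).
  by rewrite rot0 EZ2 szf.
have sub d : d \in contour f1 -> d \in contour f1 ++ inner (forest_map f1).
  by rewrite mem_cat => ->.
have Ef : f1 = f2.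
  pose S := [pred d | d \in contour f1 ++ inner (forest_map f1)].
  apply: (@trees_rigid h S _ _ f1 f2 0) => //.
  - by move=> x y; rewrite !inE -!memd; apply: inj.
  - by move=> d; rewrite -contourE => /sub.
  - by rewrite -!contourE.
have hc : {in contour f1, forall d, h d = d}.
  by apply/eq_in_map; rewrite map_id E0 -Ef.
split=> //.
- rewrite -[RHS]EO -[LHS]map_id; apply/esym/eq_in_map => d.
  by rewrite /= mem_rot => /hc.
- move=> d; rewrite mem_cat => /orP[/hc //|].
  by rewrite mem_inner; case: d => // i /hI.
Qed.

(** * The two constructions on words are inverse *)

(** The decreasing construction, applied after the increasing one along the image
    of the same path, gives back the initial map. *)
Lemma iso_down_up (D T : eqType) (r : D -> D) (r' : T -> T) (A B I q : seq D)
    (O' I' : seq T) g :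
  cut r A B I q -> iso (up_map r A B I q) (CMap O' I' r') g ->
  iso (CMap (A ++ B) I r)
    (down_map r' (map (g \o inl) A) (map (g \o inl) B) I' (g (inr true))
              (map (g \o inl) q)) (g \o inl).
Proof.
move=> C [inj EO EI com]; have [_ qA qB _ _] := cut_facts C.
have [P _] := C; have inv := plane_inv P.
have dl x : x \in (A ++ B) ++ I -> inl x \in darts (up_map r A B I q).
  by rewrite /darts /= !(inE, mem_cat) !mem_inl.
have dt : inr true \in darts (up_map r A B I q) by rewrite /darts /= inE eqxx.
have injl : {in (A ++ B) ++ I &, injective (g \o inl)}.
  by move=> x y xS yS /= /(inj _ _ (dl _ xS) (dl _ yS)) [].
have qS x : x \in q -> x \in (A ++ B) ++ I by move=> /qA; rewrite !mem_cat => ->.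
have rqS x : x \in map r q -> x \in (A ++ B) ++ I.
  by case/mapP => y /qS yS ->; exact: (plane_closed P).
have Uq : uniq q by have [] := cut_facts C.
have szlr : size (up_left q) = size (up_right r q) by rewrite size_rcons /= !size_map.
have Eb : map r' (belast (g (inr true)) (map (g \o inl) q)) = map (g \o inl) (map r q).
  have El : map (mrev (up_map r A B I q)) (up_left q) = up_right r q.
    by apply: map_rematch_l => //; rewrite /= mem_inr map_inj_uniq // => ? ? [].
  have : map r' (map g (up_left q)) = map g (up_right r q).
    rewrite -El -!map_comp; apply/eq_in_map => x; rewrite inE => xl /=.
    rewrite com //; case/predU1P: xl => [->//|/mapP[y yq ->]]; exact/dl/qS.
  have -> : map g (up_left q) = g (inr true) :: map (g \o inl) q by rewrite /= -map_comp.
  have -> : map g (up_right r q) = rcons (map (g \o inl) (map r q)) (g (inr false)).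
    by rewrite /up_right map_rcons (map_comp g inl).
  by rewrite lastI map_rcons => /rcons_inj[].
split.
- by [].
- by rewrite /= map_cat.
- by rewrite map_comp.
- move=> x xS; rewrite /down_map Eb [mrev (CMap (A ++ B) I r) x]/=.
  rewrite -(rematch_id (r := r) (l := q)); last by move=> y /qS /inv.
  apply: (rematch_morph injl) => //; first by rewrite size_map.
  move=> xq xr; have := com _ (dl _ xS); rewrite /= rematch_out //.
  + by rewrite inE mem_inl.
  + by rewrite mem_rcons inE mem_inl.
Qed.

(** The increasing construction, applied after the decreasing one along the image
    of the same path, gives back the initial map. *)
Lemma iso_up_down (D T : eqType) (r : D -> D) (r' : T -> T) (A B I : seq D) t u q
    (O' I' : seq T) g :
  cut r (t :: A) (u :: B) I (t :: q) -> u = r (last t q) ->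
  iso (down_map r A B I t q) (CMap O' I' r') g ->
  exists chi,
    [/\ iso (CMap (t :: A ++ u :: B) I r)
            (up_map r' (map g A) (map g B) I' (map g q)) chi,
        chi t = inr true &
        {in q, forall x, chi x = inl (g x)}].
Proof.
move=> C Eu [inj EO EI com]; have [Uq qA _ _ _] := cut_facts C.
have [P _] := C; have inv := plane_inv P; have Cd := cut_down C Eu.
have [_ qA' qB' _ _] := cut_facts Cd; have [Pd _] := Cd.
have perm := perm_cons_cons t u A B I.
have U := plane_uniq P; rewrite (perm_uniq perm) /= inE negb_or in U.
case/and3P: U => /andP[tu tS] uS US.
have Sx x : (x \in (t :: A ++ u :: B) ++ I) = [|| x == t, x == u | x \in (A ++ B) ++ I].
  by rewrite (perm_mem perm) !inE.
(* the two removed half-edges [t] and [u] become the new ones *)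
pose chi x : T + bool :=
  if x == t then inr true else if x == u then inr false else inl (g x).
have chit : chi t = inr true by rewrite /chi eqxx.
have chiu : chi u = inr false by rewrite /chi eqxx eq_sym (negbTE tu).
have chiS x : x \in (A ++ B) ++ I -> chi x = inl (g x).
  move=> xS; rewrite /chi; case: eqP => [E|_]; first by rewrite -E xS in tS.
  by case: eqP => [E|_] //; rewrite -E xS in uS.
have qS x : x \in q -> x \in (A ++ B) ++ I by move=> /qA'; rewrite !mem_cat => ->.
have chim s : {subset s <= (A ++ B) ++ I} -> map chi s = map inl (map g s).
  by move=> sub; rewrite -map_comp; apply/eq_in_map => x /sub /chiS.
have rho_b : map (mrev (down_map r A B I t q)) q = map r (belast t q).
  by apply: map_rematch_l; [rewrite size_map size_belast|case/andP: Uq].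
have bS x : x \in map r (belast t q) -> x \in (A ++ B) ++ I.
  by rewrite -rho_b => /mapP[y /qS yS ->]; exact: (plane_closed Pd).
have Er : map r (t :: q) = rcons (map r (belast t q)) u by rewrite lastI map_rcons -Eu.
have El : up_left (map g q) = map chi (t :: q) by rewrite /= chit chim.
have Err : up_right r' (map g q) = map chi (map r (t :: q)).
  rewrite Er map_rcons chiu chim // /up_right; congr (rcons (map _ _) _).
  rewrite -rho_b -!map_comp; apply/eq_in_map => x /qS xS /=.
  by have /= -> := com _ xS.
have subA : {subset A <= (A ++ B) ++ I} by move=> x; rewrite !mem_cat => ->.
have subB : {subset B <= (A ++ B) ++ I} by move=> x; rewrite !mem_cat => ->; rewrite orbT.
have subI : {subset I <= (A ++ B) ++ I} by move=> x; rewrite !mem_cat => ->; rewrite orbT.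
have MO : map chi (t :: A ++ u :: B) = outer (up_map r' (map g A) (map g B) I' (map g q)).
  by rewrite /= map_cat /= chit chiu !chim.
have MI : map chi I = map inl I' by rewrite chim // EI.
have injc : {in (t :: A ++ u :: B) ++ I &, injective chi}.
  apply: uniq_map_inj; rewrite (perm_uniq (perm_map chi perm)) /= chit chiu.
  rewrite chim // inE !mem_inr /= map_inj_uniq; last by move=> ? ? [].
  by rewrite map_inj_in_uniq.
exists chi; split=> //; last by move=> x /qS /chiS.
split=> //.
move=> x xS; rewrite /up_map El Err [mrev (CMap _ I r) x]/=.
have qS' y : y \in t :: q -> y \in (t :: A ++ u :: B) ++ I.
  by rewrite Sx inE => /orP[->//|/qS ->]; rewrite !orbT.
rewrite -(rematch_id (r := r) (l := t :: q)); last by move=> y /qS' /inv.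
apply: (rematch_morph injc) => //.
- by move=> y /mapP[z /qS' zS ->]; exact: (plane_closed P).
- by rewrite size_map.
move=> xq xr; move: (xq) (xr); rewrite inE negb_or Er mem_rcons inE negb_or.
case/andP=> xt xq' /andP[xu xr'].
have xS' : x \in (A ++ B) ++ I by move: xS; rewrite Sx (negbTE xt) (negbTE xu).
have Erho : mrev (down_map r A B I t q) x = r x by rewrite /= rematch_out.
have rxS : r x \in (A ++ B) ++ I by rewrite -Erho; exact: (plane_closed Pd).
by have := com _ xS'; rewrite Erho !chiS //= => ->.
Qed.

(** * Numbering of corners *)

Lemma head_rot (T : Type) (x0 : T) i s : i < size s -> head x0 (rot i s) = nth x0 s i.
Proof.
move=> Hi; rewrite -nth0 /rot nth_cat size_drop subn_gt0 Hi nth_drop.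
by rewrite addn0.
Qed.

Lemma gap_le N c c' : c < N -> c' <= N -> gap N c c' <= N.
Proof. by move=> cN c'N; rewrite /gap; case: ltnP; lia. Qed.

Lemma gap_inj N c c1 c2 : c < N -> c1 <= N -> c2 <= N ->
  gap N c c1 = gap N c c2 -> c1 = c2.
Proof. by move=> cN c1N c2N; rewrite /gap; case: ltnP => H1; case: ltnP => H2; lia. Qed.

Lemma gap_surj N c a : c < N -> a <= N -> exists2 c', c' <= N & gap N c c' = a.
Proof.
move=> cN aN; have [lt|le] := ltnP (c + a) N.
  by exists (c + a).+1; rewrite /gap; [lia|case: ltnP; lia].
by exists (c + a - N); rewrite /gap; [lia|case: ltnP; lia].
Qed.

(** The half-edge that follows the second distinguished corner is reached [gap]
    half-edges after the one that follows the first corner. *)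
Lemma gap_corner (T : Type) (x0 : T) (C : seq T) c c' :
  c < size C -> c' <= size C ->
  head x0 (rot (gap (size C) c c') (rot c C)) = nth x0 C (unbump c c').
Proof.
move=> cN cN'; rewrite /gap /unbump.
have nthR i : i < size C -> nth x0 (rot c C) i =
    nth x0 C (if c + i < size C then c + i else c + i - size C).
  move=> iN; rewrite /rot nth_cat size_drop; case: ltnP => H1; case: ltnP => H2; try lia.
    by rewrite nth_drop.
  by rewrite nth_take; [congr nth; lia|lia].
have [lt|le] := ltnP c c'.
  rewrite head_rot ?size_rot; last by lia.
  by rewrite nthR; [case: ltnP => ?; congr nth; lia|lia].
have [E|ne] := eqVneq (size C - (c - c')) (size C).
  rewrite E -{1}(size_rot c C) rot_size head_rot //; congr nth; lia.
rewrite head_rot ?size_rot; last by lia.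
rewrite nthR; last by lia.
by case: ltnP => ?; congr nth; lia.
Qed.

(** * The two relations in terms of words *)

Lemma walk_head p z y A B x0 : 0 < size (A ++ B) -> walk p z A y -> walk p y B z ->
  z = org p (head x0 (A ++ B)).
Proof.
case: A => [|a A] /=; last by move=> _ /andP[/eqP ->].
by case: B => //= b B _ /eqP -> /andP[/eqP ->].
Qed.

(** For the contour of a forest, the separating path is the self-avoiding path
    between the two corners. *)
Lemma cut_the_self_avoiding f A B q k : 0 < size f ->
  rot k (contour f) = A ++ B ->
  the_self_avoiding f (org (size f) (head (Ext 0) (A ++ B))) q
                      (org (size f) (head (Ext 0) (B ++ A))) <->
  cut hrev A B (inner (forest_map f)) q.
Proof.
move=> f0 E; have [z [y [WA WB]]] := walk_rot (contour_walk f) E.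
have sAB : 0 < size (A ++ B).
  by rewrite -E size_rot size_contour; lia.
have sBA : 0 < size (B ++ A) by rewrite size_cat addnC -size_cat.
rewrite -(walk_head _ sAB WA WB) -(walk_head _ sBA WB WA).
have key q' : cut hrev A B (inner (forest_map f)) q' -> self_avoiding f z q' y.
  by move=> C; exact: cut_self_avoiding f0 E C WA WB.
split=> [[H _]|/key H].
  have [q' C] := plane_cut (plane_forest_map f0) E.
  by rewrite (self_avoiding_uniq H (key _ C)).
by split=> // q'; exact: self_avoiding_uniq.
Qed.

Lemma forest_size n p (F : forest n p) : size (val F : seq tree) = p.
Proof. by rewrite size_tuple. Qed.

Lemma forest_contour n p (F : forest n p) : size (contour (val F)) = 2 * n + p.
Proof.
rewrite size_contour forest_size; congr (_ + _).
by rewrite (eqP (valP F)) mul2n.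
Qed.

Lemma mk_forest n p (f : seq tree) : size f = p -> size (contour f) = 2 * n + p ->
  exists F : forest n p, (val F : seq tree) = f.
Proof.
move=> /eqP sf; rewrite size_contour (eqP sf) => E.
have H : forest_edges (Tuple sf) == n by apply/eqP; rewrite /=; lia.
by exists (exist _ (Tuple sf) H).
Qed.

Lemma forest_inj n p (F F' : forest n p) : (val F : seq tree) = val F' -> F = F'.
Proof. by move=> E; do 2 apply: val_inj. Qed.

Lemma forest_cc_eq n p (X X' : forest_cc n p) :
  (val (cc_forest X) : seq tree) = val (cc_forest X') ->
  cc_first X = cc_first X' :> nat -> cc_second X = cc_second X' :> nat -> X = X'.
Proof.
case: X X' => F c d [F' c' d'] /= /forest_inj -> /ord_inj -> /ord_inj ->.
by [].
Qed.

Lemma forest_ev_eq n p (Y Y' : forest_ev n p) :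
  (val (ev_forest Y) : seq tree) = val (ev_forest Y') ->
  ev_edge Y = ev_edge Y' -> ev_vertex Y = ev_vertex Y' -> Y = Y'.
Proof.
case: Y Y' => F e v He Hv [F' e' v' He' Hv'] /= /forest_inj E Ee Ev; subst.
by congr ForestEV; exact: bool_irrelevance.
Qed.

Lemma ext_cut f A B k : rot k (contour f) = A ++ B ->
  {in A ++ B, forall h, is_ext h = (hrev h \in inner (forest_map f))}.
Proof. by move=> E h; rewrite -E mem_rot; exact: is_ext_inner. Qed.

Lemma iso_glue_equiv (D T E : eqType) (M : cmap D) (N : cmap T) (F : cmap E)
    (gam : D -> T) d0 d1 (P : E -> E -> Prop) :
  iso M N gam -> mrev_closed M -> d0 \in darts M -> d1 \in darts M ->
  (exists2 g, iso M F g & P (g d0) (g d1)) <->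
  (exists2 g, iso N F g & P (g (gam d0)) (g (gam d1))).
Proof.
move=> H C H0 H1; split=> -[g Hg Pg]; last by exists (g \o gam) => //; exact: iso_comp Hg.
have [gam' [H' K _]] := iso_inv d0 C H.
by exists (g \o gam'); [exact: iso_comp H' Hg|rewrite /= !K].
Qed.

Section UpRel.

Variables (n p : nat) (X : forest_cc n p) (Y : forest_ev n.+1 p).
Hypothesis p0 : 0 < p.
Let f : seq tree := val (cc_forest X).
Let f' : seq tree := val (ev_forest Y).
Let C := rot (cc_first X) (contour f).
Let a := gap (size C) (cc_first X) (cc_second X).
Let A := take a C.
Let B := drop a C.
Let I := inner (forest_map f).

Lemma first_lt : cc_first X < size (contour f).
Proof. by rewrite forest_contour. Qed.

Lemma second_le : cc_second X <= size (contour f).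
Proof. by rewrite forest_contour -ltnS. Qed.

Lemma gap_size : a <= size C.
Proof. by apply: gap_le; rewrite size_rot ?first_lt ?second_le. Qed.

Lemma corner_first : corner_vertex f (cc_first X) = org (size f) (head (Ext 0) (A ++ B)).
Proof. by rewrite cat_take_drop /corner_vertex head_rot // first_lt. Qed.

Lemma corner_second :
  corner_vertex f (unbump (cc_first X) (cc_second X)) =
  org (size f) (head (Ext 0) (B ++ A)).
Proof.
rewrite /corner_vertex -[B ++ A]/(rot a C) /a size_rot.
by rewrite gap_corner ?first_lt ?second_le.
Qed.

Lemma Psi_up_relE : Psi_up_rel X Y <-> exists q k g,
  [/\ cut hrev A B I q, iso (up_map hrev A B I q) (rot_cmap k (forest_map f')) g,
      g (last (inr true) (map inl q)) \in [:: Down (ev_edge Y); Up (ev_edge Y)] &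
      org (size f') (g (inr true)) = ev_vertex Y].
Proof.
have f0 : 0 < size f by rewrite forest_size.
have EAB : rot (cc_first X) (contour f) = A ++ B by rewrite cat_take_drop.
have SA q := cut_the_self_avoiding q f0 EAB.
have Glue q : cut hrev A B I q ->
  let L := add_dangling (left_part f A B q) in
  let R := add_dangling (right_part f A B q) in
  let l : seq (half_edge + bool) := inr true :: map inl q in
  let r : seq (half_edge + bool) := rcons (map inl q) (inr false) in
  (exists k g,
      [/\ is_iso (glue L R (zip l r)) (forest_map f') k g,
          g (inl (last (inr true) l)) \in [:: Down (ev_edge Y); Up (ev_edge Y)] &
          org (size f') (g (inl (inr true))) = ev_vertex Y]) <->
  exists k g, [/\ iso (up_map hrev A B I q) (rot_cmap k (forest_map f')) g,
      g (last (inr true) (map inl q)) \in [:: Down (ev_edge Y); Up (ev_edge Y)] &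
      org (size f') (g (inr true)) = ev_vertex Y].
  move=> Cq L R l r.
  have [H Cl] := glue_up Cq (ext_cut EAB).
  have [_ qA _ _ _] := cut_facts Cq.
  have inl_in x : x \in inr true :: map inl A -> inl x \in darts (glue L R (zip l r)).
    move=> xA; rewrite /darts !mem_cat /=.
    by rewrite (up_left_kept Cq) (map_f _ xA).
  have H0 : inl (inr true) \in darts (glue L R (zip l r)).
    by apply: inl_in; rewrite inE eqxx.
  have H1 : inl (last (inr true) l) \in darts (glue L R (zip l r)).
    by apply: inl_in; exact: last_inl.
  pose P (h0 h1 : half_edge) := h1 \in [:: Down (ev_edge Y); Up (ev_edge Y)] /\
    org (size f') h0 = ev_vertex Y.
  have Q k := iso_glue_equiv (rot_cmap k (forest_map f')) P H Cl H0 H1.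
  split=> -[k [g [G1 G2 G3]]].
  - have [|g' G [G4 G5]] := proj1 (Q k); first by exists g.
    by exists k, g'.
  - have [|g' G [G4 G5]] := proj2 (Q k); first by exists g.
    by exists k, g'.
rewrite /Psi_up_rel -/f -/f' -/C -/A -/B corner_first corner_second.
split.
- move=> [q /SA Cq /(Glue q Cq)[k [g [H1 H2 H3]]]].
  by exists q, k, g.
- move=> [q [k [g [Cq H1 H2 H3]]]].
  exists q; first exact/SA.
  by apply/(Glue q Cq); exists k, g.
Qed.

End UpRel.

Section DownWord.

Variables (f : seq tree) (e v : vertex).
Hypothesis f0 : 0 < size f.
Let I := inner (forest_map f).
Let p := size f.

(** The contour is cut along the path [t :: q], which starts at [v] and ends with a
    half-edge of the edge [e], between the corner before [t] and the corner
    before the reverse of that last half-edge. *)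
Definition down_word (t : half_edge) (q A B : seq half_edge) (k : nat) : Prop :=
  [/\ rot k (contour f) = t :: A ++ hrev (last t q) :: B,
      cut hrev (t :: A) (hrev (last t q) :: B) I (t :: q),
      last t q \in [:: Down e; Up e] & org p t = v].

Lemma down_word_path t q A B k : down_word t q A B k ->
  self_avoiding f v (t :: q) (fin p (last t q)).
Proof.
case=> E C _ <-; rewrite -[t :: A ++ _]/((t :: A) ++ hrev (last t q) :: B) in E.
by have [H _] := proj2 (cut_the_self_avoiding _ f0 E) C.
Qed.

Lemma down_word_away t q A B k : down_word t q A B k ->
  directed_away f v (last t q) /\
  the_self_avoiding f v (belast t q) (org p (last t q)).
Proof.
move=> /down_word_path H; rewrite lastI in H; split; first exact: directed_away_last H.
have [||H1 _] := self_avoiding_cat (x := v) (a := belast t q) (b := [:: last t q])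
  (y := fin p (last t q)) (v := org p (last t q)) (f := f).
- by rewrite cats1.
- case/self_avoidingP: H => _; rewrite -cats1 => /walk_cat[z W /= /andP[/eqP -> _]] _.
  exact: W.
by split=> // q'; exact: self_avoiding_uniq.
Qed.

(** Only one of the two half-edges of [e] is directed away from [v], and the path
    to its origin is unique. *)
Lemma down_word_uniq t q A B k t' q' A' B' k' :
  down_word t q A B k -> down_word t' q' A' B' k' ->
  [/\ t = t', q = q', A = A' & B = B'].
Proof.
move=> H H'; have [D [S _]] := down_word_away H; have [D' [S' _]] := down_word_away H'.
have [E C L O] := H; have [E' C' L' O'] := H'.
have El : last t q = last t' q'.
  have N h h' : h \in [:: Down e; Up e] -> h' \in [:: Down e; Up e] ->
      h = h' \/ h' = hrev h.
    by rewrite !inE => /orP[] /eqP -> /orP[] /eqP ->; auto.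
  case: (N _ _ L L') => // Eh; rewrite Eh in D'.
  by case: (directed_away_anti f0 D D').
have : rcons (belast t q) (last t q) = rcons (belast t' q') (last t' q').
  by rewrite -El; congr rcons; rewrite -El in S'; exact: self_avoiding_uniq S S'.
rewrite -!lastI => -[Et Eq]; rewrite -Et -Eq in E' *.
have := rot_head_eq (contour_uniq f) E E'.
have U : uniq (A ++ hrev (last t q) :: B).
  by have := contour_uniq f; rewrite -(rot_uniq k) E => /andP[].
by move=> /(uniq_cat_cons_eq U)[].
Qed.

Lemma away_word h q0 : Down e \in contour f -> h \in [:: Down e; Up e] ->
  self_avoiding f v (rcons q0 h) (fin p h) ->
  let t := head h q0 in
  let C := rot (index t (contour f)) (contour f) in
  exists q A B, [/\ rcons q0 h = t :: q, take (index (hrev h) C) C = t :: A,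
    drop (index (hrev h) C) C = hrev h :: B &
    down_word t q A B (index t (contour f))].
Proof.
move=> De he H t C.
have [q Eq] : exists q, rcons q0 h = t :: q.
  by rewrite /t; case: (q0) => [|a q1]; [exists [::]|exists (rcons q1 h)].
have Eh : h = last t q by have := congr1 (last h) Eq; rewrite last_rcons.
have /self_avoidingP[sub W U] := H.
have tq : t \in rcons q0 h by rewrite Eq inE eqxx.
have tc : t \in contour f := sub _ tq.
have hc : hrev h \in contour f.
  have := plane_closed (plane_forest_map f0); move=> /(_ h).
  rewrite !mem_cat sub ?mem_rcons ?inE ?eqxx // => /(_ isT) /orP[//|].
  by rewrite mem_inner; move: he; rewrite !inE => /orP[] /eqP ->.
have Ev : org p t = v by move: W; rewrite Eq => /andP[/eqP].
have th : t != hrev h.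
  apply/eqP => E; move: U; rewrite map_rcons /= mem_rcons inE.
  by rewrite -Ev E /p -/(fin p h) eqxx.
have EC : C = t :: behead C.
  have [i s Es] := rot_to tc; rewrite /C.
  have [j Ej] : exists j, rot j (contour f) = t :: s by exists i.
  rewrite /rot (drop_nth t) ?index_mem // nth_index //.
have hC : hrev h \in C by rewrite mem_rot.
have Eu : drop (index (hrev h) C) C = hrev h :: drop (index (hrev h) C).+1 C.
  by rewrite (drop_nth t) ?index_mem // nth_index.
have Et : exists A, take (index (hrev h) C) C = t :: A.
  rewrite EC /= (negbTE th) /=; eauto.
have [A EA] := Et; set B := drop _.+1 _ in Eu.
exists q, A, B; split=> //.
have ECAB : C = (t :: A) ++ hrev h :: B by rewrite -EA -Eu cat_take_drop.
have Cut := cut_the_self_avoiding (t :: q) f0 ECAB.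
split; rewrite -?Eh //.
apply/Cut => /=; rewrite -/p Ev -Eq.
split; first exact: H.
by move=> q'; exact: self_avoiding_uniq.
Qed.

End DownWord.

Section DownRel.

Variables (n p : nat) (Y : forest_ev n.+1 p) (X : forest_cc n p).
Hypothesis p0 : 0 < p.
Let f' : seq tree := val (ev_forest Y).
Let f : seq tree := val (cc_forest X).
Let I := inner (forest_map f').

Lemma Psi_down_relE : Psi_down_rel Y X <-> exists t q A B k g,
  [/\ down_word f' (ev_edge Y) (ev_vertex Y) t q A B k,
      iso (down_map hrev A B I t q) (rot_cmap (cc_first X) (forest_map f)) g &
      gap (size (contour f)) (cc_first X) (cc_second X) = size A].
Proof.
have f0 : 0 < size f' by rewrite forest_size.
have De := ev_edgeP Y; rewrite inE /= -/f' in De.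
have Glue t q A B k : down_word f' (ev_edge Y) (ev_vertex Y) t q A B k ->
  let L := remove_dangling (left_part f' (t :: A) (hrev (last t q) :: B) (t :: q)) t in
  let R := remove_dangling (right_part f' (t :: A) (hrev (last t q) :: B) (t :: q))
                           (last t q) in
  let m := zip (behead (t :: q)) (t :: q) in
  (exists2 g, is_iso (glue L R m) (forest_map f) (cc_first X) g &
    gap (size (contour f)) (cc_first X) (cc_second X) = size (left_kept L m)) <->
  (exists2 g, iso (down_map hrev A B I t q) (rot_cmap (cc_first X) (forest_map f)) g &
    gap (size (contour f)) (cc_first X) (cc_second X) = size A).
  move=> [E C _ _] L R m.
  have Ext : {in (t :: A) ++ hrev (last t q) :: B, forall h, is_ext h = (hrev h \in I)}.
    exact: (@ext_cut f' (t :: A) (hrev (last t q) :: B) k E).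
  have [H Cl] := glue_down C Ext.
  rewrite /m zip_down (down_left_kept C).
  split=> -[g H1 H2].
    have [g' [H' _ _]] := iso_inv (inl t) Cl H.
    by move/is_isoE in H1; exists (g \o g') => //; exact: iso_comp H' H1.
  by exists (g \o glue_fun id id) => //; apply/is_isoE; exact: iso_comp H H1.
split.
- move=> [h [q0 [he aw [S _] HG]]].
  have hc : h \in contour f'.
    move: he; rewrite !inE => /orP[] /eqP -> //.
    have := plane_closed (plane_forest_map f0); move=> /(_ (Down (ev_edge Y))).
    by rewrite mem_cat De => /(_ isT); rewrite mem_cat mem_inner orbF.
  have H := directed_away_rcons f0 hc aw S.
  have [q [A [B [Eq EA EB W]]]] := away_word f0 De he H.
  move: EA EB W HG; set t := head h q0 in Eq *; move=> EA EB W HG.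
  have Eh : h = last t q by have := congr1 (last h) Eq; rewrite last_rcons.
  have [g [H1 H2]] : exists g,
      iso (down_map hrev A B I t q) (rot_cmap (cc_first X) (forest_map f)) g /\
      gap (size (contour f)) (cc_first X) (cc_second X) = size A.
    have [G _] := Glue _ _ _ _ _ W; rewrite -Eh -Eq -EA -EB in G.
    by have [g' G1 G2] := G HG; exists g'.
  by exists t, q, A, B, (index t (contour f')), g.
- move=> [t [q [A [B [k [g [W H1 H2]]]]]]].
  have [E C L O] := W; have [aw S] := down_word_away f0 W.
  exists (last t q), (belast t q); split=> //.
  have Eh : head (last t q) (belast t q) = t by case: (q).
  rewrite Eh -lastI.
  set K := rot (index t (contour f')) (contour f').
  have EK : K = t :: A ++ hrev (last t q) :: B.
    have tc : t \in contour f' by rewrite -(mem_rot k) E inE eqxx.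
    have EK : K = t :: behead K.
      by rewrite /K /rot (drop_nth t) ?index_mem // nth_index.
    rewrite EK; congr cons; exact: rot_head_eq (contour_uniq f') EK E.
  have Nu : hrev (last t q) \notin t :: A.
    have := contour_uniq f'; rewrite -(rot_uniq k) E.
    rewrite -[t :: A ++ _]/((t :: A) ++ _) cat_uniq => /and3P[_ /hasPn N _].
    by have := N (hrev (last t q)); rewrite inE eqxx => /(_ isT).
  have Ei : index (hrev (last t q)) K = size (t :: A).
    rewrite EK -[t :: A ++ _]/((t :: A) ++ _) index_cat (negbTE Nu) /= eqxx.
    by rewrite addn0.
  have EA : take (index (hrev (last t q)) K) K = t :: A.
    by rewrite Ei EK -[t :: A ++ _]/((t :: A) ++ _) take_size_cat.
  have EB : drop (index (hrev (last t q)) K) K = hrev (last t q) :: B.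
    by rewrite Ei EK -[t :: A ++ _]/((t :: A) ++ _) drop_size_cat.
  have [_ G] := Glue _ _ _ _ _ W; rewrite -EA -EB in G.
  by apply: G; exists g.
Qed.

End DownRel.

(** * The two mappings *)

(** A map closed under reversal is that of at most one forest, through at most one
    isomorphism. *)
Lemma iso_rigid (D : eqType) (M : cmap D) (d0 : D) f1 f2 k1 k2 g1 g2 :
  mrev_closed M -> 0 < size f1 ->
  iso M (rot_cmap k1 (forest_map f1)) g1 -> iso M (rot_cmap k2 (forest_map f2)) g2 ->
  [/\ f1 = f2, rot k1 (contour f1) = rot k2 (contour f2) & {in darts M, g1 =1 g2}].
Proof.
move=> Cl f0 H1 H2; have [g1' [H1' K1 _]] := iso_inv d0 Cl H1.
have [Ef Er Eh] := forest_rigid f0 (iso_comp H1' H2); split=> // x xM.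
have : g1 x \in contour f1 ++ inner (forest_map f1).
  have := map_f g1 xM; rewrite (iso_darts H1) /darts /=.
  by rewrite !(mem_rot, mem_cat).
by move=> /Eh /=; rewrite K1.
Qed.

Lemma up_closed (D : eqType) (r : D -> D) A B I q : cut r A B I q ->
  mrev_closed (up_map r A B I q).
Proof. by move=> /cut_up[P _]; exact: plane_closed P. Qed.

Lemma down_closed (D : eqType) (r : D -> D) A B I t u q :
  cut r (t :: A) (u :: B) I (t :: q) -> u = r (last t q) ->
  mrev_closed (down_map r A B I t q).
Proof. by move=> C /(cut_down C)[P _]; exact: plane_closed P. Qed.

Lemma up_last (D : eqType) (r : D -> D) A B I q : uniq q ->
  mrev (up_map r A B I q) (last (inr true) (map inl q)) = inr false.
Proof.
move=> Uq; have E : map (mrev (up_map r A B I q)) (up_left q) = up_right r q.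
  apply: map_rematch_l; first by rewrite size_rcons /= !size_map.
  by rewrite /= mem_inr map_inj_uniq // => ? ? [].
have := congr1 (last (inr true)) E.
by rewrite /up_right last_rcons /= last_map.
Qed.

Lemma rot_lt (T : Type) k (s : seq T) : 0 < size s ->
  exists2 c, c < size s & rot k s = rot c s.
Proof.
move=> s0; have [lt|le] := ltnP k (size s); first by exists k.
by exists 0 => //; rewrite rot0 rot_oversize.
Qed.

Section Main.

Variables (n p : nat).
Hypothesis p0 : 0 < p.

Lemma Psi_up_total (X : forest_cc n p) : exists Y : forest_ev n.+1 p, Psi_up_rel X Y.
Proof.
set f : seq tree := val (cc_forest X).
have f0 : 0 < size f by rewrite forest_size.
pose C := rot (cc_first X) (contour f).
pose a := gap (size C) (cc_first X) (cc_second X).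
have EAB : rot (cc_first X) (contour f) = take a C ++ drop a C by rewrite cat_take_drop.
have [q Cq] := plane_cut (plane_forest_map f0) EAB.
have [Uq qA _ _ _] := cut_facts Cq.
have [P _] := cut_up Cq; have [f' [k [g [G sf sc]]]] := realize_plane P.
have [|| F' EF'] := @mk_forest n.+1 p f'.
- by rewrite sf size_map /= size_map size_rev size_iota forest_size.
- rewrite sc size_cat /= !size_map addnS addSn -size_cat cat_take_drop size_rot.
  by rewrite forest_contour; lia.
have f0' : 0 < size f' by rewrite -EF' forest_size.
set A := take a C in EAB Cq G P qA; set B := drop a C in EAB Cq G P.
set I := inner (forest_map f) in Cq G P.
have G' : iso (up_map hrev A B I q) (rot_cmap k (forest_map f')) g := G.
have [_ EO _ com] := G'.
have gO x : x \in outer (up_map hrev A B I q) -> g x \in contour f'.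
  by move=> /(map_f g); rewrite EO /= mem_rot.
have lO : last (inr true) (map inl q) \in outer (up_map hrev A B I q).
  by rewrite mem_cat last_inl.
set hl := g (last (inr true) (map inl q)).
have hlr : hrev hl \in contour f'.
  have lD : last (inr true) (map inl q) \in darts (up_map hrev A B I q).
    by rewrite /darts mem_cat lO.
  have := com _ lD; rewrite up_last // -[mrev _ _]/(hrev hl) => <-.
  by apply: gO; rewrite mem_cat !inE eqxx orbT.
(* both sides of the edge [e] are on the outer face, so that it is not an extra
   half-edge *)
have [e He De] : exists2 e, hl \in [:: Down e; Up e] & Down e \in contour f'.
  case: (contour_mem (gO _ lO)) => [[x [_ _ [E|E]]]|[j _ E]]; rewrite -/hl in E.
  - by exists x; rewrite -?E ?inE ?eqxx //; exact: gO.
  - by exists x; [rewrite E !inE eqxx orbT|rewrite E in hlr].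
  - by move: hlr; rewrite E => /contour_mem[[x [_ _ []]]|[]].
have Ve : org (size f') (g (inr true)) \in vertices f'.
  by rewrite mem_undup map_f //; apply: gO; rewrite inE eqxx.
rewrite -EF' in De Ve.
exists (@ForestEV n.+1 p F' e _ De Ve).
apply/Psi_up_relE => //=; by exists q, k, g; split=> //; rewrite EF'.
Qed.

Lemma Psi_up_fun (X : forest_cc n p) (Y Y' : forest_ev n.+1 p) :
  Psi_up_rel X Y -> Psi_up_rel X Y' -> Y = Y'.
Proof.
move=> /(Psi_up_relE _ _ p0)[q [k [g [Cq G L V]]]].
move=> /(Psi_up_relE _ _ p0)[q' [k' [g' [Cq' G' L' V']]]].
have f0 : 0 < size (val (cc_forest X) : seq tree) by rewrite forest_size.
move: Cq Cq' G G'; set a := gap _ _ _; set C := rot _ _ => Cq Cq' G G'.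
have EAB : rot (cc_first X) (contour (val (cc_forest X))) = take a C ++ drop a C.
  by rewrite cat_take_drop.
have Eq : q' = q.
  have [_ U] := proj2 (cut_the_self_avoiding q f0 EAB) Cq.
  by have [S _] := proj2 (cut_the_self_avoiding q' f0 EAB) Cq'; rewrite (U _ S).
rewrite {}Eq in L' G' Cq'.
have [_ qA _ _ _] := cut_facts Cq.
have f0' : 0 < size (val (ev_forest Y) : seq tree) by rewrite forest_size.
have [Ef _ Eg] := iso_rigid (inr true) (up_closed Cq) f0' G G'.
have tD : inr true \in darts (up_map hrev (take a C) (drop a C)
                         (inner (forest_map (val (cc_forest X)))) q).
  by rewrite /darts inE eqxx.
have lD : last (inr true) (map inl q) \in darts (up_map hrev (take a C) (drop a C)
                         (inner (forest_map (val (cc_forest X)))) q).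
  by rewrite !mem_cat last_inl.
apply: forest_ev_eq => //.
- move: L'; rewrite !inE; move: L; rewrite Eg // !inE.
  by case/orP => /eqP -> /orP[] /eqP [].
- by rewrite -V -V' Eg // Ef.
Qed.

Lemma Psi_down_total (Y : forest_ev n.+1 p) : exists X : forest_cc n p, Psi_down_rel Y X.
Proof.
set f' : seq tree := val (ev_forest Y).
have f0 : 0 < size f' by rewrite forest_size.
have De : Down (ev_edge Y) \in contour f' := ev_edgeP Y.
have := ev_vertexP Y; rewrite mem_undup -/f' => /mapP[h1 h1c Ev].
have [h [q0 [he S0 S]]] := away_exists f0 De h1c.
rewrite -Ev in S0 S.
have [q [A [B [_ _ _ W]]]] := away_word f0 De he S.
move: W; set t := head h q0; set k := index _ _ => W.
have [E C L O] := W.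
have [P _] := cut_down C erefl; have [f [k1 [g [G sf sc]]]] := realize_plane P.
have szAB : size (A ++ B) = 2 * n + p.
  have := congr1 size E; rewrite size_rot forest_contour /= size_cat /= size_cat.
  lia.
have [|| F EF] := @mk_forest n p f.
- by rewrite sf /= size_map size_rev size_iota forest_size.
- by rewrite sc szAB.
have [|c cN Ec] := @rot_lt _ k1 (contour f); first by rewrite sc szAB; lia.
rewrite sc szAB in cN.
have [|c' c'N Eg] := @gap_surj _ _ (size A) cN; first by rewrite -szAB size_cat leq_addr.
pose X := @ForestCC n p F (Ordinal cN) (Ordinal (c'N : c' < (2 * n + p).+1)).
exists X; apply/Psi_down_relE => //; exists t, q, A, B, k, g; split=> //=.
- move: G; rewrite EF /rot_cmap /= Ec; exact.
- by rewrite EF sc szAB.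
Qed.

Lemma Psi_down_fun (Y : forest_ev n.+1 p) (X X' : forest_cc n p) :
  Psi_down_rel Y X -> Psi_down_rel Y X' -> X = X'.
Proof.
have f0' : 0 < size (val (ev_forest Y) : seq tree) by rewrite forest_size.
move=> /(Psi_down_relE _ _ p0)[t [q [A [B [k [g [W G E]]]]]]].
move=> /(Psi_down_relE _ _ p0)[t' [q' [A' [B' [k' [g' [W' G' E']]]]]]].
have [Et Eq EA EB] := down_word_uniq f0' W W'.
rewrite -Et -Eq -EA -EB in G' E'; have [_ C _ _] := W.
have f0 : 0 < size (val (cc_forest X) : seq tree) by rewrite forest_size.
have [Ef Er _] := iso_rigid t (down_closed C erefl) f0 G G'.
have Ec : cc_first X = cc_first X' :> nat.
  have := congr1 (head (Ext 0)) Er; rewrite !head_rot ?first_lt // -Ef => /eqP.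
  rewrite nth_uniq ?contour_uniq ?first_lt //; first by move/eqP.
  by rewrite Ef first_lt.
apply: forest_cc_eq => //.
apply: (@gap_inj (size (contour (val (cc_forest X)))) (cc_first X)).
- exact: first_lt.
- exact: second_le.
- by rewrite Ef second_le.
- by rewrite E Ec Ef E'.
Qed.

Lemma Psi_up_down (X : forest_cc n p) (Y : forest_ev n.+1 p) :
  Psi_up_rel X Y -> Psi_down_rel Y X.
Proof.
move=> /(Psi_up_relE _ _ p0)[q [k [g [Cq G L V]]]]; apply/Psi_down_relE => //.
move: Cq G; set f : seq tree := val (cc_forest X); set f' : seq tree := val (ev_forest Y).
set a := gap _ _ _; set C := rot _ _; set A := take _ _; set B := drop _ _.
set I := inner _ => Cq G.
have [Uq qA _ _ _] := cut_facts Cq; have [P _] := Cq.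
have [inj EO EI com] := G.
have Cu := cut_map inj com (cut_up Cq); rewrite [map g (map inl I)]EI in Cu.
pose psi := g \o inl.
exists (g (inr true)), (map psi q), (map psi A), (map psi B), k.
have El : last (g (inr true)) (map psi q) = g (last (inr true) (map inl q)).
  by rewrite -(last_map g) -map_comp.
have Eu : hrev (last (g (inr true)) (map psi q)) = g (inr false).
  rewrite El; have := com (last (inr true) (map inl q)); rewrite up_last // => -> //.
  by rewrite !mem_cat last_inl.
have H := iso_down_up Cq G.
have [x xI] : exists x, x \in I.
  by case: (I) (plane_neq0 P) => // x I' _; exists x; rewrite inE eqxx.
have Cd : cut hrev (g (inr true) :: map psi A) (g (inr false) :: map psi B)
            (inner (forest_map f')) (g (inr true) :: map psi q).
  by move: Cu; rewrite /= -!map_comp.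
have ClM : mrev_closed (CMap (A ++ B) I hrev) by exact: plane_closed P.
have [g' [H' _ _]] := iso_inv x ClM H.
exists g'; split.
- split.
  + by rewrite Eu -[LHS]EO /= map_cat /= -!map_comp.
  + by rewrite Eu.
  + by rewrite El.
  + exact: V.
- by move: H'; rewrite /rot_cmap /= -[rot _ (contour f)]/C -(cat_take_drop a C).
- by rewrite size_map size_takel ?gap_size // /a size_rot.
Qed.

Lemma Psi_down_up (Y : forest_ev n.+1 p) (X : forest_cc n p) :
  Psi_down_rel Y X -> Psi_up_rel X Y.
Proof.
move=> /(Psi_down_relE _ _ p0)[t [q [A [B [k [g [[E C L V] G Eg]]]]]]].
apply/Psi_up_relE => //.
move: E C G Eg V; set f : seq tree := val (cc_forest X).
set f' : seq tree := val (ev_forest Y).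
set I := inner _ => E C G Eg V.
have Cd := cut_down C erefl; have [inj EO EI com] := G.
have Cf := cut_map inj com Cd; rewrite [map g I]EI in Cf.
have EC : rot (cc_first X) (contour f) = map g A ++ map g B.
  by rewrite -map_cat; exact: esym EO.
have EA : take (gap (size (rot (cc_first X) (contour f))) (cc_first X) (cc_second X))
               (rot (cc_first X) (contour f)) = map g A.
  by rewrite {1}size_rot Eg EC take_size_cat ?size_map.
have EB : drop (gap (size (rot (cc_first X) (contour f))) (cc_first X) (cc_second X))
               (rot (cc_first X) (contour f)) = map g B.
  by rewrite {1}size_rot Eg EC drop_size_cat ?size_map.
have [chi [Hc ct cq]] := iso_up_down C erefl G.
have ClM : mrev_closed (CMap (t :: A ++ hrev (last t q) :: B) I hrev).
  by have [P _] := C; exact: plane_closed P.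
have [chi' [Hc' K _]] := iso_inv t ClM Hc.
have [_ qA _ _ _] := cut_facts C.
have tqD x : x \in t :: q -> x \in darts (CMap (t :: A ++ hrev (last t q) :: B) I hrev).
  by move=> /qA; rewrite /darts /= !(inE, mem_cat); case/orP => ->; rewrite ?orbT.
exists (map g q), k, chi'; rewrite EA EB; split=> //.
- by move: Hc'; rewrite /rot_cmap /= E.
- have -> : last (inr true) (map inl (map g q)) = chi (last t q).
    rewrite -ct -map_comp -(last_map chi); congr last.
    by apply/eq_in_map => y /cq ->.
  by rewrite K // tqD // mem_last.
- by rewrite -ct K // tqD // inE eqxx.
Qed.

End Main.

Theorem theorem1 (n p : nat) (hp : 0 < p) :
  exists (Psi_up : forest_cc n p -> forest_ev n.+1 p)
         (Psi_down : forest_ev n.+1 p -> forest_cc n p),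
    [/\ forall X Y, Psi_up_rel X Y <-> Psi_up X = Y,
        forall Y X, Psi_down_rel Y X <-> Psi_down Y = X,
        cancel Psi_up Psi_down &
        cancel Psi_down Psi_up].
Proof.
have [up Hup] := functional_choice _ (@Psi_up_total n p hp).
have [down Hdown] := functional_choice _ (@Psi_down_total n p hp).
exists up, down; split.
- by move=> X Y; split=> [/(Psi_up_fun hp (Hup X))|<-].
- by move=> Y X; split=> [/(Psi_down_fun hp (Hdown Y))|<-].
- by move=> X; apply: (Psi_down_fun hp (Hdown _)); exact: Psi_up_down.
- by move=> Y; apply: (Psi_up_fun hp (Hup _)); exact: Psi_down_up.
Qed.
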